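(* Let $n\in\{2,3\}$. Assume there exists a solitary wave with localized vorticity in Case I (Case I-A or Case I-B) or a vortex sheet solitary wave in Case II such that for some $\varepsilon\in(0,1/4)$ $$\eta\in C^2_{\mathrm{bdd}}(\mathbb{R}^{n-1}),\qquad \partial^\beta\eta=O\left(\frac1{|x'|^{n-1+|\beta|+4\varepsilon}}\right)\ \text{ as }|x'|\to\infty,\ 0\le|\beta|\le1,$$ $$u=O\left(\frac1{|x|^{n-1+\varepsilon}}\right)\ \text{ as }|x|\to\infty$$ (with $u_\pm$ in place of $u$ in Case II). If the total angular momentum $$\int_\Omega x^\perp \cdot \rho u \, dx\quad (n=2),\qquad \int_\Omega x \times \rho u \, dx\quad (n=3)$$ is finite, then $p=0$ (in Case II: $p_+=p_-=0$). Here $\rho\equiv1$ in Case I, and $\rho=\rho_\pm$ in $\Omega_\pm$ in Case II. Furthermore, for a vortex sheet (Case II) every nontrivial wave (that is, with $u\not\equiv0$) has infinite angular momentum.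
   Context: Write $x=(x',x_n)\in\mathbb{R}^{n-1}\times\mathbb{R}$. Fix $g>0$, $\sigma\ge0$ and a horizontal wave velocity $c=(c',0)\in\mathbb{R}^n$. $C^2_{\mathrm{bdd}}$ is the space of $C^2$ functions bounded together with their derivatives up to order two. A solitary wave is a traveling wave (written in the moving frame) whose profile $\eta:\mathbb{R}^{n-1}\to\mathbb{R}$ vanishes at infinity. In two dimensions $x^\perp=(-x_2,x_1)$, $\nabla^\perp=(-\partial_{x_2},\partial_{x_1})$. Integrals are Lebesgue integrals: the angular momentum is finite if the integrand is in $L^1(\Omega)$. Case I (one fluid). $\Omega=\{x_n<\eta(x')\}$, $S=\partial\Omega$, $N=(-\nabla\eta,1)/\sqrt{1+|\nabla\eta|^2}$ the outward unit normal. The velocity $u$ and pressure $P$ satisfy, in the weak sense, $$(u-c)\cdot\nabla u+\nabla P+ge_n=0,\quad\nabla\cdot u=0\ \text{ in }\Omega,\qquad (u-c)\cdot N=0,\quad P=\sigma\nabla\cdot N\ \text{ on }S.$$ The vorticity is $\omega=\partial_{x_1}u_2-\partial_{x_2}u_1$ if $n=2$, and $\omega=\nabla\times u$ if $n=3$. Case I-A: $\omega\in L^1(\Omega)\cap L^\infty(\Omega)$ and $|x|^k\omega\in L^1(\Omega)$ for some $k>n^2$; if $n=3$, also $\omega\cdot N=0$ on $S$ (normal trace in $H^{-1/2}(S)$, as $\omega$ is divergence free). Case I-B ($n=2$ only): $\omega=\sum_{i=1}^M\varpi^i\delta_{\xi^i}+\omega_{\mathrm{ac}}$ with $\Xi=\{\xi^1,\dots,\xi^M\}\subset\Omega$,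 $\varpi^i\in\mathbb{R}$, and $\omega_{\mathrm{ac}}$ satisfying the integrability conditions of Case I-A. The Euler equations hold in the distributional sense on $\Omega\setminus\Xi$, and $c=\big(u-\frac1{2\pi}\varpi^i\nabla^\perp\log|\cdot-\xi^i|\big)\big|_{\xi^i}$ for $i=1,\dots,M$. Case II (vortex sheet). $\Omega_-=\{x_n<\eta\}$, $\Omega_+=\{x_n>\eta\}$, $\Omega=\Omega_+\cup\Omega_-$, $S=\partial\Omega_\pm$, with constant densities $\rho_\pm>0$; $u_\pm,P_\pm$ are the restrictions of $u,P$ to $\Omega_\pm$ and $N_\pm$ is the outward unit normal to $\Omega_\pm$. One requires $$(u_\pm-c)\cdot\nabla u_\pm+\tfrac1{\rho_\pm}\nabla P_\pm+ge_n=0,\quad\nabla\cdot u_\pm=0,\quad\nabla\times u_\pm=0\ \text{ in }\Omega_\pm,$$ $$N_\pm\cdot(u_\pm-c)=0,\qquad P_+-P_-=\sigma\nabla\cdot N_+=-\sigma\nabla\cdot N_-\ \text{ on }S.$$ Dipole moments. Under these hypotheses, in Case I there is a unique $p=(p',0)\in\mathbb{R}^n$ with $u=\nabla(p\cdot x/|x|^n)+O(|x|^{-n-\varepsilon'})$ as $|x|\to\infty$ for some $\varepsilon'>0$; in Case II there are unique $p_\pm=(p_\pm',0)\in\mathbb{R}^n$ with $u_\pm=\nabla(p_\pm\cdot x/|x|^n)+O(|x|^{-n-\varepsilon'})$ as $|x|\to\infty$. *)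

(* Defs.v *)
From HB Require Import structures.
From mathcomp Require Import all_boot all_order all_algebra.
From mathcomp Require Import all_classical all_reals all_analysis.
Import Order.TTheory GRing.Theory Num.Theory.
Import numFieldNormedType.Exports.

Set Implicit Arguments.
Unset Strict Implicit.
Unset Printing Implicit Defensive.

Local Open Scope classical_set_scope.
Local Open Scope ring_scope.

(** Points of R^n are row vectors 'rV[R]_n, with the product sigma-algebra. *)
Section measurable_rV.
Context (R : realType) (n : nat).

Let coord (i : 'I_n) (x : 'rV[R]_n) : measurableTypeR R := x ord0 i.

Let rV_set0 : g_sigma_preimage coord set0.
Proof. exact: sigma_algebra0. Qed.

Let rV_setC A : g_sigma_preimage coord A -> g_sigma_preimage coord (~` A).
Proof. exact: sigma_algebraC. Qed.

Let rV_bigcup (F : (set 'rV[R]_n)^nat) :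
  (forall i, g_sigma_preimage coord (F i)) ->
  g_sigma_preimage coord (\bigcup_i (F i)).
Proof. exact: sigma_algebra_bigcup. Qed.

HB.instance Definition _ := @isMeasurable.Build
  default_measure_display
  'rV[R]_n (g_sigma_preimage coord) rV_set0 rV_setC rV_bigcup.

Lemma measurable_coord (i : 'I_n) :
  measurable_fun [set: 'rV[R]_n] (fun x : 'rV[R]_n => (x ord0 i : measurableTypeR R)).
Proof.
move=> _ Y mY; rewrite setTI; apply: sub_sigma_algebra => /=.
rewrite -bigcup_seq/=; exists i => /=; first by rewrite mem_index_enum.
by exists Y => //; rewrite setTI.
Qed.

Lemma measurable_fun_rV d (T : measurableType d) (f : T -> 'rV[R]_n) :
  (forall i, measurable_fun [set: T]
     (fun t => (f t ord0 i : measurableTypeR R))) ->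
  measurable_fun [set: T] f.
Proof.
move=> mf _ A mA; rewrite setTI.
suff : g_sigma_preimage (fun i => coord i \o f) `<=` measurable.
  apply; rewrite g_sigma_preimage_comp; exists A => //.
  by rewrite setTI.
apply: smallest_sub; first exact: sigma_algebra_measurable.
rewrite -bigcup_seq => B [i _ [Y mY <-]]; exact: mf.
Qed.

End measurable_rV.

Section coordinates.
Context (R : realType) (m : nat).

(* x = (x', x_n) in R^n, n = m + 1. *)
Definition pt (x' : 'rV[R]_m) (t : R) : 'rV[R]_m.+1 :=
  \row_j (if unlift ord_max j is Some i then x' ord0 i else t).
Definition hor (x : 'rV[R]_m.+1) : 'rV[R]_m := \row_i x ord0 (lift ord_max i).
Definition ver (x : 'rV[R]_m.+1) : R := x ord0 ord_max.

Lemma measurable_pt :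
  measurable_fun [set: 'rV[R]_m * measurableTypeR R] (fun p => pt p.1 p.2).
Proof.
apply: measurable_fun_rV => j; rewrite /pt.
case: (unliftP ord_max j) => [i ->|->].
  apply: (eq_measurable_fun (fun p : 'rV[R]_m * measurableTypeR R =>
      (p.1 ord0 i : measurableTypeR R))).
    by move=> p _; rewrite mxE liftK.
  by apply: (measurableT_comp (measurable_coord i)); exact: measurable_fst.
apply: (eq_measurable_fun (fun p : 'rV[R]_m * measurableTypeR R => p.2)).
  by move=> p _; rewrite mxE unlift_none.
exact: measurable_snd.
Qed.

End coordinates.

Section lebesgue_step.
Context (R : realType) (m : nat) (mu : {measure set 'rV[R]_m -> \bar R}).

Definition leb_step : set 'rV[R]_m.+1 -> \bar R :=
  pushforward (mu \x @lebesgue_measure R)%E (fun p => pt p.1 p.2).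

Let leb_step0 : leb_step set0 = 0%E.
Proof. by rewrite /leb_step /pushforward preimage_set0 measure0. Qed.

Let leb_step_ge0 A : (0 <= leb_step A)%E.
Proof. by rewrite /leb_step /pushforward measure_ge0. Qed.

Let leb_step_sigma_additive : semi_sigma_additive leb_step.
Proof.
move=> F mF tF mUF; rewrite /leb_step /pushforward preimage_bigcup.
apply: measure_semi_sigma_additive.
- by move=> n; rewrite -[X in measurable X]setTI; exact: (measurable_pt _ (mF n)).
- apply/trivIsetP => /= i j _ _ ij; rewrite -preimage_setI.
  by move/trivIsetP : tF => /(_ _ _ _ _ ij) ->//; rewrite preimage_set0.
- by rewrite -preimage_bigcup -[X in measurable X]setTI; exact: (measurable_pt _ mUF).
Qed.

HB.instance Definition _ := isMeasure.Build _ _ _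
  leb_step leb_step0 leb_step_ge0 leb_step_sigma_additive.

End lebesgue_step.

Fixpoint leb (R : realType) (n : nat) : {measure set 'rV[R]_n -> \bar R} :=
  match n with
  | 0 => @dirac _ 'rV[R]_0 0 R
  | m.+1 => leb_step (leb R m)
  end.

Notation integral_rV D f := (Rintegral (leb _ _) D f).

Section vector_calculus.
Context (R : realType) (n : nat).
Implicit Types (x y : 'rV[R]_n) (f : 'rV[R]_n -> R).

Definition dot x y : R := \sum_i x ord0 i * y ord0 i.

(* Euclidean norm; the norm `|x| of 'rV[R]_n is the maximum norm. *)
Definition enorm x : R := Num.sqrt (dot x x).

Definition basis_vec (i : 'I_n) : 'rV[R]_n := delta_mx ord0 i.

Definition partial (i : 'I_n) f : 'rV[R]_n -> R :=
  fun x => 'D_(basis_vec i) f x.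

Definition grad f x : 'rV[R]_n := \row_i partial i f x.

Definition divergence (F : 'rV[R]_n -> 'rV[R]_n) x : R :=
  \sum_i partial i (fun y => F y ord0 i) x.

Fixpoint Ck (k : nat) f : Prop :=
  continuous f /\
  match k with
  | 0 => True
  | j.+1 => forall i, (forall x, derivable f x (basis_vec i)) /\
                      Ck j (partial i f)
  end.

Fixpoint Ck_bdd (k : nat) f : Prop :=
  [/\ continuous f, (exists M : R, forall x, `|f x| <= M) &
  match k with
  | 0 => True
  | j.+1 => forall i, (forall x, derivable f x (basis_vec i)) /\
                      Ck_bdd j (partial i f)
  end].

(* phi \in C_c^oo(U) *)
Definition test_function (U : set 'rV[R]_n) f : Prop :=
  [/\ (forall k, Ck k f), compact (closure [set x | f x != 0]) &
      closure [set x | f x != 0] `<=` U].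

(* f \in L^1_loc(closure(Om) `&` U), U open: integrability up to the boundary
   of Om, but not near the complement of U. *)
Definition loc_integrable (U Om : set 'rV[R]_n) f : Prop :=
  forall K, compact K -> K `<=` U ->
    (leb R n).-integrable (Om `&` K) (EFin \o f).

(* f(x) = O(|x|^(-a)) as |x| -> oo in A *)
Definition bigO_infty (A : set 'rV[R]_n) f (a : R) : Prop :=
  exists C r0 : R, 0 < r0 /\
    forall x, A x -> r0 <= enorm x -> `|f x| <= C * enorm x `^ (- a).

Definition vanishes_at_infinity f : Prop :=
  forall e : R, 0 < e ->
    exists r0 : R, forall x, r0 <= enorm x -> `|f x| < e.

(* w \in L^1(Om) `&` L^oo(Om) and |x|^k w \in L^1(Om) *)
Definition localized (Om : set 'rV[R]_n) (k : R) (w : 'rV[R]_n -> R) : Prop :=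
  [/\ (leb R n).-integrable Om (EFin \o w),
      (exists M : R, {ae leb R n, forall x, Om x -> `|w x| <= M}) &
      (leb R n).-integrable Om (fun x => (enorm x `^ k * w x)%:E)].

End vector_calculus.

Section dimension2.
Context (R : realType).

Definition perp (x : 'rV[R]_2) : 'rV[R]_2 :=
  \row_j nth 0 [:: - x ord0 1; x ord0 0] j.

Definition gradperp (f : 'rV[R]_2 -> R) (x : 'rV[R]_2) : 'rV[R]_2 :=
  perp (grad f x).

End dimension2.

Definition cross (R : realType) (x y : 'rV[R]_3) : 'rV[R]_3 :=
  \row_j nth 0 [:: x ord0 1 * y ord0 2 - x ord0 2 * y ord0 1;
                   x ord0 2 * y ord0 0 - x ord0 0 * y ord0 2;
                   x ord0 0 * y ord0 1 - x ord0 1 * y ord0 0] j.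

Section weak_curl.
Context (R : realType).

(* <d_1 u_2 - d_2 u_1, phi> = - \int_Om u . gradperp phi *)
Definition curl2_pairing (Om : set 'rV[R]_2) (u : 'rV[R]_2 -> 'rV[R]_2)
    (phi : 'rV[R]_2 -> R) : R :=
  - integral_rV Om (fun x => dot (u x) (gradperp phi x)).

(* <(curl u)_j, phi> = - \int_Om (grad phi x u)_j *)
Definition curl3_pairing (Om : set 'rV[R]_3) (u : 'rV[R]_3 -> 'rV[R]_3)
    (j : 'I_3) (phi : 'rV[R]_3 -> R) : R :=
  - integral_rV Om (fun x => cross (grad phi x) (u x) ord0 j).

Definition irrotational (m : nat) :
    set 'rV[R]_m.+1 -> ('rV[R]_m.+1 -> 'rV[R]_m.+1) -> Prop :=
  match m with
  | 1 => fun Om u => forall phi, test_function Om phi ->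
           curl2_pairing Om u phi = 0
  | 2 => fun Om u => forall j phi, test_function Om phi ->
           curl3_pairing Om u j phi = 0
  | _ => fun _ _ => False
  end.

End weak_curl.

Section interface.
Context (R : realType) (m : nat) (eta : 'rV[R]_m -> R).

Definition below : set 'rV[R]_m.+1 := [set x | ver x < eta (hor x)].
Definition above : set 'rV[R]_m.+1 := [set x | eta (hor x) < ver x].

Let slope (x' : 'rV[R]_m) : R :=
  Num.sqrt (1 + dot (grad eta x') (grad eta x')).

(* Unit normal of S pointing upwards: N in one fluid, N_- = - N_+ for a
   vortex sheet. It is constant in x_n, hence defined on all of R^n. *)
Definition normal (x : 'rV[R]_m.+1) : 'rV[R]_m.+1 :=
  (slope (hor x))^-1 *: pt (- grad eta (hor x)) 1.

Definition surface_integral (f : 'rV[R]_m.+1 -> R) : R :=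
  integral_rV setT (fun x' => f (pt x' (eta x')) * slope x').

(* Weak form, away from the complement of the open set U, of
     div F = f in Om   and   F . nu = h on S,
   with nu the outward unit normal of Om; S is contained in the boundary of Om.
   If Om = above `|` below, h is the sum of the two outward normal traces. *)
Definition weak_div (Om U : set 'rV[R]_m.+1)
    (F : 'rV[R]_m.+1 -> 'rV[R]_m.+1) (f h : 'rV[R]_m.+1 -> R) : Prop :=
  forall phi, test_function U phi ->
    integral_rV Om (fun x => dot (F x) (grad phi x) + f x * phi x)
    = surface_integral (fun x => h x * phi x).

(* div u = 0 in Om and (u - c) . N = 0 on S *)
Definition incompressible (Om U : set 'rV[R]_m.+1) (c : 'rV[R]_m.+1)
    (u : 'rV[R]_m.+1 -> 'rV[R]_m.+1) : Prop :=
  weak_div Om U (fun x => u x - c) (fun=> 0) (fun=> 0).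

(* Conservation form: as div u = 0 in Om and (u - c) . N = 0 on S, the vector
   field F = rho u_i (u - c) + P e_i has divergence
   rho (u - c) . grad u_i + d_i P and outward normal trace P nu_i on S.
   For Om = below this is
     rho ((u - c) . grad u + g e_n) + grad P = 0, P = sigma div N on S;
   for Om = above `|` below the dynamic condition is
     P_- - P_+ = sigma div N_-. *)
Definition momentum_balance (Om U : set 'rV[R]_m.+1)
    (rho : 'rV[R]_m.+1 -> R) (g sigma : R) (c : 'rV[R]_m.+1)
    (u : 'rV[R]_m.+1 -> 'rV[R]_m.+1) (P : 'rV[R]_m.+1 -> R) : Prop :=
  forall i : 'I_m.+1,
    weak_div Om U
      (fun x => (rho x * u x ord0 i) *: (u x - c) + P x *: basis_vec R i)
      (fun x => - (rho x * g * (i == ord_max)%:R))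
      (fun x => sigma * divergence normal x * normal x ord0 i).

(* u \in L^1_loc up to S, and u \in L^2_loc, P \in L^1_loc up to S away from
   the complement of U. *)
Definition weak_regularity (Om U : set 'rV[R]_m.+1)
    (u : 'rV[R]_m.+1 -> 'rV[R]_m.+1) (P : 'rV[R]_m.+1 -> R) : Prop :=
  [/\ (forall i, loc_integrable setT Om (fun x => u x ord0 i)),
      (forall i, loc_integrable U Om (fun x => (u x ord0 i) ^+ 2)) &
      loc_integrable U Om P].

(* Free boundary Euler system for one fluid, outside the set Xi of point
   vortices. *)
Definition one_fluid (g sigma : R) (c' : 'rV[R]_m) (Xi : set 'rV[R]_m.+1)
    (u : 'rV[R]_m.+1 -> 'rV[R]_m.+1) (P : 'rV[R]_m.+1 -> R) : Prop :=
  [/\ weak_regularity below (~` Xi) u P,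
      incompressible below (~` Xi) (pt c' 0) u &
      momentum_balance below (~` Xi) (fun=> 1) g sigma (pt c' 0) u P].

Definition sheet_density (rho_m rho_p : R) (x : 'rV[R]_m.+1) : R :=
  if ver x < eta (hor x) then rho_m else rho_p.

End interface.

(* The vorticity w of u in below eta; if n = 3, w is a divergence free field
   and w . N = 0 on S. *)
Definition localized_vorticity (R : realType) (m : nat) :
    ('rV[R]_m -> R) -> ('rV[R]_m.+1 -> 'rV[R]_m.+1) -> Prop :=
  match m with
  | 1 => fun eta u =>
      exists w : 'rV[R]_2 -> R,
        (forall phi, test_function (below eta) phi ->
           curl2_pairing (below eta) u phi
           = integral_rV (below eta) (fun x => w x * phi x)) /\
        exists2 k : R, 2 ^+ 2 < k & localized (below eta) k w
  | 2 => fun eta u =>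
      exists w : 'rV[R]_3 -> 'rV[R]_3,
        [/\ (forall j phi, test_function (below eta) phi ->
               curl3_pairing (below eta) u j phi
               = integral_rV (below eta) (fun x => w x ord0 j * phi x)),
            (exists2 k : R, 3 ^+ 2 < k &
               forall j, localized (below eta) k (fun x => w x ord0 j)) &
            weak_div eta (below eta) setT w (fun=> 0) (fun=> 0)]
  | _ => fun _ _ => False
  end.

Definition case_IA (R : realType) (m : nat) (g sigma : R) (c' : 'rV[R]_m)
    (eta : 'rV[R]_m -> R) (u : 'rV[R]_m.+1 -> 'rV[R]_m.+1)
    (P : 'rV[R]_m.+1 -> R) : Prop :=
  one_fluid eta g sigma c' set0 u P /\ localized_vorticity eta u.

(* Point vortices of strength vort i at the distinct points xi i, plus an
   absolutely continuous part w. *)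
Definition case_IB_2d (R : realType) (g sigma : R) (c' : 'rV[R]_1)
    (eta : 'rV[R]_1 -> R) (u : 'rV[R]_2 -> 'rV[R]_2)
    (P : 'rV[R]_2 -> R) : Prop :=
  exists (M : nat) (xi : 'I_M -> 'rV[R]_2) (vort : 'I_M -> R)
         (w : 'rV[R]_2 -> R),
    [/\ injective xi /\ range xi `<=` below eta,
        one_fluid eta g sigma c' (range xi) u P,
        (forall phi, test_function (below eta) phi ->
           curl2_pairing (below eta) u phi
           = \sum_i vort i * phi (xi i)
             + integral_rV (below eta) (fun x => w x * phi x)),
        (exists2 k : R, 2 ^+ 2 < k & localized (below eta) k w) &
        forall i,
          (fun x => u x - (vort i / (2 * pi)) *:
                      gradperp (fun y => ln (enorm (y - xi i))) x)
            @ (xi i)^' --> pt c' 0].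

Definition case_IB (R : realType) (m : nat) (g sigma : R) :
    'rV[R]_m -> ('rV[R]_m -> R) -> ('rV[R]_m.+1 -> 'rV[R]_m.+1) ->
    ('rV[R]_m.+1 -> R) -> Prop :=
  match m with
  | 1 => fun c' eta u P => case_IB_2d g sigma c' eta u P
  | _ => fun _ _ _ _ => False
  end.

(* u_+, P_+ and u_-, P_- are the restrictions of u, P to above, below. *)
Definition case_II (R : realType) (m : nat) (g sigma rho_m rho_p : R)
    (c' : 'rV[R]_m) (eta : 'rV[R]_m -> R)
    (u : 'rV[R]_m.+1 -> 'rV[R]_m.+1) (P : 'rV[R]_m.+1 -> R) : Prop :=
  [/\ weak_regularity (above eta `|` below eta) setT u P,
      incompressible eta (below eta) setT (pt c' 0) u /\
      incompressible eta (above eta) setT (pt c' 0) u,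
      irrotational (below eta) u /\ irrotational (above eta) u &
      momentum_balance eta (above eta `|` below eta) setT
        (sheet_density eta rho_m rho_p) g sigma (pt c' 0) u P].

(* x^perp . rho u, resp. every component of x \times rho u, is in L^1(Om). *)
Definition finite_angular_momentum (R : realType) (m : nat) :
    set 'rV[R]_m.+1 -> ('rV[R]_m.+1 -> R) ->
    ('rV[R]_m.+1 -> 'rV[R]_m.+1) -> Prop :=
  match m with
  | 1 => fun Om rho u =>
      (leb R 2).-integrable Om (fun x => (dot (perp x) (rho x *: u x))%:E)
  | 2 => fun Om rho u => forall j : 'I_3,
      (leb R 3).-integrable Om (fun x => (cross x (rho x *: u x) ord0 j)%:E)
  | _ => fun _ _ _ => False
  end.

(* p = (p', 0) and u = grad (p . x / |x|^n) + O(|x|^(-n-e)) for some e > 0 *)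
Definition dipole_moment (R : realType) (m : nat) (Om : set 'rV[R]_m.+1)
    (u : 'rV[R]_m.+1 -> 'rV[R]_m.+1) (p : 'rV[R]_m.+1) : Prop :=
  ver p = 0 /\
  exists2 e : R, 0 < e &
    bigO_infty Om
      (fun x => enorm (u x - grad (fun y => dot p y / enorm y ^+ m.+1) x))
      (m.+1%:R + e).

(* eta \in C^2_bdd, eta -> 0, and
   d^beta eta = O(|x'|^-(n - 1 + |beta| + 4 eps)) for |beta| <= 1 *)
Definition solitary_profile (R : realType) (m : nat) (eps : R)
    (eta : 'rV[R]_m -> R) : Prop :=
  [/\ Ck_bdd 2 eta, vanishes_at_infinity eta,
      bigO_infty setT eta (m%:R + 4 * eps) &
      forall i, bigO_infty setT (partial i eta) (m%:R + 1 + 4 * eps)].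

(* Main.v *)
(* Vanishing of the dipole moments.  The velocity is [grad (p.x/|x|^n)] up to
   [O(|x|^(-n-eps'))], so the component [(p.x) u_n - x_n (p.u)] of the angular
   momentum density is [- x_n |p|^2/|x|^n] up to [O(|x|^(1-n-eps'))], and this is
   not integrable over the boxes [|x'| <= h, h <= |x_n| <= 2h] unless [p = 0].

   Triviality of vortex sheets.  On each side of the interface [u] is irrotational;
   convolving it with a kernel supported in a cone pointing into that side makes it
   the gradient of a smooth potential [Phi] up to a small error, and integrating [u_n]
   vertically up to height [r] gives [Phi = O(r^(1-b))] when [u = O(|x|^(-b))].
   Incompressibility tested against [Phi chi], with [chi = F + 2 y F'] for a radial
   cutoff [F] and [y = |x|^2/r^2], yields [int chi |u|^2 = int chi c.u + o(1)]; the term in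
   which [c.grad chi] appears is removed by the divergence-free field
   [(c.x) e_n - x_n c] and by the integrability of the angular momentum.
   Incompressibility across both sides, tested against [(c.x) F], shows that
   [int chi c.u] tends to [0]; hence [int |u|^2 = 0]. *)

Require Import Defs.
From mathcomp Require Import all_boot all_order all_algebra.
From HB Require Import structures.
From mathcomp Require Import lra ring.
From mathcomp Require Import all_classical all_reals all_analysis measurable_realfun.
Import Order.TTheory GRing.Theory Num.Def Num.Theory.
Import numFieldNormedType.Exports.
Local Open Scope classical_set_scope.
Local Open Scope ring_scope.

(** The equations hold only weakly, so every identity is an integral against a smooth test function,
    and the potential must be smooth itself. It is a convolution of [u_n] with a kernel elongated to
    a finite length [T]; with [r] fixed, [T] is chosen large and then the kernel width small. The
    obstacle on one side is that decay alone fails: with [b = n - 1 + eps], the term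
    [Phi c.grad chi] has size [r^(1-b) r^(-1)] on a volume [r^n], in all [r^(1-eps)]. The field
    [(c.x) e_n - x_n c] is divergence free and orthogonal to [x], so it trades this term for
    [(c.x) u_n - x_n c.u], except in a strip of bounded height at the interface, whose volume is
    only [r^(n-1)]. The form of [chi] is dictated by the last test function: [chi c.u] and
    [u.grad((c.x) F)] differ by [(2/r^2) F' (|x|^2 c.u - (c.x)(x.u))], which is [O(1/r)] times
    angular momentum densities, whereas with [F] in place of [chi] a term of size [r^(1-eps)] would
    be left. *)

Lemma measurable_boxset (R : realType) (n : nat) (A : 'I_n -> set R) :
  (forall i, measurable (A i : set (measurableTypeR R))) ->
  measurable [set x : 'rV[R]_n | forall i, A i (x ord0 i)].
Proof.
move=> mA.
have -> : [set x : 'rV[R]_n | forall i, A i (x ord0 i)] =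
    \bigcap_(i in [set: 'I_n])
      ([set: 'rV[R]_n] `&` (fun x : 'rV[R]_n => x ord0 i : measurableTypeR R) @^-1` A i).
  by apply/seteqP; split => x /= h i; [split => //; exact: h|have [] := h i I].
apply: fin_bigcap_measurable => //= i _.
by have := @measurable_coord R n i measurableT (A i) (mA i).
Qed.

(** * Cubes, sigma-finiteness, Tonelli and product integrals for [leb] *)

Definition cube (R : realType) (n : nat) (L : R) : set 'rV[R]_n :=
  [set x | forall i, `|x ord0 i| <= L].

Lemma measurable_cube (R : realType) (n : nat) (L : R) : measurable (cube R n L).
Proof.
have -> : cube R n L = [set x | forall i, `[- L, L]%classic (x ord0 i)].
  by apply/seteqP; split => x /= h i; have := h i; rewrite /= in_itv/= ler_norml.
by apply: (@measurable_boxset R n (fun=> `[- L, L]%classic)) => i; exact: measurable_itv.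
Qed.

Lemma preimage_pt_cube (R : realType) (m : nat) (L : R) :
  (fun p : 'rV[R]_m * R => pt p.1 p.2) @^-1` cube R m.+1 L = cube R m L `*` `[- L, L]%classic.
Proof.
apply/seteqP; split => [[x t]/= h|[x t] /= [h ht] i].
  split => /= [i|].
    by have := h (lift ord_max i); rewrite mxE liftK.
  by have := h ord_max; rewrite mxE unlift_none in_itv/= ler_norml.
rewrite mxE; case: unliftP => [j _|_]; first exact: h.
by rewrite ler_norml; move: ht; rewrite in_itv.
Qed.

Lemma leb_cube (R : realType) (n : nat) (L : R) : 0 <= L ->
  leb R n (cube R n L) = ((L + L) ^+ n)%:E.
Proof.
move=> L0; elim: n => [|m IH].
  rewrite /= diracE mem_set ?expr0// => i.
  by case: i.
rewrite /= /leb_step /pushforward preimage_pt_cube product_measure1E.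
- rewrite [X in (X * _)%E]IH [X in (_ * X)%E]lebesgue_measure_itv/= lte_fin.
  case: ltP => [_|h]; first by rewrite -EFinB opprK -EFinM exprSr.
  have -> : L = 0 by apply/eqP; rewrite eq_le L0 andbT; move: h; lra.
  by rewrite mule0 addr0 exprS mul0r.
- exact: measurable_cube.
- exact: measurable_itv.
Qed.

Lemma rV_norm_ge (R : realType) (n : nat) (x : 'rV[R]_n) i : `|x ord0 i| <= `|x|.
Proof.
have /mapP[j Hj ->] : `|x ord0 i| \in [seq `|x z.1 z.2| | z : 'I_1 * 'I_n].
  by apply/mapP; exists (ord0, i) => //=; rewrite mem_enum.
by rewrite [leRHS]/normr /= mx_normrE; apply/bigmax_geP; right => /=; exists j.
Qed.

Lemma rV_norm_le (R : realType) (n : nat) (x : 'rV[R]_n) (e : R) : 0 <= e ->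
  (forall i, `|x ord0 i| <= e) -> `|x| <= e.
Proof.
move=> e0 h; rewrite [leLHS]/normr /= mx_normrE; apply/bigmax_leP; split => // -[i j] _ /=.
by rewrite (ord1 i).
Qed.

Lemma cube_exhaust (R : realType) (n : nat) (x : 'rV[R]_n) (L : R) :
  `|x| <= L -> cube R n L x.
Proof. by move=> xL i; apply: le_trans xL; exact: rV_norm_ge. Qed.

Lemma leb_sigma_finite (R : realType) (n : nat) :
  sigma_finite [set: 'rV[R]_n] (leb R n).
Proof.
exists (fun k : nat => cube R n k%:R).
  apply/esym/seteqP; split => // x _.
  exists (Num.bound `|x|) => //; apply: cube_exhaust.
  by apply/ltW/(le_lt_trans _ (archi_boundP _)).
by move=> k; split; [exact: measurable_cube|rewrite leb_cube// ltry].
Qed.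

(** Unbundled copy of [leb], so that being a measure and being sigma-finite are instances on one
    function, as Tonelli and Fubini require. *)
Definition lebs (R : realType) (n : nat) : set 'rV[R]_n -> \bar R := leb R n.

HB.instance Definition _ (R : realType) (n : nat) :=
  isMeasure.Build _ _ _ (@lebs R n) (measure0 (leb R n))
    (measure_ge0 (leb R n)) (@measure_semi_sigma_additive _ _ _ (leb R n)).

HB.instance Definition _ (R : realType) (n : nat) :=
  Measure_isSigmaFinite.Build _ _ _ (@lebs R n) (leb_sigma_finite R n).

Arguments lebs : clear implicits.

Lemma measurable_fun_pt2 (R : realType) (m : nat) d (T : measurableType d)
    (f : 'rV[R]_m.+1 -> T) :
  measurable_fun setT f -> measurable_fun setT (fun p : 'rV[R]_m * measurableTypeR R => f (pt p.1 p.2)).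
Proof. by move=> mf; apply: (measurableT_comp mf); exact: measurable_pt. Qed.

(** [leb R m.+1] is by definition the image of a product measure under [pt], so this is a change of
    variables followed by Tonelli. *)
Lemma leb_tonelli (R : realType) (m : nat) (f : 'rV[R]_m.+1 -> \bar R) :
  measurable_fun setT f -> (forall x, 0 <= f x)%E ->
  (\int[leb R m.+1]_x f x = \int[leb R m]_x' \int[lebesgue_measure]_t f (pt x' t))%E.
Proof.
move=> mf f0.
have mp := @measurable_pt R m.
transitivity (\int[(lebs R m \x @lebesgue_measure R)]_p f (pt p.1 p.2))%E.
  rewrite -[LHS]/(\int[pushforward (lebs R m \x @lebesgue_measure R) (fun p => pt p.1 p.2)]_x f x)%E.
  by rewrite (ge0_integral_pushforward mp)// preimage_setT.
pose mu : {sigma_finite_measure set 'rV[R]_m -> \bar R} := lebs R m.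
have mf2 := measurable_fun_pt2 R m _ _ f mf.
exact: (fubini_tonelli1 (m1 := mu) (m2 := @lebesgue_measure R)
  (fun p : 'rV[R]_m * measurableTypeR R => f (pt p.1 p.2)) mf2 (fun p => f0 _)).
Qed.

Lemma leb2_tonelli (R : realType) (n : nat) (f : 'rV[R]_n * 'rV[R]_n -> \bar R) :
  measurable_fun setT f -> (forall x, 0 <= f x)%E ->
  (\int[leb R n]_x \int[leb R n]_y f (x, y) = \int[leb R n]_y \int[leb R n]_x f (x, y))%E.
Proof.
move=> mf f0.
pose mu : {sigma_finite_measure set 'rV[R]_n -> \bar R} := lebs R n.
exact: (fubini_tonelli (m1 := mu) (m2 := mu) f mf f0).
Qed.

Lemma prod_pt (R : realType) (m : nat) (f : 'I_m.+1 -> R -> R) x' t :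
  \prod_i f i (pt x' t ord0 i) = (\prod_i f (lift ord_max i) (x' ord0 i)) * f ord_max t.
Proof.
rewrite big_ord_recr/= !mxE unlift_none; congr (_ * _); apply: eq_bigr => i _.
have -> : widen_ord (leqnSn m) i = lift ord_max i.
  by apply: val_inj; rewrite /= /bump leqNgt ltn_ord.
by rewrite mxE liftK.
Qed.

(** Induction, splitting off the last coordinate with [leb_tonelli]. The kernels and boxes used
    later are products of functions of one coordinate, and their integrals reduce to this. *)
Lemma leb_prod (R : realType) (n : nat) (f : 'I_n -> R -> R) (c : 'I_n -> R) :
  (forall i, measurable_fun setT (f i : measurableTypeR R -> measurableTypeR R)) ->
  (forall i t, 0 <= f i t) ->
  (forall i, \int[lebesgue_measure]_t (f i t)%:E = (c i)%:E)%E ->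
  (\int[leb R n]_x (\prod_i f i (x ord0 i))%:E = (\prod_i c i)%:E)%E.
Proof.
elim: n f c => [|m IH] f c mf f0 fc.
  under eq_integral do rewrite big_ord0.
  by rewrite big_ord0 /= integral_dirac// diracE mem_set// mul1e.
have mp : forall k (g : 'I_k -> R -> R), (forall i, measurable_fun setT (g i : measurableTypeR R -> measurableTypeR R)) ->
   measurable_fun setT (fun x : 'rV[R]_k => (\prod_i g i (x ord0 i))).
  move=> k g mg; apply: measurable_prod => i _.
  exact: (measurableT_comp (mg i) (measurable_coord i)).
have E := leb_tonelli R m (fun x => (\prod_i f i (x ord0 i))%:E).
rewrite {}E; last 2 first.
- by apply/measurable_EFinP; exact: (mp _ _ mf).
- by move=> x; rewrite lee_fin prodr_ge0.
- transitivity (\int[leb R m]_x ((\prod_i f (lift ord_max i) (x ord0 i))%:E * (c ord_max)%:E))%E.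
    apply: eq_integral => x' _.
    under eq_integral do rewrite prod_pt EFinM.
    rewrite ge0_integralZl ?fc//.
    + by apply/measurable_EFinP; exact: mf.
    + by move=> t _; rewrite lee_fin.
    + by rewrite lee_fin prodr_ge0.
  rewrite ge0_integralZr.
  + rewrite [X in (X * _)%E](IH (fun i => f (lift ord_max i)) (fun i => c (lift ord_max i)))// -EFinM big_ord_recr/=.
    congr (_ * _)%:E; apply: eq_bigr => i _; congr (c _); apply: val_inj.
    by rewrite /= /bump leqNgt ltn_ord.
  + by [].
  + by apply/measurable_EFinP; exact: (mp _ (fun i => f (lift ord_max i)) (fun i => mf _)).
  + by move=> x _; rewrite lee_fin prodr_ge0.
  + by rewrite -fc integral_ge0// => t _; rewrite lee_fin.
Qed.

(** The measurable sets are generated by the coordinates, not by the topology. Rounding the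
    coordinates down to the grid of mesh [1/(k+1)] makes [f] constant on each of countably many
    half-open boxes, and these functions converge pointwise to [f]. *)
Lemma continuous_measurable_rV (R : realType) (n : nat) (f : 'rV[R]_n -> R) :
  continuous f -> measurable_fun setT (f : 'rV[R]_n -> measurableTypeR R).
Proof.
move=> cf.
pose g (k : nat) (x : 'rV[R]_n) : 'rV[int]_n := \row_i Num.floor (k.+1%:R * x ord0 i).
pose r (k : nat) (y : 'rV[int]_n) : 'rV[R]_n := \row_i ((y ord0 i)%:~R / k.+1%:R).
apply: (@measurable_fun_cvg _ _ _ setT (fun k x => f (r k (g k x)))).
- move=> k _ Y mY; rewrite setTI.
  have -> : (fun x => f (r k (g k x))) @^-1` Y =
     \bigcup_(y : 'rV[int]_n) ([set x | Y (f (r k y))] `&` [set x | forall i, `[(y ord0 i)%:~R / k.+1%:R, (y ord0 i + 1)%:~R / k.+1%:R[%classic (x ord0 i)]).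
    have key (x : 'rV[R]_n) (y : 'rV[int]_n) : (forall i, `[(y ord0 i)%:~R / k.+1%:R, (y ord0 i + 1)%:~R / k.+1%:R[%classic (x ord0 i)) <-> g k x = y.
      split => [h|<-] //.
        apply/rowP => i; rewrite mxE; apply/floor_def.
        have := h i; rewrite /= in_itv/= ler_pdivrMr// ltr_pdivlMr//.
        by rewrite [_ * k.+1%:R]mulrC.
      move=> i; rewrite /= in_itv/= ler_pdivrMr// ltr_pdivlMr// mxE.
      by rewrite [_ * k.+1%:R]mulrC ge_floor/= floorD1_gt.
    apply/seteqP; split => [x /= Yx|x [y _ [/= Yx /key gx]]].
      by exists (g k x) => //; split => //; exact/key.
    by rewrite gx.
  apply: countable_bigcupT_measurable => //= y.
  apply: measurableI.
    have [h|h] := pselect (Y (f (r k y))).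
      have -> : (fun _ : 'rV[R]_n => Y (f (r k y))) = setT by apply/seteqP; split.
      exact: measurableT.
    have -> : (fun _ : 'rV[R]_n => Y (f (r k y))) = set0 by apply/seteqP; split.
    exact: measurable0.
  by apply: (@measurable_boxset R n (fun i => `[(y ord0 i)%:~R / k.+1%:R, (y ord0 i + 1)%:~R / k.+1%:R[%classic)) => i; exact: measurable_itv.
- move=> x _; apply: continuous_cvg; first exact: cf.
  apply/cvgrPdist_le => e e0.
  near=> k.
  apply: rV_norm_le => [|j]; first exact: ltW.
  rewrite !mxE.
  have h1 := ge_floor (k.+1%:R * x ord0 j); have h2 := floorD1_gt (k.+1%:R * x ord0 j).
  have ke : 1 <= e * k.+1%:R.
    rewrite -ler_pdivrMl// mulr1; near: k.
    have e1 : 0 <= e^-1 by rewrite invr_ge0 ltW.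
    exists (Num.bound e^-1) => //= j0 hj; apply: (le_trans (ltW (archi_boundP e1))).
    by rewrite ler_nat (leq_trans hj).
  have -> : x ord0 j - (Num.floor (k.+1%:R * x ord0 j))%:~R / k.+1%:R =
     (k.+1%:R * x ord0 j - (Num.floor (k.+1%:R * x ord0 j))%:~R) / k.+1%:R.
    by rewrite mulrBl [_ * x ord0 j]mulrC mulfK.
  rewrite normrM ger0_norm ?subr_ge0// ger0_norm ?invr_ge0//.
  rewrite ler_pdivrMr//; apply: le_trans ke.
  by rewrite lerBlDl; apply/ltW; move: h2; rewrite intrD.
Unshelve. all: by end_near. Qed.

(** * A smooth step function *)

Section flat.
Context {R : realType}.
Implicit Types (t a b : R) (k : nat).

(** [t^(-k) exp(-1/t)] extended by 0; the powers are included so that derivatives stay in the span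
    of the family. *)
Definition flat k t : R := if 0 < t then t^-1 ^+ k * expR (- t^-1) else 0.

Lemma flat_ge0 k t : 0 <= flat k t.
Proof.
rewrite /flat; case: ifPn => // t0.
by rewrite mulr_ge0 ?expR_ge0// exprn_ge0// invr_ge0 ltW.
Qed.

(** From the term of order [k+1] of the exponential series at [1/t]. It yields the vanishing
    derivative at 0 in [is_derive_flat]. *)
Lemma flat_le k t : 0 < t -> flat k t <= (k.+1)`!%:R * t.
Proof.
move=> t0; rewrite /flat t0.
have u0 : 0 < t^-1 by rewrite invr_gt0.
have h : t^-1 ^+ k.+1 <= k.+1`!%:R * expR t^-1.
  have := expR_ge1Dxn k (ltW u0).
  rewrite -ler_pdivrMl ?ltr0n ?fact_gt0// mulrC => h.
  by apply: le_trans h; rewrite lerDr.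
rewrite -ler_pdivrMr// -mulrA [_ * t^-1]mulrC mulrA -exprSr.
by rewrite expRN ler_pdivrMr ?expR_gt0.
Qed.

Lemma flatS k t : t != 0 -> flat k.+1 t = t^-1 * flat k t.
Proof. by move=> t0; rewrite /flat; case: ifP; rewrite ?mulr0// exprS mulrA. Qed.

Lemma is_derive_flat k t : is_derive t 1 (flat k) (flat k.+2 t - k%:R * flat k.+1 t).
Proof.
have [t0|t0|->] := ltgtP t 0.
- apply: (near_eq_is_derive (f := cst 0)).
    near=> s; rewrite /flat ifF//; apply/negbTE; rewrite -leNgt ltW//.
    by near: s; exact: lt_nbhsl.
  apply: is_derive_eq.
  by rewrite /flat !ltNge (ltW t0)/= mulr0 subr0.
- apply: (near_eq_is_derive (f := fun s : R => s^-1 ^+ k * expR (- s^-1))).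
    near=> s; rewrite /flat ifT//.
    by near: s; exact: lt_nbhsr.
  have dv : is_derive t 1 (fun s : R => s^-1) (- t ^- 2).
    have := @is_deriveV R id t 1 1 (lt0r_neq0 t0) (is_derive_id _ _).
    by rewrite /= scaler1.
  have dv2 : is_derive t 1 (fun s : R => expR (- s^-1)) (expR (- t^-1) * (t ^- 2)).
    apply: (@is_derive1_comp R expR (fun s => - s^-1)).
    by apply: is_derive_eq; rewrite opprK.
  have dv3 : is_derive t 1 (fun s : R => s^-1 ^+ k) ((k%:R * t^-1 ^+ k.-1) * (- t ^- 2)).
    have := @is_deriveX R R (fun s => s^-1) k t 1 (- t ^- 2) dv.
    by rewrite fctE.
  apply: is_derive_eq.
  rewrite /flat t0 /= /GRing.scale/=.
  have -> : t ^- 2 = t^-1 ^+ 2 by rewrite exprVn.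
  case: k {dv3} => [|k] /=; first by rewrite !expr0; ring.
  by rewrite !exprS; ring.
(* At 0 the difference quotient of [flat k] is [flat k.+1], which tends to 0 by [flat_le]. *)
rewrite /flat !ltxx mulr0 subr0.
have h : (fun s : R => s^-1 *: ((flat k \o shift 0) (s *: 1) - flat k 0)) @ 0^' --> (0 : R).
  apply/cvgrPdist_le => e e0; near=> s.
  have s0 : s != 0 by near: s; exact: nbhs_dnbhs_neq.
  rewrite /= /shift/= addr0 {2}/flat ltxx subr0 sub0r normrN.
  rewrite /GRing.scale/= mulr1 -flatS// ger0_norm ?flat_ge0//.
  have [sp|sn] := ltP 0 s; last by rewrite /flat ltNge sn /= ltW.
  apply: (le_trans (flat_le _ _ sp)).
  rewrite -ler_pdivlMl ?ltr0n ?fact_gt0//.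
  apply: le_trans (ler_norm _) _.
  near: s; apply: nbhs_dnbhs.
  have e1 : 0 < (k.+2`!%:R)^-1 * e by rewrite mulr_gt0// invr_gt0 ltr0n fact_gt0.
  have := @nbhs0_le R R _ e1.
  exact.
apply: DeriveDef; first by apply/cvg_ex; exists 0.
exact/cvg_lim.
Unshelve. all: by end_near. Qed.

(** A syntactic class containing [kap] and closed under derivatives, so that all derivatives of
    [kap] exist without computing any. *)
Inductive smooth1 : (R -> R) -> Prop :=
| smooth1_cst c : smooth1 (fun=> c)
| smooth1_flat k a b : smooth1 (fun t => flat k (a * t + b))
| smooth1_add f g : smooth1 f -> smooth1 g -> smooth1 (fun t => f t + g t)
| smooth1_mul f g : smooth1 f -> smooth1 g -> smooth1 (fun t => f t * g t)
| smooth1_inv f : smooth1 f -> (forall t, f t != 0) -> smooth1 (fun t => (f t)^-1).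

Lemma is_derive_aff (f : R -> R) (a b t df : R) :
  is_derive (a * t + b) 1 f df -> is_derive t 1 (fun s => f (a * s + b)) (a * df).
Proof.
move=> h; have -> : a * df = df * a by rewrite mulrC.
apply: (@is_derive1_comp R f (fun s => a * s + b)).
apply: is_derive_eq.
by rewrite scaler1 addr0.
Qed.

Lemma smooth1_derive f : smooth1 f ->
  exists2 g, smooth1 g & forall t, is_derive t 1 f (g t).
Proof.
elim => {f} [c|k a b|f g sf [f' sf' df] sg [g' sg' dg]|f g sf [f' sf' df] sg [g' sg' dg]|f sf [f' sf' df] f0].
- exists (fun=> 0); first exact: smooth1_cst.
  by move=> t; exact: is_derive_cst.
- exists (fun t => a * (flat k.+2 (a * t + b) + (- k%:R) * flat k.+1 (a * t + b))).
    apply: smooth1_mul; first exact: smooth1_cst.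
    apply: smooth1_add; first exact: smooth1_flat.
    by apply: smooth1_mul; [exact: smooth1_cst|exact: smooth1_flat].
  move=> t; apply: is_derive_aff; rewrite mulNr; exact: is_derive_flat.
- exists (fun t => f' t + g' t); first exact: smooth1_add.
  by move=> t; exact: is_deriveD.
- exists (fun t => f t * g' t + g t * f' t).
    by apply: smooth1_add; exact: smooth1_mul.
  by move=> t; exact: is_deriveM.
- exists (fun t => (-1) * (((f t)^-1 * (f t)^-1) * f' t)).
    apply: smooth1_mul; first exact: smooth1_cst.
    apply: smooth1_mul => //.
    by apply: smooth1_mul; exact: smooth1_inv.
  move=> t; have := @is_deriveV R f t (f' t) 1 (f0 t) (df t).
  by rewrite /GRing.scale/= mulN1r -exprVn expr2 mulNr.
Qed.

(* Smooth transition from 0 (for t <= 1) to 1 (for t >= 2). *)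
Definition kap : R -> R := fun t => flat 0 (t - 1) * (flat 0 (t - 1) + flat 0 (2 - t))^-1.

Lemma kap_den (t : R) : flat 0 (t - 1) + flat 0 (2 - t) > 0.
Proof.
have p s : 0 < s -> 0 < flat 0 s by move=> s0; rewrite /flat s0 expr0 mul1r expR_gt0.
have [t1|t1] := ltP 1 t.
  by rewrite ltr_pwDl ?flat_ge0// p// subr_gt0.
rewrite ltr_wpDl ?flat_ge0// p//; lra.
Qed.

Lemma smooth1_kap : smooth1 kap.
Proof.
have h1 : smooth1 (fun t : R => flat 0 (t - 1)).
  have -> : (fun t : R => flat 0 (t - 1)) = (fun t => flat 0 (1 * t + (-1))).
    by apply/funext => t; rewrite mul1r.
  exact: smooth1_flat.
have h2 : smooth1 (fun t : R => flat 0 (2 - t)).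
  have -> : (fun t : R => flat 0 (2 - t)) = (fun t => flat 0 ((-1) * t + 2)).
    by apply/funext => t; rewrite mulN1r addrC.
  exact: smooth1_flat.
apply: smooth1_mul => //; apply: smooth1_inv; first exact: smooth1_add.
by move=> t; rewrite lt0r_neq0// kap_den.
Qed.

(** Indexing by the order of the derivative makes the family closed under differentiation; this is
    what the constructor [sm0_step] relies on. *)
Definition step (k : nat) : R -> R := derive1n k kap.

Lemma smooth1_step (k : nat) : smooth1 (step k).
Proof.
rewrite /step; elim: k => [|k /(smooth1_derive _)[g sg dg]]; first by rewrite derive1n0; exact: smooth1_kap.
rewrite derive1nS (_ : derive1 _ = g)//; apply/funext => t.
by rewrite derive1E; apply: derive_val.
Qed.

Lemma is_derive_step (k : nat) (t : R) : is_derive t 1 (step k) (step k.+1 t).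
Proof.
have [g sg dg] := smooth1_derive _ (smooth1_step k).
suff -> : step k.+1 t = g t by [].
by rewrite /step derive1nS derive1E; apply: derive_val.
Qed.

Lemma continuous_step k : continuous (step k).
Proof.
move=> t; apply: differentiable_continuous; apply/derivable1_diffP.
by have [] := is_derive_step k t.
Qed.

Lemma step_le1 t : t <= 1 -> step 0 t = 0.
Proof. by move=> t1; rewrite /step derive1n0 /kap {1}/flat ltNge subr_le0 t1/= mul0r. Qed.

Lemma step_ge2 t : 2 <= t -> step 0 t = 1.
Proof.
move=> t2; rewrite /step derive1n0 /kap [flat 0 (2 - t)]/flat ltNge subr_le0 t2/= addr0 mulfV//.
have := kap_den t.
have -> : flat 0 (2 - t) = 0 by rewrite /flat ltNge subr_le0 t2.
by rewrite addr0; exact: lt0r_neq0.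
Qed.

Lemma step0_ge0 t : 0 <= step 0 t.
Proof. by rewrite /step derive1n0 mulr_ge0 ?flat_ge0// invr_ge0 ltW// kap_den. Qed.

Lemma step0_le1 t : step 0 t <= 1.
Proof.
by rewrite /step derive1n0 ler_pdivrMr ?kap_den// mul1r lerDl flat_ge0.
Qed.

(** By the quotient rule the numerator is [y x' + x y'], where [y'] is minus the derivative of
    [flat 0 (2 - t)] and all four factors are nonnegative. This sign makes [kone] a density and [kK]
    nonnegative. *)
Lemma step1_ge0 t : 0 <= step 1 t.
Proof.
have d1 : is_derive t 1 (fun t : R => flat 0 (t - 1)) (flat 2 (t - 1)).
  have := @is_derive_aff (flat 0) 1 (-1) t _ (is_derive_flat 0 _).
  rewrite !mul1r mul0r subr0; congr is_derive.
  by apply/funext => s; rewrite mul1r.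
have d2 : is_derive t 1 (fun t : R => flat 0 (2 - t)) (- flat 2 (2 - t)).
  have := @is_derive_aff (flat 0) (-1) 2 t _ (is_derive_flat 0 _).
  rewrite !mulN1r mul0r subr0 addrC; congr is_derive.
  by apply/funext => s; rewrite mulN1r addrC.
have d3 := is_deriveD d1 d2.
have d4 := @is_deriveV R (fun s => flat 0 (s - 1) + flat 0 (2 - s)) t _ 1 (lt0r_neq0 (kap_den t)) d3.
have d5 := is_deriveM d1 d4.
have := @is_derive_step 0 t; rewrite {1}/step derive1n0 => d6.
have -> : step 1 t = 'D_1 kap t by apply/esym; apply: derive_val.
rewrite (derive_val (is_derive := d5)) /GRing.scale/=.
have := kap_den t.
have := flat_ge0 0 (t - 1); have := flat_ge0 0 (2 - t).
have := flat_ge0 2 (t - 1); have := flat_ge0 2 (2 - t).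
move: (flat 0 (t - 1)) (flat 0 (2 - t)) (flat 2 (t - 1)) (flat 2 (2 - t)) => x y x' y' hy' hx' hy hx h.
have -> : x * (- (x + y) ^- 2 * (x' - y')) + (x + y)^-1 * x' = (y * x' + x * y') / (x + y) ^+ 2.
  by field; rewrite lt0r_neq0.
by rewrite divr_ge0 ?exprn_ge0 ?addr_ge0 ?mulr_ge0// ltW.
Qed.

Lemma step_cst_near (k : nat) (c t : R) : (\forall s \near t, step k s = c) -> step k.+1 t = 0.
Proof.
move=> h.
have h2 : is_derive t 1 (step k) 0.
  apply: (@near_eq_is_derive _ _ _ (cst c)); by near do apply/esym.
have -> : step k.+1 t = 'D_1 (step k) t by apply/esym/derive_val/is_derive_step.
exact: derive_val.
Unshelve. all: by end_near. Qed.

Lemma stepS_lt1 (k : nat) (t : R) : t < 1 -> step k.+1 t = 0.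
Proof.
elim: k t => [|k IH] t t1; apply: (step_cst_near _ 0); near=> s.
  by apply: step_le1; apply/ltW; near: s; exact: lt_nbhsl.
by apply: IH; near: s; exact: lt_nbhsl.
Unshelve. all: by end_near. Qed.

Lemma stepS_gt2 (k : nat) (t : R) : 2 < t -> step k.+1 t = 0.
Proof.
elim: k t => [|k IH] t t1.
  apply: (step_cst_near _ 1); near=> s.
  by apply: step_ge2; apply/ltW; near: s; exact: lt_nbhsr.
apply: (step_cst_near _ 0); near=> s.
by apply: IH; near: s; exact: lt_nbhsr.
Unshelve. all: by end_near. Qed.

Lemma step_bounded (k : nat) : exists2 M : R, 0 < M & forall t, `|step k t| <= M.
Proof.
have : {within `[1, 2], continuous (fun t => `|step k t|)}.
  apply: continuous_subspaceT => t; apply: continuous_comp; first exact: continuous_step.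
  exact: norm_continuous.
move/(EVT_max (ler1n _ 2)) => [c _ hc].
exists (`|step k c| + 1); first by rewrite ltr_wpDl.
move=> t.
have [t1|t1] := ltP t 1.
  case: k {hc} => [|k]; first by rewrite step_le1 ?(ltW t1)// normr0 ltW// ltr_wpDl.
  by rewrite stepS_lt1// normr0 ltW// ltr_wpDl.
have [t2|t2] := ltP 2 t.
  case: k {hc} => [|k]; first by rewrite step_ge2 ?(ltW t2)// normr1 lerDr.
  by rewrite stepS_gt2// normr0 ltW// ltr_wpDl.
apply: (le_trans (hc t _)); last by rewrite lerDl.
by rewrite in_itv/= t1.
Qed.

End flat.

#[global] Arguments step {R} k : simpl never.

Notation Int f := ((leb _ _).-integrable setT (EFin \o f)).
Notation Io f := (integral_rV setT f).

(** * Integrals over the whole space *)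

Section toolkit.
Context {R : realType} {n : nat}.
Implicit Types f g U : 'rV[R]_n -> R.

Lemma Int_meas f : Int f -> measurable_fun setT f.
Proof. by move=> /(measurable_int (leb R n))/measurable_EFinP. Qed.

Lemma Int_dom f g : measurable_fun setT f -> Int g -> (forall x, `|f x| <= g x) -> Int f.
Proof.
move=> mf ig fg; apply: (le_integrable measurableT _ _ ig); first exact/measurable_EFinP.
by move=> x _ /=; rewrite lee_fin (le_trans (fg x))// ler_norm.
Qed.

Lemma Int_norm f : Int f -> Int (fun x => `|f x|).
Proof. exact: integrable_norm. Qed.

Lemma Int_scale (c : R) f : Int f -> Int (fun x => c * f x).
Proof.
move=> h; have := integrableZl measurableT c h.
by apply: eq_integrable.
Qed.

Lemma Int_mulb U g (M : R) : Int U -> measurable_fun setT g -> (forall x, `|g x| <= M) ->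
  Int (fun x => g x * U x).
Proof.
move=> iU mg gM; apply: (Int_dom _ (fun x => M * `|U x|)).
- apply: measurable_funM => //; exact: Int_meas.
- exact/Int_scale/Int_norm.
- by move=> x; rewrite normrM ler_wpM2r.
Qed.

Lemma Int_add f g : Int f -> Int g -> Int (fun x => f x + g x).
Proof. by move=> h k; have := integrableD measurableT h k; apply: eq_integrable. Qed.

Lemma Int_sub f g : Int f -> Int g -> Int (fun x => f x - g x).
Proof. by move=> h k; have := integrableB measurableT h k; apply: eq_integrable. Qed.

Lemma Int_0 : Int (fun _ : 'rV[R]_n => 0 : R).
Proof. exact: integrable0. Qed.

Lemma Int_sum (J : Type) (s : seq J) (F : J -> 'rV[R]_n -> R) : (forall j, Int (F j)) ->
  Int (fun x => \sum_(j <- s) F j x).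
Proof.
move=> h; elim: s => [|j s IH].
  by have := Int_0; apply: eq_integrable => // x _; rewrite /= big_nil.
by have := Int_add _ _ (h j) IH; apply: eq_integrable => // x _; rewrite /= big_cons.
Qed.

Lemma Io_add f g : Int f -> Int g -> Io (fun x => f x + g x) = Io f + Io g.
Proof. by move=> *; exact: RintegralD. Qed.

Lemma Io_sub f g : Int f -> Int g -> Io (fun x => f x - g x) = Io f - Io g.
Proof. by move=> *; exact: RintegralB. Qed.

Lemma Io_scale (c : R) f : Int f -> Io (fun x => c * f x) = c * Io f.
Proof. by move=> *; exact: RintegralZl. Qed.

Lemma Io_0 : Io (fun _ : 'rV[R]_n => 0 : R) = 0.
Proof. by rewrite Rintegral_cst// mul0r. Qed.

Lemma Io_sum (J : Type) (s : seq J) (F : J -> 'rV[R]_n -> R) : (forall j, Int (F j)) ->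
  Io (fun x => \sum_(j <- s) F j x) = \sum_(j <- s) Io (F j).
Proof.
move=> h; elim: s => [|j s IH].
  by rewrite big_nil -[RHS]Io_0; congr Rintegral; apply/funext => x; rewrite big_nil.
rewrite big_cons -IH -Io_add//; last exact: Int_sum.
by congr Rintegral; apply/funext => x; rewrite big_cons.
Qed.

Lemma Io_abs f : Int f -> `|Io f| <= Io (fun x => `|f x|).
Proof. by move=> *; exact: le_normr_Rintegral. Qed.

Lemma Io_le f g : Int f -> Int g -> (forall x, f x <= g x) -> Io f <= Io g.
Proof. by move=> *; exact: le_Rintegral. Qed.

Lemma Io_abs_le f g : measurable_fun setT f -> Int g -> (forall x, `|f x| <= g x) -> `|Io f| <= Io g.
Proof.
move=> mf ig fg; have jf := Int_dom _ _ mf ig fg.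
by apply: (le_trans (Io_abs _ jf)); apply: Io_le => //; exact: Int_norm.
Qed.

Lemma Io_ge0 f : (forall x, 0 <= f x) -> 0 <= Io f.
Proof. by move=> h; exact: Rintegral_ge0. Qed.

Lemma Io_eq f g : f =1 g -> Io f = Io g.
Proof. by move=> h; congr Rintegral; exact/funext. Qed.

Lemma Int_eq f g : f =1 g -> Int f -> Int g.
Proof. by move=> h; rewrite (_ : f = g)//; exact/funext. Qed.

Lemma Int_cube (L : R) : 0 <= L -> Int (\1_(cube R n L)).
Proof.
move=> L0; apply/integrableP; split.
  by apply/measurable_EFinP; exact: measurable_indic (measurable_cube R n L).
under eq_integral do rewrite /= ger0_norm//.
by rewrite integral_indic//= ?setIT ?leb_cube ?ltry//; exact: measurable_cube.
Qed.

Lemma Io_cube (L : R) : 0 <= L -> Io (\1_(cube R n L)) = (L + L) ^+ n.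
Proof.
move=> L0; rewrite /Rintegral integral_indic//=; last exact: measurable_cube.
by rewrite setIT leb_cube.
Qed.

Lemma Int_bnd f (M L : R) : 0 <= L -> measurable_fun setT f -> (forall x, `|f x| <= M) ->
  (forall x, f x != 0 -> cube R n L x) -> Int f.
Proof.
move=> L0 mf fM fL; apply: (Int_dom _ (fun x => M * \1_(cube R n L) x)) => //.
  exact/Int_scale/Int_cube.
move=> x; have [->|fx] := eqVneq (f x) 0.
  by rewrite normr0 mulr_ge0// (le_trans _ (fM x)).
by rewrite indicE mem_set ?mulr1//; exact: fL.
Qed.

Lemma Io_bnd f (M L : R) : 0 <= L -> measurable_fun setT f -> (forall x, `|f x| <= M) ->
  (forall x, f x != 0 -> cube R n L x) -> `|Io f| <= M * (L + L) ^+ n.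
Proof.
move=> L0 mf fM fL; rewrite -Io_cube// -Io_scale; last exact: Int_cube.
apply: Io_abs_le => //; first exact/Int_scale/Int_cube.
move=> x; have [->|fx] := eqVneq (f x) 0.
  by rewrite normr0 mulr_ge0// (le_trans _ (fM x)).
by rewrite indicE mem_set ?mulr1//; exact: fL.
Qed.

Lemma compact_cube (L : R) : compact (cube R n L).
Proof.
have -> : cube R n L = [set v : 'rV[R]_n | forall i, `[- L, L]%classic (v ord0 i)].
  by apply/seteqP; split => x /= h i; have := h i; rewrite /= in_itv/= ler_norml.
by apply: (@rV_compact _  _ (fun=> `[- L, L]%classic)) => _; exact: segment_compact.
Qed.

Lemma closed_cube (L : R) : closed (cube R n L).
Proof. by apply: compact_closed; [exact: norm_hausdorff|exact: compact_cube]. Qed.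

Lemma bounded_of_supp f (L : R) : continuous f -> (forall x, f x != 0 -> cube R n L x) ->
  exists2 M : R, 0 <= M & forall x, `|f x| <= M.
Proof.
move=> cf fL.
have [/eqP C0|/set0P C0] := eqVneq (cube R n L) set0.
  exists 0 => // x; have [->|/fL] := eqVneq (f x) 0; first by rewrite normr0.
  by rewrite (eqP C0).
have : {within cube R n L, continuous (fun x => `|f x|)}.
  apply: continuous_subspaceT => t; apply: continuous_comp; first exact: cf.
  exact: norm_continuous.
move/(EVT_max_rV C0 (compact_cube L)) => [c _ hc].
exists `|f c| => // x; have [->|/fL h] := eqVneq (f x) 0; first by rewrite normr0.
by apply: hc; rewrite inE.
Qed.

(** Reduces directional derivatives to derivatives along lines, where the one-variable chain rule,
    mean value theorem and fundamental theorem of calculus apply. *)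
Lemma is_derive_line f (a v : 'rV[R]_n) (t df : R) :
  is_derive t 1 (fun s : R => f (s *: v + a)) df <-> is_derive (t *: v + a) v f df.
Proof.
have E : (fun h : R => h^-1 *: (((fun s : R => f (s *: v + a)) \o shift t) (h *: 1) - f (t *: v + a))) =
  (fun h : R => h^-1 *: ((f \o shift (t *: v + a)) (h *: v) - f (t *: v + a))).
  apply/funext => h /=; congr (_ *: (f _ - _)).
  by rewrite /shift /= [h%:A]mulr1 scalerDl addrA.
split=> -[h1 h2]; apply: DeriveDef.
- by move: h1; rewrite /derivable [X in cvg (X @ _)]E.
- by move: h2; rewrite /derive [X in lim (X @ _)]E.
- by rewrite /derivable [X in cvg (X @ _)]E.
- by rewrite /derive [X in lim (X @ _)]E.
Qed.

Lemma is_derive_line0 f (a v : 'rV[R]_n) (df : R) :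
  is_derive (0 : R) 1 (fun s : R => f (s *: v + a)) df <-> is_derive a v f df.
Proof. by have := is_derive_line f a v 0 df; rewrite scale0r add0r. Qed.

End toolkit.

(** * Lipschitz bounds from partial derivatives *)

Lemma MVT_lip {R : realType} (g dg : R -> R) (M a b : R) :
  (forall t : R, is_derive t 1 g (dg t)) -> (forall t : R, `|dg t| <= M) ->
  `|g b - g a| <= M * `|b - a|.
Proof.
move=> dgd dgM.
wlog ab : a b / a < b => [H|].
  have [ab|ab|->] := ltgtP a b; first exact: H.
    by rewrite distrC [`|b - a|]distrC; exact: H.
  by rewrite !subrr normr0 mulr0.
have [|c _ ->] := @MVT R g dg a b ab (fun x _ => dgd x).
  by apply: continuous_subspaceT => t; apply/differentiable_continuous/derivable1_diffP.
by rewrite normrM ler_wpM2r.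
Qed.

(** The path from [y] to [x] changes one coordinate at a time: [z k] has the first [k] coordinates
    of [x], and the mean value theorem bounds each step. *)
Lemma lip_of_partials {R : realType} {n : nat} (f : 'rV[R]_n -> R) (M : R) :
  (forall i x, derivable f x (basis_vec R i)) -> (forall i x, `|partial i f x| <= M) ->
  forall x y, `|f x - f y| <= M * \sum_i `|x ord0 i - y ord0 i|.
Proof.
move=> df fM x y.
pose z k : 'rV[R]_n := \row_i (if (i < k)%N then x ord0 i else y ord0 i).
have z0 : z 0%N = y by apply/rowP => i; rewrite mxE.
have zn : z n = x by apply/rowP => i; rewrite mxE ltn_ord.
have H (k : nat) : (k <= n)%N -> `|f (z k) - f y| <= M * \sum_(i < n | (i < k)%N) `|x ord0 i - y ord0 i|.
  elim: k => [|k IH] kn; first by rewrite z0 subrr normr0 big_pred0 ?mulr0.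
  have := IH (ltnW kn) => {}IH.
  pose i0 := Ordinal kn.
  rewrite (bigD1 i0)//= mulrDr.
  have -> : \sum_(i < n | (i < k.+1)%N && (i != i0)) `|x ord0 i - y ord0 i| = \sum_(i < n | (i < k)%N) `|x ord0 i - y ord0 i|.
    by apply: eq_bigl => i; rewrite -val_eqE/= ltnS [RHS]ltn_neqAle andbC.
  rewrite -[f _ - _](subrKA (f (z k))).
  apply: (le_trans (ler_normD _ _)); apply: lerD => //.
  have zz : z k.+1 = (x ord0 i0 - y ord0 i0) *: basis_vec R i0 + z k.
    apply/rowP => i; rewrite !mxE eqxx/= -val_eqE/= ltnS leq_eqVlt.
    have [_|_|e] := ltngtP (val i) k; rewrite ?mulr0 ?add0r//.
    by rewrite mulr1 (_ : i = i0) ?subrK//; exact: val_inj.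
  rewrite zz.
  have := @MVT_lip R (fun t : R => f (t *: basis_vec R i0 + z k)) (fun t => partial i0 f (t *: basis_vec R i0 + z k)) M 0 (x ord0 i0 - y ord0 i0).
  rewrite scale0r add0r subr0; apply.
    by move=> t; apply/is_derive_line; exact: derivableP.
  by move=> t; exact: fM.
have := H n (leqnn n); rewrite zn => /le_trans; apply.
by rewrite le_eqVlt; apply/orP; left; apply/eqP; congr (_ * _); apply: eq_bigl => i; rewrite ltn_ord.
Qed.

Lemma continuous_of_lip {R : realType} {n : nat} (f : 'rV[R]_n -> R) (M : R) :
  (forall x y, `|f x - f y| <= M * \sum_i `|x ord0 i - y ord0 i|) -> continuous f.
Proof.
move=> h x.
have FF : Filter (nbhs x) := nbhs_filter x.
pose C := (`|M| + 1) * (n%:R + 1).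
have C0 : 0 < C by rewrite mulr_gt0// ltr_wpDl.
have hC y : `|f x - f y| <= C * `|x - y|.
  apply: (le_trans (h x y)); rewrite /C -mulrA.
  have S : \sum_i `|x ord0 i - y ord0 i| <= (n%:R + 1) * `|x - y|.
    apply: (@le_trans _ _ (\sum_(i < n) `|x - y|)).
      by apply: ler_sum => i _; have := rV_norm_ge R n (x - y) i; rewrite !mxE.
    by rewrite sumr_const card_ord -[leLHS]mulr_natl ler_wpM2r// lerDl.
  apply: (@le_trans _ _ ((`|M| + 1) * \sum_i `|x ord0 i - y ord0 i|)).
    by rewrite ler_wpM2r ?sumr_ge0// (le_trans (ler_norm _))// lerDl.
  by rewrite ler_wpM2l// addr_ge0.
apply/cvgrPdist_le => e e0.
have Ce : 0 < C^-1 * e by rewrite mulr_gt0// invr_gt0.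
have B : nbhs x (ball x (C^-1 * e)) by exact: nbhsx_ballx.
apply: (@filterS _ _ FF _ _ _ B) => y.
rewrite mx_norm_ball /ball_/= => /ltW yx.
by apply: (le_trans (hC y)); rewrite -ler_pdivlMl.
Qed.

Lemma partialP {R : realType} {n : nat} (f : 'rV[R]_n -> R) i x : derivable f x (basis_vec R i) ->
  is_derive x (basis_vec R i) f (partial i f x).
Proof. exact: derivableP. Qed.

Lemma partial_val {R : realType} {n : nat} (f : 'rV[R]_n -> R) i x df :
  is_derive x (basis_vec R i) f df -> partial i f x = df.
Proof. by move=> h; exact: derive_val. Qed.

(** * Smooth functions, convolutions and test functions *)

Section smooth.
Context {R : realType} {n : nat}.
Implicit Types f g K U : 'rV[R]_n -> R.

(* Being closed under partial derivatives, this class gives smoothness without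
   estimates; every cutoff and kernel below lies in it. *)
Inductive sm0 : ('rV[R]_n -> R) -> Prop :=
| sm0_cst c : sm0 (fun=> c)
| sm0_coord i : sm0 (fun x => x ord0 i)
| sm0_add f g : sm0 f -> sm0 g -> sm0 (fun x => f x + g x)
| sm0_mul f g : sm0 f -> sm0 g -> sm0 (fun x => f x * g x)
| sm0_step k f : sm0 f -> sm0 (fun x => step k (f x)).

Lemma is_derive_coord (x v : 'rV[R]_n) i : is_derive x v (fun y : 'rV[R]_n => y ord0 i) (v ord0 i).
Proof.
apply/is_derive_line0.
have -> : (fun s : R => (s *: v + x) ord0 i) = (fun s : R => v ord0 i * s + x ord0 i).
  by apply/funext => s; rewrite !mxE mulrC.
by apply: is_derive_eq; rewrite scaler1 addr0.
Qed.

Lemma is_derive_scomp (g dg : R -> R) f (x v : 'rV[R]_n) df :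
  (forall t : R, is_derive t 1 g (dg t)) -> is_derive x v f df ->
  is_derive x v (fun y => g (f y)) (dg (f x) * df).
Proof.
move=> dgd /is_derive_line0 h; apply/is_derive_line0.
apply: (@is_derive1_comp R g (fun s => f (s *: v + x))).
by have := dgd (f (0 *: v + x)); rewrite scale0r add0r.
Qed.

Lemma sm0_partial f : sm0 f -> forall i, exists2 g, sm0 g & forall x, is_derive x (basis_vec R i) f (g x).
Proof.
move=> + i; elim => {f} [c|j|f g sf [f' sf' df] sg [g' sg' dg]|f g sf [f' sf' df] sg [g' sg' dg]|k f sf [f' sf' df]].
- by exists (fun=> 0); [exact: sm0_cst|move=> t; exact: is_derive_cst].
- by exists (fun=> basis_vec R i ord0 j); [exact: sm0_cst|move=> t; exact: is_derive_coord].
- by exists (fun t => f' t + g' t); [exact: sm0_add|move=> t; exact: is_deriveD].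
- exists (fun t => f t * g' t + g t * f' t); last by move=> t; exact: is_deriveM.
  by apply: sm0_add; exact: sm0_mul.
- exists (fun t => step k.+1 (f t) * f' t); first by apply: sm0_mul => //; exact: sm0_step.
  by move=> t; apply: (is_derive_scomp (step k) (step k.+1)) => // s; exact: is_derive_step.
Qed.

Lemma sm0_continuous f : sm0 f -> continuous f.
Proof.
elim => {f} [c|j|f g sf cf sg cg|f g sf cf sg cg|k f sf cf] x.
- exact: cst_continuous.
- exact: coord_continuous.
- by apply: continuousD; [exact: cf|exact: cg].
- by apply: continuousM; [exact: cf|exact: cg].
- by apply: continuous_comp; [exact: cf|exact: continuous_step].
Qed.

Lemma sm0_partialE f i : sm0 f -> sm0 (partial i f).
Proof.
move=> /sm0_partial/(_ i)[g sg dg]; rewrite (_ : partial i f = g)//.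
by apply/funext => x; exact: partial_val.
Qed.

Lemma sm0_derivable f i x : sm0 f -> derivable f x (basis_vec R i).
Proof. by move=> /sm0_partial/(_ i)[g sg dg]; have [] := dg x. Qed.

Lemma partial_supp f (L : R) i x : (forall x, f x != 0 -> cube R n L x) ->
  partial i f x != 0 -> cube R n L x.
Proof.
move=> fL; apply: contraPP => nx; apply/negP; rewrite negbK; apply/eqP.
apply: partial_val.
apply: (@near_eq_is_derive _ _ _ (cst 0)).
have : \forall y \near x, (~` cube R n L) y.
  by apply: open_nbhs_nbhs; split => //; rewrite openC; exact: closed_cube.
apply: filterS => y ny; apply/esym/eqP; rewrite -[_ == _]negbK; apply/negP => /fL; exact: ny.
Qed.

Definition conv K U : 'rV[R]_n -> R := fun x => Io (fun z : 'rV[R]_n => K (x - z) * U z).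

Lemma measurable_shift K (x : 'rV[R]_n) : continuous K -> measurable_fun setT (fun z : 'rV[R]_n => K (x - z)).
Proof.
move=> cK; apply: continuous_measurable_rV => z.
apply: (@continuous_comp _ _ _ (fun z : 'rV[R]_n => x - z) K); last exact: cK.
apply: continuousB; [exact: cst_continuous|exact: cvg_id].
Qed.

Lemma conv_Int K U (L : R) x : continuous K -> (forall x, K x != 0 -> cube R n L x) -> Int U ->
  Int (fun z => K (x - z) * U z).
Proof.
move=> cK KL iU; have [M M0 KM] := bounded_of_supp _ _ cK KL.
apply: (Int_mulb _ _ M) => //; exact: measurable_shift.
Qed.

Lemma conv_bounded K U (L : R) : continuous K -> (forall x, K x != 0 -> cube R n L x) -> Int U ->
  exists2 M : R, 0 <= M & forall x, `|conv K U x| <= M.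
Proof.
move=> cK KL iU; have [M M0 KM] := bounded_of_supp _ _ cK KL.
exists (M * Io (fun z => `|U z|)); first by rewrite mulr_ge0// Io_ge0.
move=> x; rewrite -Io_scale; last exact: Int_norm.
apply: Io_abs_le.
- by apply: Int_meas; exact: conv_Int KL iU.
- exact/Int_scale/Int_norm.
- by move=> z; rewrite normrM ler_wpM2r.
Qed.

(** Differentiation under the integral sign, dominated by a bound of the derivative of [K] times
    [|U|]; integrability of [U] is thus enough. *)
Lemma conv_is_derive K U (L : R) i x : sm0 K -> (forall x, K x != 0 -> cube R n L x) -> Int U ->
  is_derive x (basis_vec R i) (conv K U) (conv (partial i K) U x).
Proof.
move=> sK KL iU; apply/is_derive_line0.
have cK := sm0_continuous _ sK.
have sK' := sm0_partialE _ i sK.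
have cK' := sm0_continuous _ sK'.
have KL' y := partial_supp _ _ i y KL.
have [M M0 KM] := bounded_of_supp _ _ cK' KL'.
pose f (t : R) z := K (t *: basis_vec R i + (x - z)) * U z.
have -> : (fun s : R => conv K U (s *: basis_vec R i + x)) = (fun s : R => Io (f s)).
  by apply/funext => s; apply: Io_eq => z; rewrite /f addrA.
have df (t : R) z : is_derive t 1 (f ^~ z) (partial i K (t *: basis_vec R i + (x - z)) * U z).
  have h : is_derive t 1 (fun t : R => K (t *: basis_vec R i + (x - z))) (partial i K (t *: basis_vec R i + (x - z))).
    by apply/is_derive_line; apply: partialP; exact: sm0_derivable.
  rewrite /f; apply: is_derive_eq.
  by rewrite /GRing.scale/= mulr0 add0r mulrC.
have p (t : R) z : partial1of2 f t z = partial i K (t *: basis_vec R i + (x - z)) * U z.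
  by rewrite partial1of2E; exact: derive_val.
have If (t : R) : Int (f t).
  by have := @conv_Int K U L (t *: basis_vec R i + x) cK KL iU; apply: Int_eq => z; rewrite /f addrA.
have z01 : [set` `](-1 : R), 1[] (0 : R) by rewrite /= in_itv/= ltrN10 ltr01.
have iG : Int (fun z => M * `|U z|) by exact/Int_scale/Int_norm.
have G0 z : 0 <= M * `|U z| by rewrite mulr_ge0.
have GM (t : R) z : `|partial1of2 f t z| <= M * `|U z| by rewrite p normrM ler_wpM2r.
have der (t : R) z : derivable (f ^~ z) t 1 by have [] := df t z.
apply: DeriveDef.
  exact: (@derivable_under_integral R _ _ (leb R n) f setT measurableT 0 (-1) 1 z01 (fun t _ => If t) (fun t z _ _ => der t z) _ G0 iG (fun t z _ _ => GM t z)).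
rewrite -derive1E.
rewrite (@differentiation_under_integral R _ _ (leb R n) f setT measurableT 0 (-1) 1 z01 (fun t _ => If t) (fun t z _ _ => der t z) _ G0 iG (fun t z _ _ => GM t z)).
by apply: Io_eq => z; rewrite p scale0r add0r.
Qed.

(** The partial derivatives are convolutions with bounded kernels, hence bounded, which gives a
    global Lipschitz bound. *)
Lemma conv_continuous K U (L : R) : sm0 K -> (forall x, K x != 0 -> cube R n L x) -> Int U ->
  continuous (conv K U).
Proof.
move=> sK KL iU.
have H i : exists M : R, 0 <= M /\ forall x, `|partial i (conv K U) x| <= M.
  have [M M0 hM] := conv_bounded (partial i K) U L (sm0_continuous _ (sm0_partialE _ i sK)) (fun y => partial_supp _ _ i y KL) iU.
  exists M; split => // x; by rewrite (partial_val _ _ _ _ (conv_is_derive K U L i x sK KL iU)).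
have [M hM] := choice H.
apply: (@continuous_of_lip _ _ _ (\sum_i M i)); apply: lip_of_partials.
  by move=> i x; have [] := conv_is_derive K U L i x sK KL iU.
move=> i x; apply: (le_trans (proj2 (hM i) x)).
rewrite (bigD1 i)//= lerDl sumr_ge0// => j _; by have [] := hM j.
Qed.

(** [sm0] enlarged by convolutions with arbitrary integrable functions: the potential [sPhi] is such
    a convolution and has to enter test functions. *)
Inductive sm : ('rV[R]_n -> R) -> Prop :=
| sm_sm0 f : sm0 f -> sm f
| sm_add f g : sm f -> sm g -> sm (fun x => f x + g x)
| sm_mul f g : sm f -> sm g -> sm (fun x => f x * g x)
| sm_conv K U L : sm0 K -> (forall x, K x != 0 -> cube R n L x) -> Int U -> sm (conv K U).

Lemma sm_continuous f : sm f -> continuous f.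
Proof.
elim => {f} [f|f g sf cf sg cg|f g sf cf sg cg|K U L sK KL iU].
- exact: sm0_continuous.
- by move=> x; apply: continuousD; [exact: cf|exact: cg].
- by move=> x; apply: continuousM; [exact: cf|exact: cg].
- exact: conv_continuous KL iU.
Qed.

Lemma sm_partial f : sm f -> forall i, exists2 g, sm g & forall x, is_derive x (basis_vec R i) f (g x).
Proof.
move=> + i; elim => {f} [f /sm0_partial/(_ i)[g sg dg]|f g sf [f' sf' df] sg [g' sg' dg]|f g sf [f' sf' df] sg [g' sg' dg]|K U L sK KL iU].
- by exists g => //; exact: sm_sm0.
- by exists (fun t => f' t + g' t); [exact: sm_add|move=> t; exact: is_deriveD].
- exists (fun t => f t * g' t + g t * f' t); last by move=> t; exact: is_deriveM.
  by apply: sm_add; exact: sm_mul.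
- exists (conv (partial i K) U); last by move=> x; exact: conv_is_derive KL iU.
  apply: (sm_conv _ _ L) => //; first exact: sm0_partialE.
  by move=> x; exact: partial_supp.
Qed.

Lemma sm_partialE f i : sm f -> sm (partial i f).
Proof.
move=> /sm_partial/(_ i)[g sg dg]; rewrite (_ : partial i f = g)//.
by apply/funext => x; exact: partial_val.
Qed.

Lemma sm_derivable f i x : sm f -> derivable f x (basis_vec R i).
Proof. by move=> /sm_partial/(_ i)[g sg dg]; have [] := dg x. Qed.

Lemma sm_Ck f k : sm f -> Ck k f.
Proof.
elim: k f => [|k IH] f sf /=; split => //; try exact: sm_continuous.
by move=> i; split => [x|]; [exact: sm_derivable|apply: IH; exact: sm_partialE].
Qed.

Lemma sm_test f (A U : set 'rV[R]_n) (L : R) : sm f -> closed A -> A `<=` U -> A `<=` cube R n L ->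
  (forall x, f x != 0 -> A x) -> test_function U f.
Proof.
move=> sf cA AU AL fA; have h : closure [set x | f x != 0] `<=` A.
  apply: (@subset_trans _ (closure A)); first exact: closure_subset.
  by rewrite -(proj1 (closure_id A) cA).
split; first by move=> k; exact: sm_Ck.
  apply: (subclosed_compact _ (compact_cube L)); first exact: closed_closure.
  exact: subset_trans AL.
exact: subset_trans AU.
Qed.

End smooth.

(** * Fubini and integration by parts for compactly supported functions *)

Lemma FTC_line {R : realType} (h H : R -> R) (a b : R) : a < b ->
  (forall t : R, is_derive t 1 H (h t)) -> continuous h ->
  (forall t, (t < a) || (b < t) -> h t = 0) ->
  (\int[lebesgue_measure]_t (h t)%:E = (H b - H a)%:E)%E.
Proof.
move=> ab dH ch h0.
have cH : continuous H.
  by move=> t; apply/differentiable_continuous/derivable1_diffP; have [] := dH t.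
transitivity (\int[lebesgue_measure]_(t in `[a, b]) (h t)%:E)%E.
  rewrite [RHS]integral_mkcond; apply: eq_integral => t _.
  rewrite patchE; case: ifPn => // /negP tab; rewrite h0//.
  apply/negPn/negP; rewrite negb_or -!leNgt => /andP[at_ tb].
  by apply: tab; rewrite inE/= in_itv/= at_ tb.
rewrite (continuous_FTC2 (F := H))//.
- exact: continuous_subspaceT.
- split.
  + by move=> t _; have [] := dH t.
  + by apply: cvg_at_right_filter; exact: cH.
  + by apply: cvg_at_left_filter; exact: cH.
- by move=> t _; rewrite derive1E; exact: derive_val.
Qed.

Section fubini_step.
Context {R : realType} {m : nat}.
Implicit Type g : 'rV[R]_m.+1 -> R.

Let leb_sf : {sigma_finite_measure set 'rV[R]_m -> \bar R} := lebs R m.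

Lemma Int_pt g : Int g ->
  (leb_sf \x @lebesgue_measure R)%E.-integrable setT
    (fun p : 'rV[R]_m * measurableTypeR R => (g (pt p.1 p.2))%:E).
Proof.
move=> ig; have mg := Int_meas _ ig.
have mg2 : measurable_fun setT (fun p : 'rV[R]_m * measurableTypeR R => (g (pt p.1 p.2))%:E).
  by apply: (measurable_fun_pt2 R m _ _ (EFin \o g)); exact/measurable_EFinP.
apply/(@integrable12ltyP _ _ _ _ R leb_sf (@lebesgue_measure R)) => //.
have h := leb_tonelli R m (fun x => `|(g x)%:E|%E).
have h2 : (\int[leb R m.+1]_x `|(g x)%:E| < +oo)%E by case/integrableP: ig.
rewrite h in h2 => //.
by apply: measurableT_comp => //; exact/measurable_EFinP.
Qed.

Lemma leb_fubini1 g : Int g ->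
  (\int[leb R m.+1]_x (g x)%:E = \int[leb R m]_x' \int[lebesgue_measure]_t (g (pt x' t))%:E)%E.
Proof.
move=> ig; have ip := Int_pt _ ig.
rewrite -[LHS]/(\int[pushforward (lebs R m \x @lebesgue_measure R) (fun p : 'rV[R]_m * measurableTypeR R => pt p.1 p.2)]_x (g x)%:E)%E.
rewrite (integral_pushforward (@measurable_pt R m))//.
- rewrite preimage_setT; exact/esym/(@integral12_prod_meas1 _ _ _ _ R leb_sf (@lebesgue_measure R) _ ip).
- by apply/measurable_EFinP; exact: Int_meas.
Qed.

Lemma leb_fubini2 g : Int g ->
  (\int[leb R m.+1]_x (g x)%:E = \int[lebesgue_measure]_t \int[leb R m]_x' (g (pt x' t))%:E)%E.
Proof.
move=> ig; have ip := Int_pt _ ig.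
rewrite -[LHS]/(\int[pushforward (lebs R m \x @lebesgue_measure R) (fun p : 'rV[R]_m * measurableTypeR R => pt p.1 p.2)]_x (g x)%:E)%E.
rewrite (integral_pushforward (@measurable_pt R m))//.
- rewrite preimage_setT; exact/esym/(@integral21_prod_meas1 _ _ _ _ R leb_sf (@lebesgue_measure R) _ ip).
- by apply/measurable_EFinP; exact: Int_meas.
Qed.

Lemma pt_shift_max (x' : 'rV[R]_m) (s t : R) : pt x' (s + t) = s *: basis_vec R ord_max + pt x' t.
Proof.
apply/rowP => j; rewrite !mxE; case: unliftP => [i ->|->].
  by rewrite [lift _ _ == _]eq_sym (negbTE (neq_lift _ _)) andbF mulr0 add0r.
by rewrite !eqxx mulr1.
Qed.

Lemma pt_shift_lift (x' : 'rV[R]_m) i (s t : R) :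
  pt (s *: basis_vec R i + x') t = s *: basis_vec R (lift ord_max i) + pt x' t.
Proof.
apply/rowP => j; rewrite !mxE; case: unliftP => [k ->|->].
  by rewrite !mxE !eqxx/= (inj_eq lift_inj).
by rewrite (negbTE (neq_lift _ _)) andbF mulr0 add0r.
Qed.

End fubini_step.

(** Induction on the dimension. For the last coordinate Fubini integrates vertically first, and the
    fundamental theorem of calculus applies between [-(L+1)] and [L+1], where [f] vanishes. For any
    other coordinate it integrates horizontally first, and each slice falls under the induction
    hypothesis. *)
Lemma Io_partial0 {R : realType} {n : nat} (f : 'rV[R]_n -> R) i (L : R) : 0 <= L ->
  continuous f -> (forall x, derivable f x (basis_vec R i)) -> continuous (partial i f) ->
  (forall x, f x != 0 -> cube R n L x) -> Io (partial i f) = 0.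
Proof.
elim: n f i => [f [] //|m IH] f i L0 cf df cdf fL.
have pL x := partial_supp _ _ i x fL.
have [M M0 fM] := bounded_of_supp _ _ cdf pL.
have ip : Int (partial i f).
  by apply: (Int_bnd _ _ _ L0 (continuous_measurable_rV _ _ _ cdf) fM pL).
have cpt1 (x' : 'rV[R]_m) : continuous (fun t : R => pt x' t).
  have -> : (fun t : R => pt x' t) = (fun t : R => t *: basis_vec R ord_max + pt x' 0).
    by apply/funext => t; rewrite -pt_shift_max addr0.
  move=> t; apply: cvgD; last exact: cvg_cst.
  by apply: cvgZr_tmp.
have cpt2 (t : R) : continuous (fun x' : 'rV[R]_m => pt x' t).
  move=> x'; have FF : Filter (nbhs x') := nbhs_filter x'.
  apply/cvgrPdist_le => e e0.
  have B : nbhs x' (ball x' e) by exact: nbhsx_ballx.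
  apply: (@filterS _ _ FF _ _ _ B) => y; rewrite mx_norm_ball /ball_/= => /ltW yx.
  apply: rV_norm_le => [|j]; first exact: ltW.
  rewrite !mxE; case: unliftP => [k _|_]; last by rewrite subrr normr0 ltW.
  by apply: le_trans yx; have := rV_norm_ge _ _ (x' - y) k; rewrite !mxE.
rewrite /Rintegral; case: (unliftP ord_max i) df cdf pL fM ip => [j ->|->] df cdf pL fM ip; last first.
  rewrite leb_fubini1// [X in fine X](_ : _ = 0%E)//.
  apply: integral0_eq => x' _.
  have L1 : - (L + 1) < L + 1 by lra.
  have fz (t : R) : L < `|t| -> f (pt x' t) = 0.
    move=> Lt; apply/eqP/negPn/negP => /fL/(_ ord_max); rewrite mxE unlift_none.
    by rewrite leNgt Lt.
  have L3 : L < `|L + 1| by rewrite ger0_norm ?addr_ge0// ltrDl.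
  have dH (t : R) : is_derive t 1 (fun t => f (pt x' t)) (partial ord_max f (pt x' t)).
    have [_ h2] := is_derive_line f (pt x' 0) (basis_vec R ord_max) t (partial ord_max f (pt x' t)).
    rewrite -pt_shift_max addr0 in h2.
    have -> : (fun t : R => f (pt x' t)) = (fun s : R => f (s *: basis_vec R ord_max + pt x' 0)).
      by apply/funext => s; rewrite -pt_shift_max addr0.
    by apply: h2; exact: derivableP.
  have ch : continuous (fun t : R => partial ord_max f (pt x' t)).
    by move=> t; apply: continuous_comp; [exact: cpt1|exact: cdf].
  have h0 (t : R) : (t < - (L + 1)) || (L + 1 < t) -> partial ord_max f (pt x' t) = 0.
    move=> tL; apply/eqP/negPn/negP => /pL/(_ ord_max); rewrite mxE unlift_none.
    by rewrite ler_norml => /andP[h1 h2]; move: tL; rewrite !ltNge; lra.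
  have -> := FTC_line _ _ _ _ L1 dH ch h0.
  by rewrite (fz (L + 1))// (fz (- (L + 1))) ?normrN// subrr.
rewrite leb_fubini2// [X in fine X](_ : _ = 0%E)//.
apply: integral0_eq => t _.
have E x' : partial (lift ord_max j) f (pt x' t) = partial j (fun x' => f (pt x' t)) x'.
  apply/esym/partial_val; apply/is_derive_line0.
  under eq_fun do rewrite pt_shift_lift.
  apply/is_derive_line0; exact: partialP.
under eq_integral do rewrite E.
have := IH (fun x' => f (pt x' t)) j L0.
have c1 : continuous (fun x' : 'rV[R]_m => f (pt x' t)).
  by move=> x'; apply: continuous_comp; [exact: cpt2|exact: cf].
have c2 : continuous (partial j (fun x' : 'rV[R]_m => f (pt x' t))).
  rewrite (_ : partial j _ = (fun x' => partial (lift ord_max j) f (pt x' t))); last first.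
    by apply/funext => x'; rewrite E.
  by move=> x'; apply: continuous_comp; [exact: cpt2|exact: cdf].
have d1 x' : derivable (fun x' : 'rV[R]_m => f (pt x' t)) x' (basis_vec R j).
  have : is_derive x' (basis_vec R j) (fun x' : 'rV[R]_m => f (pt x' t)) (partial (lift ord_max j) f (pt x' t)).
    apply/is_derive_line0.
    under eq_fun do rewrite pt_shift_lift.
    apply/is_derive_line0; exact: partialP.
  by case.
have s1 (x' : 'rV[R]_m) : f (pt x' t) != 0 -> cube R m L x'.
  by move=> /fL h k; have := h (lift ord_max k); rewrite mxE liftK.
move=> /(_ c1 d1 c2 s1) I0.
have ij : Int (partial j (fun x' : 'rV[R]_m => f (pt x' t))).
  apply: (Int_bnd _ M L L0 (continuous_measurable_rV _ _ _ c2)).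
    by move=> x'; rewrite -E.
  by move=> x'; apply: partial_supp.
(* The induction hypothesis speaks of the finite part of the slice integral; it determines the
   integral only once that is known to be finite. *)
have := integrable_fin_num measurableT ij => /fineK <-.
by congr EFin.
Qed.

Lemma Io_dct {R : realType} {n : nat} (f_ : nat -> 'rV[R]_n -> R) (f G : 'rV[R]_n -> R) :
  (forall k, measurable_fun setT (f_ k)) -> measurable_fun setT f -> Int G ->
  (forall x, f_ ^~ x @ \oo --> f x) -> (forall k x, `|f_ k x| <= G x) ->
  forall e : R, 0 < e -> exists N, forall k, (N <= k)%N -> Io (fun x => `|f_ k x - f x|) <= e.
Proof.
move=> mf_ mf iG cf fG e e0.
have mf_' k : measurable_fun setT (fun x => (f_ k x)%:E) by exact/measurable_EFinP.
have mf' : measurable_fun setT (EFin \o f) by exact/measurable_EFinP.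
have cf' : {ae leb R n, forall x, setT x -> (fun k => (f_ k x)%:E) @ \oo --> (EFin \o f) x}.
  by apply: aeW => x _; apply: cvg_EFin; [exact: nearW|exact: cf].
have fG' : {ae leb R n, forall x k, setT x -> (`|(f_ k x)%:E| <= (EFin \o G) x)%E}.
  by apply: aeW => x k _; rewrite /= lee_fin.
have [h1 h2 _] := @dominated_convergence _ _ _ (leb R n) setT measurableT (fun k x => (f_ k x)%:E) (EFin \o f) (EFin \o G)
  mf_' mf' cf' iG fG'.
have If k : Int (f_ k) by apply: (Int_dom _ _ (mf_ k) iG).
have /fine_cvgP[_] := h2.
move/cvgrPdist_le/(_ e e0) => [N _ hN]; exists N => k /hN.
rewrite sub0r normrN /= => /(le_trans (ler_norm _)).
by [].
Qed.

Import HBSimple.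

(** * Density of smooth functions and mollification *)

Section density.
Context {R : realType} {n : nat}.
Implicit Types U v : 'rV[R]_n -> R.

(** Membership in the L^1 closure of the compactly supported functions of [sm0]. *)
Definition approx U := forall e : R, 0 < e -> exists v,
  [/\ sm0 v, exists2 L : R, 0 <= L & forall x, v x != 0 -> cube R n L x &
      Io (fun x => `|U x - v x|) <= e].

Lemma sm0_Int v : sm0 v -> (exists2 L : R, 0 <= L & forall x, v x != 0 -> cube R n L x) -> Int v.
Proof.
move=> sv [L L0 vL]; have [M M0 vM] := bounded_of_supp _ _ (sm0_continuous _ sv) vL.
by apply: (Int_bnd _ M L) => //; apply: continuous_measurable_rV; exact: sm0_continuous.
Qed.

Lemma cube_le (L L' : R) (x : 'rV[R]_n) : L <= L' -> cube R n L x -> cube R n L' x.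
Proof. by move=> LL h i; apply: le_trans (h i) LL. Qed.

Lemma approx_add U V : Int U -> Int V -> approx U -> approx V -> approx (fun x => U x + V x).
Proof.
move=> iU iV aU aV e e0; have e2 : 0 < e / 2 by rewrite divr_gt0.
have [v [sv [L L0 vL] hv]] := aU _ e2; have [w [sw [L' L0' wL] hw]] := aV _ e2.
have iv : Int v by apply: sm0_Int => //; exists L.
have iw : Int w by apply: sm0_Int => //; exists L'.
exists (fun x => v x + w x); split; first exact: sm0_add.
- exists (L + L'); first exact: addr_ge0.
  move=> x; have [v0|/vL h _] := eqVneq (v x) 0; last by apply: cube_le h; rewrite lerDl.
  by rewrite v0 add0r => /wL h; apply: cube_le h; rewrite lerDr.
- rewrite (splitr e); apply: le_trans (lerD hv hw).
  have i1 := Int_norm _ (Int_sub _ _ iU iv); have i2 := Int_norm _ (Int_sub _ _ iV iw).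
  rewrite -Io_add//; apply: Io_le.
  + by apply: Int_norm; apply: Int_sub; exact: Int_add.
  + exact: Int_add.
  + by move=> x; rewrite opprD addrACA; exact: ler_normD.
Qed.

Lemma approx_scale (c : R) U : Int U -> approx U -> approx (fun x => c * U x).
Proof.
move=> iU aU e e0; have e2 : 0 < e / (`|c| + 1) by rewrite divr_gt0// ltr_wpDl.
have [v [sv [L L0 vL] hv]] := aU _ e2.
have iv : Int v by apply: sm0_Int => //; exists L.
exists (fun x => c * v x); split; first by apply: sm0_mul => //; exact: sm0_cst.
  by exists L => // x; rewrite mulf_eq0 negb_or => /andP[_ /vL].
rewrite (Io_eq _ (fun x => `|c| * `|U x - v x|)); last by move=> x; rewrite -mulrBr normrM.
rewrite Io_scale; last exact/Int_norm/Int_sub.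
apply: (@le_trans _ _ (`|c| * (e / (`|c| + 1)))); first by rewrite ler_wpM2l.
by rewrite mulrCA ler_piMr ?(ltW e0)// ler_pdivrMr ?mul1r ?lerDl// ltr_wpDl.
Qed.

Lemma approx_lim U : Int U ->
  (forall e : R, 0 < e -> exists W, [/\ Int W, approx W & Io (fun x => `|U x - W x|) <= e]) -> approx U.
Proof.
move=> iU h e e0; have e2 : 0 < e / 2 by rewrite divr_gt0.
have [W [iW aW hW]] := h _ e2; have [v [sv vL hv]] := aW _ e2.
exists v; split => //; rewrite (splitr e); apply: le_trans (lerD hW hv).
have iv : Int v by exact: sm0_Int.
rewrite -Io_add//; [|exact/Int_norm/Int_sub|exact/Int_norm/Int_sub].
apply: Io_le; [exact/Int_norm/Int_sub| |].
  by apply: Int_add; exact/Int_norm/Int_sub.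
by move=> x; rewrite -[U x - v x](subrKA (W x)); exact: ler_normD.
Qed.

(** These sets form a pi-system generating the measurable sets and are products of half-lines, hence
    limits of products of steps. *)
Definition octant (a : 'I_n -> R) : set 'rV[R]_n := [set x | forall i, a i < x ord0 i].

Lemma measurable_octant a : measurable (octant a).
Proof.
have -> : octant a = [set x : 'rV[R]_n | forall i, `](a i), +oo[%classic (x ord0 i)].
  by apply/seteqP; split => x /= h i; have := h i; rewrite /= in_itv/= andbT.
by apply: (@measurable_boxset R n (fun i => `](a i), +oo[%classic)) => i; exact: measurable_itv.
Qed.

Lemma indic_cvg_step (a t : R) : (fun k : nat => step 0 (k.+1%:R * (t - a))) @ \oo --> ((a < t)%R%:R : R).
Proof.
have [at_|ta] := ltP a t; last first.
  rewrite (_ : (fun _ => _) = cst 0); first exact: cvg_cst.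
  apply/funext => k; apply: step_le1; apply: (@le_trans _ _ 0) => //.
  by rewrite mulr_ge0_le0// subr_le0.
apply/cvgrPdist_le => e e0; near=> k.
rewrite step_ge2 ?subrr ?normr0 ?(ltW e0)//.
rewrite -ler_pdivrMr ?subr_gt0//; near: k.
have e1 : 0 <= 2 / (t - a) by rewrite divr_ge0// subr_ge0 ltW.
exists (Num.bound (2 / (t - a))) => //= j0 hj; apply: (le_trans (ltW (archi_boundP e1))).
by rewrite ler_nat (leq_trans hj).
Unshelve. all: by end_near. Qed.

(** The argument of the step starts at 2, where [step 0] is already 1, so the limit includes
    [t = L]; in [indic_cvg_step] it starts at 0, and the limit excludes [t = a]. *)
Lemma le_cvg_step (L t : R) : (fun k : nat => step 0 (2 + k.+1%:R * (L - t))) @ \oo --> ((t <= L)%R%:R : R).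
Proof.
have [tL|Lt] := leP t L.
  rewrite (_ : (fun _ => _) = cst 1); first exact: cvg_cst.
  apply/funext => k; apply: step_ge2; rewrite lerDl.
  by rewrite mulr_ge0// subr_ge0.
apply/cvgrPdist_le => e e0; near=> k.
rewrite step_le1 ?subrr ?normr0 ?(ltW e0)//.
have : 1 <= k.+1%:R * (t - L).
  rewrite -ler_pdivrMr ?subr_gt0//; near: k.
  have e1 : 0 <= 1 / (t - L) by rewrite divr_ge0// subr_ge0 ltW.
  exists (Num.bound (1 / (t - L))) => //= j0 hj; apply: (le_trans (ltW (archi_boundP e1))).
  by rewrite ler_nat (leq_trans hj).
by rewrite !mulrBr; lra.
Unshelve. all: by end_near. Qed.

Lemma sm0_sub f g : @sm0 R n f -> sm0 g -> sm0 (fun x => f x - g x).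
Proof.
move=> sf sg; have -> : (fun x => f x - g x) = (fun x => f x + (-1) * g x).
  by apply/funext => x; rewrite mulN1r.
by apply: sm0_add => //; apply: sm0_mul => //; exact: sm0_cst.
Qed.

Lemma sm0_prod (J : Type) (s : seq J) (F : J -> 'rV[R]_n -> R) : (forall j, sm0 (F j)) ->
  sm0 (fun x => \prod_(j <- s) F j x).
Proof.
move=> h; elim: s => [|j s IH].
  by rewrite (_ : (fun _ => _) = fun=> 1); [exact: sm0_cst|apply/funext => x; rewrite big_nil].
rewrite (_ : (fun _ => _) = fun x => F j x * \prod_(j <- s) F j x); first exact: sm0_mul.
by apply/funext => x; rewrite big_cons.
Qed.

(** Dominated convergence for products of both kinds of steps: all approximants live in the cube of
    radius [L + 1], whose indicator dominates them. *)
Lemma approx_octant a (L : R) : 0 <= L -> approx (\1_(octant a `&` cube R n L)).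
Proof.
move=> L0 e e0.
pose w (k : nat) i (t : R) := step 0 (k.+1%:R * (t - a i)) * (step 0 (2 + k.+1%:R * (L - t)) * step 0 (2 + k.+1%:R * (L - (- t)))).
pose v (k : nat) (x : 'rV[R]_n) := \prod_i w k i (x ord0 i).
have sv k : sm0 (v k).
  apply: sm0_prod => i.
  have sc c d : sm0 (fun x : 'rV[R]_n => c + d * x ord0 i).
    apply: sm0_add; first exact: sm0_cst.
    by apply: sm0_mul; [exact: sm0_cst|exact: sm0_coord].
  apply: sm0_mul; last apply: sm0_mul.
  - apply: (sm0_step 0 (fun x : 'rV[R]_n => _)).
    rewrite (_ : (fun _ => _) = fun x : 'rV[R]_n => k.+1%:R * (- a i) + k.+1%:R * x ord0 i)//.
    by apply/funext => x; rewrite -mulrDr addrC.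
  - apply: (sm0_step 0 (fun x : 'rV[R]_n => _)).
    rewrite (_ : (fun _ => _) = fun x : 'rV[R]_n => (2 + k.+1%:R * L) + (- k.+1%:R) * x ord0 i)//.
    by apply/funext => x; ring.
  - apply: (sm0_step 0 (fun x : 'rV[R]_n => _)).
    rewrite (_ : (fun _ => _) = fun x : 'rV[R]_n => (2 + k.+1%:R * L) + k.+1%:R * x ord0 i)//.
    by apply/funext => x; ring.
have w01 k i t : 0 <= w k i t <= 1.
  have m2 (x y : R) : 0 <= x <= 1 -> 0 <= y <= 1 -> 0 <= x * y <= 1.
    by move=> /andP[x0 x1] /andP[y0 y1]; rewrite mulr_ge0//= mulr_ile1.
  have st (x : R) : 0 <= step 0 x <= 1 by rewrite step0_ge0 step0_le1.
  exact: (m2 _ _ (st _) (m2 _ _ (st _) (st _))).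
have v01 k x : 0 <= v k x <= 1.
  by rewrite /v prodr_ge0/= ?prodr_ile1// => i _; have /andP[] := w01 k i (x ord0 i).
have vL k x : v k x != 0 -> cube R n (L + 1) x.
  move=> vx i; have : w k i (x ord0 i) != 0 by move: vx; rewrite /v prodf_seq_neq0 => /allP/(_ i)/=; rewrite mem_index_enum; exact.
  rewrite /w mulf_eq0 negb_or => /andP[_]; rewrite mulf_eq0 negb_or => /andP[h1 h2].
  have A (t : R) : step 0 (2 + k.+1%:R * (L - t)) != 0 -> t <= L + 1.
    move=> h; rewrite leNgt; apply/negP => Lt; move/negP: h; apply; apply/eqP; apply: step_le1.
    have : 1 <= k.+1%:R * (t - L).
      have h4 : 1 <= t - L by move: Lt; lra.
      apply: (le_trans h4); rewrite ler_peMl ?ler1n//; lra.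
    by rewrite !mulrBr; lra.
  by rewrite ler_norml (A _ h1) andbT lerNl (A _ h2).
have cv x : v ^~ x @ \oo --> (\1_(octant a `&` cube R n L) x : R).
  have -> : (\1_(octant a `&` cube R n L) x : R) = \prod_i ((a i < x ord0 i)%R%:R * ((x ord0 i <= L)%R%:R * (- x ord0 i <= L)%R%:R)).
    rewrite indicE; have [/set_mem[h1 h2]|/negP h] := boolP (x \in octant a `&` cube R n L).
      rewrite big1// => i _; rewrite (h1 i) mul1r.
      by have := h2 i; rewrite ler_norml => /andP[h3 h4]; rewrite h4 lerNl h3 mulr1.
    apply/esym/eqP/prodf_eq0.
    apply: contrapT => h3; apply: h; apply/mem_set.
    have h4 i : a i < x ord0 i /\ `|x ord0 i| <= L.
      have : ~~ ((a i < x ord0 i)%R%:R * ((x ord0 i <= L)%R%:R * (- x ord0 i <= L)%R%:R) == 0 :> R).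
        by apply/negP => h4; apply: h3; exists i.
      rewrite !mulf_eq0 !pnatr_eq0 !eqb0 !negb_or !negbK => /and3P[h5 h6 h7].
      by split => //; rewrite ler_norml h6 lerNl h7.
    by split => i; have [] := h4 i.
  rewrite /v; apply: cvg_big => [p|i _]; first by apply: cvgM; [exact: cvg_fst|exact: cvg_snd].
  rewrite /w.
  apply: cvgM; first exact: indic_cvg_step.
  by apply: cvgM; exact: le_cvg_step.
have L10 : 0 <= L + 1 by rewrite addr_ge0.
have iG := @Int_cube R n _ L10.
have mE : measurable (octant a `&` cube R n L).
  by apply: measurableI; [exact: measurable_octant|exact: measurable_cube].
have [|||N hN] := @Io_dct R n v (\1_(octant a `&` cube R n L)) (\1_(cube R n (L + 1))) _ _ iG cv _ e e0.
- by move=> k; apply: continuous_measurable_rV; exact: sm0_continuous.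
- exact: measurable_indic.
- move=> k x; have /andP[h1 h2] := v01 k x; rewrite ger0_norm// indicE.
  by have [->//|/vL h] := eqVneq (v k x) 0; rewrite mem_set.
exists (v N); split => //; first by exists (L + 1) => // x; exact: vL.
by have := hN N (leqnn N); under eq_Rintegral do rewrite distrC.
Qed.


(** A half-space in one coordinate is the union over [k] of the octants with lower bound [- k] in
    every other coordinate. *)
Lemma measurable_octants :
  @measurable _ 'rV[R]_n = <<s [set A | exists a, A = octant a] >>.
Proof.
apply/seteqP; split; last first.
  apply: smallest_sub; first exact: sigma_algebra_measurable.
  by move=> _ [a ->]; exact: measurable_octant.
pose G := [set A | exists a, A = octant a].
pose T := g_sigma_algebraType G.
have mc i : measurable_fun [set: T] (fun x : T => ((x : 'rV[R]_n) ord0 i : measurableTypeR R)).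
  apply: (@measurability _ _ T (measurableTypeR R) setT _ (@RGenOInfty.G R)).
    exact: RGenOInfty.measurableE.
  move=> _ [_ [a ->] <-]; rewrite setTI.
  have -> : (fun x : T => (x : 'rV[R]_n) ord0 i) @^-1` `]a, +oo[%classic =
      \bigcup_(k : nat) octant (fun j => if j == i then a else - k%:R).
    apply/seteqP; split => x /=; rewrite in_itv/= andbT.
      move=> ax; exists (Num.bound `|x|) => // j /=; case: eqP => [->//|_].
      rewrite ltrNl; apply: (le_lt_trans _ (archi_boundP (normr_ge0 x))).
      by apply: le_trans (rV_norm_ge _ _ x j); rewrite -normrN ler_norm.
    by move=> [k _ /(_ i)]; rewrite eqxx.
  apply: bigcup_measurable => k _; apply: sub_sigma_algebra.
  by exists (fun j => if j == i then a else - k%:R).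
apply: smallest_sub; first exact: (@sigma_algebra_measurable _ T).
rewrite -bigcup_seq => A [i _ [Y mY <-]].
exact: (mc i measurableT Y mY).
Qed.

(** The pi-lambda argument inside a fixed cube: a complement is a difference from the cube, and a
    countable disjoint union is the L^1 limit of its partial sums. *)
Lemma approx_indic (E : set 'rV[R]_n) (L : R) : 0 <= L -> measurable E -> approx (\1_(E `&` cube R n L)).
Proof.
move=> L0 mE; rewrite measurable_octants in mE; move: E mE.
have iE (E : set 'rV[R]_n) : measurable E -> Int (\1_(E `&` cube R n L)).
  move=> mE; apply: (Int_dom _ (\1_(cube R n L))).
  - by apply: measurable_indic; apply: measurableI => //; exact: measurable_cube.
  - exact: Int_cube.
  - move=> x; rewrite !indicE in_setI; case: (x \in E) => //=; first by rewrite normr_nat.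
    by rewrite normr0.
apply: (dynkin_induction measurable_octants).
- move=> _ _ [a ->] [b ->]; exists (fun i => maxr (a i) (b i)).
  apply/seteqP; split => x /=; first by move=> [h1 h2] i; rewrite gt_max h1 h2.
  by move=> h; split => i; have := h i; rewrite gt_max => /andP[].
- rewrite setTI.
  have -> : cube R n L = octant (fun=> - L - 1) `&` cube R n L.
    apply/seteqP; split => x //=; last by case.
    move=> h; split => // i; have := h i; rewrite ler_norml => /andP[h1 _]; lra.
  exact: approx_octant.
- by move=> _ [a ->]; exact: approx_octant.
- move=> S mS aS.
  have -> : \1_(~` S `&` cube R n L) = (fun x => \1_(setT `&` cube R n L) x + (-1) * \1_(S `&` cube R n L) x) :> ('rV[R]_n -> R).
    apply/funext => x; rewrite !indicE !in_setI in_setT in_setC /=.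
    by case: (x \in S); case: (x \in cube R n L) => /=; rewrite ?mulr0 ?addr0 ?mulN1r ?subrr.
  apply: approx_add; [exact: iE| |rewrite setTI|].
  + by apply: Int_scale; exact: iE.
  + have -> : cube R n L = octant (fun=> - L - 1) `&` cube R n L.
      apply/seteqP; split => x //=; last by case.
      move=> h; split => // i; have := h i; rewrite ler_norml => /andP[h1 _]; lra.
    exact: approx_octant.
  + by apply: approx_scale => //; exact: iE.
- move=> F mF tF aF.
  have mUF : measurable (\bigcup_k F k) by exact: bigcupT_measurable.
  apply: approx_lim; first exact: iE.
  move=> e e0.
  pose W (N : nat) (x : 'rV[R]_n) : R := \sum_(k < N) \1_(F k `&` cube R n L) x.
  have iW N : Int (W N) by apply: Int_sum => k; exact: iE.
  have aW N : approx (W N).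
    elim: N => [|N IH].
      have -> : W 0%N = fun=> 0 by apply/funext => x; rewrite /W big_ord0.
      move=> d d0; exists (fun=> 0); split; first exact: sm0_cst.
        by exists 0 => // x; rewrite eqxx.
      by under eq_Rintegral do rewrite subrr normr0; rewrite Io_0 ltW.
    have -> : W N.+1 = fun x => W N x + \1_(F N `&` cube R n L) x.
      by apply/funext => x; rewrite /W big_ord_recr.
    by apply: approx_add => //; exact: iE.
  (* By disjointness a partial sum is 1 once it contains the only index [k0] with [x] in [F k0], and
     0 otherwise. This gives both the convergence and the domination. *)
  have key x : (exists2 k0 : nat, \1_(\bigcup_k F k `&` cube R n L) x = 1 :> R & forall N, W N x = (k0 < N)%N%:R) \/
      (\1_(\bigcup_k F k `&` cube R n L) x = 0 :> R /\ forall N, W N x = 0).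
    have [[k0 [Fk cx]]|h] := pselect (exists k, F k x /\ cube R n L x).
      left; exists k0; first by rewrite indicE mem_set//; split => //; exists k0.
      move=> N.
      have FE k : \1_(F k `&` cube R n L) x = (k == k0)%:R :> R.
        rewrite indicE; case: eqVneq => [->|kk0]; first by rewrite mem_set.
        rewrite memNset// => -[Fkx _]; move/eqP: kk0; apply.
        by apply: tF => //; exists x.
      rewrite /W; under eq_bigr do rewrite FE.
      have [kN|Nk] := ltnP k0 N.
        rewrite (bigD1 (Ordinal kN))//= eqxx big1 ?addr0// => k.
        by rewrite -val_eqE/= => /negbTE ->.
      rewrite big1// => k _; rewrite (_ : (_ == _) = false)//.
      by apply/negbTE; rewrite neq_ltn (leq_trans (ltn_ord k) Nk).
    right; split.
      by rewrite indicE memNset// => -[[k _ Fk] cx]; apply: h; exists k.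
    move=> N; rewrite /W big1// => k _; rewrite indicE memNset// => -[Fk cx].
    by apply: h; exists (val k).
  have [||||N hN] := @Io_dct R n W (\1_(\bigcup_k F k `&` cube R n L)) (\1_(cube R n L)) _ _ (Int_cube _ L0) _ _ e e0.
  + by move=> N; exact: Int_meas (iW N).
  + by apply: measurable_indic; apply: measurableI => //; exact: measurable_cube.
  + move=> x; have [[k0 -> WE]|[-> WE]] := key x.
      apply/cvgrPdist_le => d d0; near=> N; rewrite WE (_ : (k0 < N)%N) ?subrr ?normr0 ?(ltW d0)//.
      by near: N; exists k0.+1.
    by rewrite (_ : W ^~ x = cst 0); [exact: cvg_cst|apply/funext => N; rewrite WE].
  + move=> N x; have [cx|cx] := pselect (cube R n L x).
      rewrite [leRHS]indicE mem_set//.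
      by have [[k0 _ ->]|[_ ->]] := key x; rewrite ?normr0// normr_nat; case: ltnP.
    rewrite /W big1 ?normr0// => k _; rewrite indicE memNset// => -[_ //].
  + exists (W N); split => //.
    by have := hN N (leqnn N); under eq_Rintegral do rewrite distrC.
Unshelve. all: by end_near. Qed.

Lemma approx_cut U : Int U -> forall e : R, 0 < e -> exists2 L : R, 0 <= L &
  Io (fun x => `|U x - U x * \1_(cube R n L) x|) <= e.
Proof.
move=> iU e e0.
have iL (k : nat) : Int (fun x => U x * \1_(cube R n k%:R) x).
  under eq_fun do rewrite mulrC.
  apply: (Int_mulb _ _ 1) => //.
    by apply: measurable_indic; exact: measurable_cube.
  by move=> x; rewrite indicE normr_nat; case: (_ \in _).
have [||||N hN] := @Io_dct R n (fun k x => U x * \1_(cube R n k%:R) x) U (fun x => `|U x|) _ _ (Int_norm _ iU) _ _ e e0.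
- by move=> k; exact: Int_meas (iL k).
- exact: Int_meas.
- move=> x; apply/cvgrPdist_le => d d0; near=> k.
  rewrite indicE mem_set ?mulr1 ?subrr ?normr0 ?(ltW d0)//.
  apply: cube_exhaust; near: k.
  exists (Num.bound `|x|) => //= k hk; apply: (le_trans (ltW (archi_boundP (normr_ge0 x)))).
  by rewrite ler_nat.
- move=> k x; rewrite normrM ler_piMr// indicE normr_nat; by case: (_ \in _).
- exists N%:R => //.
  by have := hN N (leqnn N); under eq_Rintegral do rewrite distrC.
Unshelve. all: by end_near. Qed.

(** Cutting off to a cube and passing to simple functions leaves finite combinations of indicators
    of measurable subsets of the cube. *)
Lemma approx_Int U : Int U -> approx U.
Proof.
move=> iU; apply: approx_lim => // e e0; have e2 : 0 < e / 2 by rewrite divr_gt0.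
have [L L0 hL] := approx_cut _ iU _ e2.
have [g [ig _ g0]] := approximation_sfun_integrable measurableT iU.
have /fine_cvgP[_ /cvgrPdist_le/(_ _ e2)[N _ hN]] := g0.
have {hN} := hN N (leqnn N); rewrite sub0r normrN => /(le_trans (ler_norm _)) hN.
have mc : measurable (cube R n L) := measurable_cube _ _ _.
exists (fun x => g N x * \1_(cube R n L) x).
have cb f : Int f -> Int (fun x => f x * \1_(cube R n L) x).
  move=> h; under eq_fun do rewrite mulrC.
  apply: (Int_mulb _ _ 1) => // x.
  by rewrite indicE normr_nat; case: (_ \in _).
have ign : Int (g N) := ig N.
split; first exact: cb.
  have gE : (fun x => g N x * \1_(cube R n L) x) =
      (fun x => \sum_(r <- finmap.enum_fset (fset_set (range (g N)))) r * \1_(g N @^-1` [set r] `&` cube R n L) x).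
    apply/funext => x; rewrite {1}fimfunE fsbig_finite//= mulr_suml; apply: eq_bigr => r _.
    by rewrite -mulrA; congr (_ * _); rewrite !indicE in_setI -natrM mulnb.
  rewrite gE.
  have ir (r : R) : Int (\1_(g N @^-1` [set r] `&` cube R n L)).
    apply: (Int_dom _ (\1_(cube R n L))).
    - by apply: measurable_indic; apply: measurableI.
    - exact: Int_cube.
    - move=> x; rewrite !indicE in_setI; case: (x \in _ @^-1` _) => //=; first by rewrite normr_nat.
      by rewrite normr0.
  elim: (finmap.enum_fset _) => [|r s IH].
    move=> d d0; exists (fun=> 0); split; first exact: sm0_cst.
      by exists 0 => // x; rewrite eqxx.
    by under eq_Rintegral do rewrite big_nil subrr normr0; rewrite Io_0 ltW.
  have -> : (fun x => \sum_(r0 <- r :: s) r0 * \1_(g N @^-1` [set r0] `&` cube R n L) x) =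
    (fun x => r * \1_(g N @^-1` [set r] `&` cube R n L) x + \sum_(r0 <- s) r0 * \1_(g N @^-1` [set r0] `&` cube R n L) x).
    by apply/funext => x; rewrite big_cons.
  apply: approx_add => //.
  - exact: Int_scale.
  - by apply: Int_sum => r0; exact: Int_scale.
  - by apply: approx_scale => //; exact: approx_indic.
have iS : Int (fun x => `|U x - g N x|) by exact/Int_norm/Int_sub.
have {}hN : Io (fun x => `|U x - g N x|) <= e / 2 by exact: hN.
rewrite (splitr e); apply: le_trans (lerD hL hN).
have i1 : Int (fun x => `|U x - U x * \1_(cube R n L) x|) by apply/Int_norm/Int_sub => //; exact: cb.
rewrite -Io_add//.
apply: Io_le.
- by apply/Int_norm/Int_sub => //; exact: cb.
- exact: Int_add.
- move=> x; rewrite -[U x - _](subrKA (U x * \1_(cube R n L) x)).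
  apply: (le_trans (ler_normD _ _)); rewrite lerD2l -mulrBl normrM ler_piMr//.
  by rewrite indicE normr_nat; case: (_ \in _).
Qed.

End density.

Section mollification.
Context {R : realType} {n : nat}.
Implicit Types U W : 'rV[R]_n -> R.

(** Mass one is required in each variable of [rho (x - z)] separately, so that translation and
    reflection invariance of [leb] are never invoked. The integral in [z] makes convolution an
    average, the one in [x] makes it an L^1 contraction. *)
Definition mollifier (r : R) (rho : 'rV[R]_n -> R) : Prop :=
  [/\ sm0 rho, (forall x, 0 <= rho x), (forall x, rho x != 0 -> cube R n r x),
      (forall x : 'rV[R]_n, Io (fun z : 'rV[R]_n => rho (x - z)) = 1) &
      (forall z : 'rV[R]_n, Io (fun x : 'rV[R]_n => rho (x - z)) = 1)].

Lemma cube_sub (L r : R) (x z : 'rV[R]_n) : cube R n L z -> cube R n r (x - z) -> cube R n (L + r) x.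
Proof.
move=> hz hx i; have := hz i; have := hx i; rewrite !mxE => h1 h2.
rewrite -[x ord0 i](subrK (z ord0 i)) addrC.
by apply: (le_trans (ler_normD _ _)); exact: lerD.
Qed.

Lemma cube_subl (L r : R) (x z : 'rV[R]_n) : cube R n L x -> cube R n r (x - z) -> cube R n (L + r) z.
Proof.
move=> hz hx i; have := hz i; have := hx i; rewrite !mxE => h1 h2.
have -> : z ord0 i = x ord0 i - (x ord0 i - z ord0 i) by ring.
by apply: (le_trans (ler_normB _ _)); exact: lerD.
Qed.

Section one.
Variables (r : R) (rho : 'rV[R]_n -> R) (mr : mollifier r rho).

Let srho : sm0 rho. Proof. by case: mr. Qed.
Let rho0 x : 0 <= rho x. Proof. by case: mr. Qed.
Let rhor x : rho x != 0 -> cube R n r x. Proof. by case: mr => _ _ + _ _; apply. Qed.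
Let crho : continuous rho. Proof. exact: sm0_continuous. Qed.
Let mrho : measurable_fun setT rho. Proof. exact: continuous_measurable_rV. Qed.

Lemma moll_cube0 x : cube R n `|x| x.
Proof. exact: cube_exhaust. Qed.

Lemma moll_Int_l (x : 'rV[R]_n) : Int (fun z : 'rV[R]_n => rho (x - z)).
Proof.
have [M M0 hM] := bounded_of_supp _ _ crho rhor.
apply: (Int_bnd _ M (`|x| + `|r|)) => //; first exact: measurable_shift.
move=> z /rhor h; apply: (cube_subl _ _ x) (moll_cube0 x) _.
by apply: cube_le h; exact: ler_norm.
Qed.

Lemma measurable_sub2 : measurable_fun setT (fun p : 'rV[R]_n * 'rV[R]_n => p.1 - p.2).
Proof.
apply: measurable_fun_rV => i.
apply: (eq_measurable_fun (fun p : 'rV[R]_n * 'rV[R]_n => p.1 ord0 i - p.2 ord0 i)).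
  by move=> p _; rewrite !mxE.
apply: measurable_funB.
  by apply: (measurableT_comp (measurable_coord i)); exact: measurable_fst.
by apply: (measurableT_comp (measurable_coord i)); exact: measurable_snd.
Qed.

Lemma moll_joint U : measurable_fun setT U ->
  measurable_fun setT (fun p : 'rV[R]_n * 'rV[R]_n => (rho (p.1 - p.2) * U p.2)%:E).
Proof.
move=> mU; apply/measurable_EFinP; apply: measurable_funM.
  exact: (measurableT_comp mrho measurable_sub2).
by apply: (measurableT_comp mU); exact: measurable_snd.
Qed.

(** Young's inequality for a kernel of mass one: Tonelli, then the normalization in the variable
    [x]. *)
Lemma moll_L1 U : Int U -> Int (conv rho U) /\ Io (fun x => `|conv rho U x|) <= Io (fun x => `|U x|).
Proof.
move=> iU; have iaU := Int_norm _ iU.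
have mU := Int_meas _ iU; have maU := Int_meas _ iaU.
have c1 : continuous (conv rho U) by exact: conv_continuous rhor iU.
have c2 : continuous (conv rho (fun x => `|U x|)) by exact: conv_continuous rhor iaU.
have iz x : Int (fun z : 'rV[R]_n => rho (x - z) * `|U z|) by exact: conv_Int rhor iaU.
have E : (\int[leb R n]_x (conv rho (fun x => `|U x|) x)%:E = \int[leb R n]_z `|U z|%:E)%E.
  transitivity (\int[leb R n]_x \int[leb R n]_z (rho (x - z) * `|U z|)%:E)%E.
    apply: eq_integral => x _; rewrite /conv /Rintegral fineK//.
    exact: integrable_fin_num (iz x).
  rewrite (leb2_tonelli R n (fun p : 'rV[R]_n * 'rV[R]_n => (rho (p.1 - p.2) * `|U p.2|)%:E)); last 2 first.
  - exact: (moll_joint (fun x => `|U x|) maU).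
  - by move=> p; rewrite lee_fin mulr_ge0.
  apply: eq_integral => z _ /=.
  under eq_integral do rewrite EFinM.
  have ir : Int (fun x : 'rV[R]_n => rho (x - z)).
    have [M M0 hM] := bounded_of_supp _ _ crho rhor.
    apply: (Int_bnd _ M (`|z| + `|r|)) => //.
      apply: continuous_measurable_rV => y.
      apply: (@continuous_comp _ _ _ (fun y : 'rV[R]_n => y - z) rho); last exact: crho.
      by apply: continuousB; [exact: cvg_id|exact: cst_continuous].
    move=> x /rhor h; apply: (cube_sub _ _ _ z) (moll_cube0 z) _.
    by apply: cube_le h; exact: ler_norm.
  rewrite ge0_integralZr//.
  - have -> : (\int[leb R n]_x (rho (x - z))%:E = 1)%E.
      have [_ _ _ _ /(_ z)] := mr; rewrite /Rintegral => h.
      by rewrite -[LHS]fineK ?h//; exact: integrable_fin_num ir.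
    by rewrite mul1e.
  - by apply/measurable_EFinP; exact: Int_meas ir.
  - by move=> x _; rewrite lee_fin.
have i2 : Int (conv rho (fun x => `|U x|)).
  apply/integrableP; split; first by apply/measurable_EFinP; exact: continuous_measurable_rV.
  have h0 x : 0 <= conv rho (fun x => `|U x|) x by apply: Io_ge0 => z; rewrite mulr_ge0.
  have -> : (\int[leb R n]_x `|(EFin \o conv rho (fun x => `|U x|%R)) x| = \int[leb R n]_z `|U z|%:E)%E.
    by rewrite -E; apply: eq_integral => x _; rewrite gee0_abs// lee_fin.
  case/integrableP: iaU => _.
  by under eq_integral do rewrite /= normr_id.
have le12 x : `|conv rho U x| <= conv rho (fun x => `|U x|) x.
  apply: Io_abs_le; [|exact: iz|].
    by apply: Int_meas; exact: conv_Int rhor iU.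
  by move=> z; rewrite normrM ger0_norm.
have i1 : Int (conv rho U).
  by apply: Int_dom le12 => //; exact: continuous_measurable_rV.
split => //.
apply: (@le_trans _ _ (Io (conv rho (fun x => `|U x|)))).
  by apply: Io_le => //; exact: Int_norm.
by rewrite /Rintegral E.
Qed.

Lemma conv_sub U V x : Int U -> Int V -> conv rho (fun z => U z - V z) x = conv rho U x - conv rho V x.
Proof.
move=> iU iV; rewrite /conv -Io_sub; [|exact: conv_Int rhor iU|exact: conv_Int rhor iV].
by apply: Io_eq => z; rewrite mulrBr.
Qed.

(* AM-GM under the convolution: 2 |W U| <= W^2 / k + k U^2 *)
Lemma moll_bilinear U W (k : R) : 0 < k -> Int U -> Int (fun x => U x ^+ 2) ->
  Int W -> Int (fun x => W x ^+ 2) ->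
  `|Io (fun x => W x * conv rho U x)| <= 2^-1 * (k^-1 * Io (fun x => W x ^+ 2) + k * Io (fun x => U x ^+ 2)).
Proof.
move=> k0 iU iU2 iW iW2.
have [ic2 hc2] := moll_L1 _ iU2.
have iWc : measurable_fun setT (fun x => W x * conv rho U x).
  apply: measurable_funM; first exact: Int_meas.
  by apply: continuous_measurable_rV; exact: conv_continuous rhor iU.
have ib : Int (fun x => 2^-1 * (k^-1 * W x ^+ 2 + k * conv rho (fun z => U z ^+ 2) x)).
  by apply: Int_scale; apply: Int_add; exact: Int_scale.
apply: (@le_trans _ _ (Io (fun x => 2^-1 * (k^-1 * W x ^+ 2 + k * conv rho (fun z => U z ^+ 2) x)))).
  apply: Io_abs_le => // x.
  have i3 : Int (fun z : 'rV[R]_n => rho (x - z) * U z ^+ 2) by exact: conv_Int rhor iU2.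
  have -> : 2^-1 * (k^-1 * W x ^+ 2 + k * conv rho (fun z => U z ^+ 2) x) =
     Io (fun z : 'rV[R]_n => (2^-1 * k^-1 * W x ^+ 2) * rho (x - z) + (2^-1 * k) * (rho (x - z) * U z ^+ 2)).
    rewrite Io_add; [|apply: Int_scale; exact: moll_Int_l|exact: Int_scale].
    rewrite Io_scale; last exact: moll_Int_l.
    rewrite Io_scale// -/(conv rho _ x); have [_ _ _ -> _] := mr.
    by rewrite mulr1 mulrDr !mulrA.
  rewrite /conv -Io_scale; last exact: conv_Int rhor iU.
  apply: Io_abs_le.
  - by apply: measurable_funM => //; apply: Int_meas; exact: conv_Int rhor iU.
  - by apply: Int_add; apply: Int_scale => //; exact: moll_Int_l.
  - move=> z; rewrite mulrCA normrM (ger0_norm (rho0 _)).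
    have -> : 2^-1 * k^-1 * W x ^+ 2 * rho (x - z) + 2^-1 * k * (rho (x - z) * U z ^+ 2) =
      rho (x - z) * (2^-1 * (k^-1 * W x ^+ 2 + k * U z ^+ 2)) by ring.
    rewrite ler_wpM2l// normrM -(real_normK (num_real (W x))) -(real_normK (num_real (U z))).
    move: `|W x| `|U z| => a b.
    have h : 0 <= k^-1 * (a - k * b) ^+ 2 by rewrite mulr_ge0 ?invr_ge0 ?(ltW k0)// sqr_ge0.
    have e : k^-1 * (a - k * b) ^+ 2 = k^-1 * a ^+ 2 + k * b ^+ 2 - 2 * (a * b).
      by field; rewrite lt0r_neq0.
    by rewrite e in h; lra.
rewrite Io_scale; last by apply: Int_add; exact: Int_scale.
rewrite Io_add; [|exact: Int_scale|exact: Int_scale].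
rewrite !Io_scale// ler_wpM2l// lerD2l ler_wpM2l ?(ltW k0)//.
apply: (le_trans (ler_norm _)); apply: (le_trans (Io_abs _ ic2)).
apply: (le_trans hc2).
by rewrite (Io_eq _ (fun x => U x ^+ 2))// => x; rewrite ger0_norm// sqr_ge0.
Qed.

End one.

(** [v] is Lipschitz and [rho] samples within [r] in each coordinate, so the pointwise error is at
    most [B n r], on a cube that is the same for all [r <= 1]. *)
Lemma moll_cvg_sm0 v : sm0 v -> (exists2 L : R, 0 <= L & forall x, v x != 0 -> cube R n L x) ->
  forall e : R, 0 < e -> exists2 r0 : R, 0 < r0 & forall r rho, r <= r0 -> mollifier r rho ->
    Io (fun x => `|conv rho v x - v x|) <= e.
Proof.
move=> sv vL e e0; have iv := sm0_Int _ sv vL; case: vL => L L0 vL.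
have H i : exists M : R, 0 <= M /\ forall x, `|partial i v x| <= M.
  have [M M0 hM] := bounded_of_supp _ _ (sm0_continuous _ (sm0_partialE _ i sv)) (fun x => partial_supp _ _ i x vL).
  by exists M.
have [M hM] := choice H.
pose B := \sum_i M i.
have B0 : 0 <= B by apply: sumr_ge0 => i _; have [] := hM i.
have lip : forall x y, `|v x - v y| <= B * \sum_i `|x ord0 i - y ord0 i|.
  apply: lip_of_partials => [i x|i x]; first exact: sm0_derivable.
  apply: (le_trans (proj2 (hM i) x)).
  by rewrite /B (bigD1 i)//= lerDl sumr_ge0// => j _; have [] := hM j.
pose V := ((L + 1) + (L + 1)) ^+ n.
have V0 : 0 <= V by rewrite exprn_ge0// !addr_ge0.
pose r0 := minr 1 (e / (B * n%:R * V + 1)).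
have d0 : 0 < B * n%:R * V + 1 by rewrite ltr_wpDl// !mulr_ge0.
exists r0; first by rewrite lt_min ltr01 divr_gt0.
move=> r rho rr0 mr; have [srho rho0 rhor rho1 rho2] := mr.
have crho := sm0_continuous _ srho.
have r1 : r <= 1 by apply: le_trans rr0 _; rewrite ge_min lexx.
have re : r <= e / (B * n%:R * V + 1) by apply: le_trans rr0 _; rewrite ge_min lexx orbT.
(* [r] is only bounded above. For [r < 0] the kernel would vanish, against its mass one, unless
   there are no coordinates; in dimension 0 the function [v] is constant and the error is 0. *)
have [r_lt0|r_ge0] := ltP r 0.
  have cv0 : forall i : 'I_n, False.
    move=> i; have := rho1 0; rewrite (Io_eq _ (fun=> 0)) ?Io_0; first by move/eqP; rewrite eq_sym oner_eq0.
    move=> z; apply/eqP/negPn/negP => /rhor/(_ i) h.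
    by have := le_lt_trans h r_lt0; rewrite normr_lt0.
  have B_0 : B = 0 by rewrite /B big1// => i _; case: (cv0 i).
  rewrite (Io_eq _ (fun=> 0)) ?Io_0 ?(ltW e0)// => x.
  apply/eqP; rewrite normr_eq0; apply/eqP.
  have vc y z : v y = v z.
    by apply/eqP; rewrite -subr_eq0 -normr_le0; apply: (le_trans (lip y z)); rewrite B_0 mul0r.
  rewrite /conv (Io_eq _ (fun z : 'rV[R]_n => v x * rho (x - z))); last by move=> z; rewrite mulrC (vc z x).
  by rewrite Io_scale ?rho1 ?mulr1 ?subrr//; exact: (moll_Int_l _ _ mr).
have key x : `|conv rho v x - v x| <= B * (n%:R * r).
  have ix := moll_Int_l _ _ mr x.
  have icx : Int (fun z : 'rV[R]_n => rho (x - z) * v z) by exact: conv_Int rhor iv.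
  have -> : conv rho v x - v x = Io (fun z : 'rV[R]_n => rho (x - z) * v z - v x * rho (x - z)).
    by rewrite Io_sub ?Io_scale ?rho1 ?mulr1//; exact: Int_scale.
  have -> : B * (n%:R * r) = Io (fun z : 'rV[R]_n => (B * (n%:R * r)) * rho (x - z)).
    by rewrite Io_scale ?rho1 ?mulr1.
  apply: Io_abs_le.
  - by apply: Int_meas; apply: Int_sub => //; exact: Int_scale.
  - exact: Int_scale.
  - move=> z; rewrite [v x * _]mulrC -mulrBr normrM (ger0_norm (rho0 _)) mulrC.
    have [->|/rhor h] := eqVneq (rho (x - z)) 0; first by rewrite !mulr0.
    rewrite ler_wpM2r//; apply: (le_trans (lip z x)); rewrite ler_wpM2l//.
    apply: (@le_trans _ _ (\sum_(i < n) r)); last by rewrite sumr_const card_ord mulr_natl.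
    by apply: ler_sum => i _; have := h i; rewrite !mxE distrC.
have ms : measurable_fun setT (fun x => `|conv rho v x - v x|).
  apply: measurableT_comp => //; apply: measurable_funB; last exact: Int_meas.
  by apply: continuous_measurable_rV; exact: conv_continuous rhor iv.
have L1 : 0 <= L + 1 by rewrite addr_ge0.
have sup x : `|conv rho v x - v x| != 0 -> cube R n (L + 1) x.
  move=> h; apply: contrapT => nx; move/negP: h; apply; rewrite normr_eq0.
  have -> : v x = 0.
    by apply/eqP/negPn/negP => /vL c; apply: nx; apply: cube_le c; rewrite lerDl.
  rewrite subr0 /conv (Io_eq _ (fun=> 0)) ?Io_0// => z; apply/eqP; rewrite mulf_eq0.
  apply/negPn/negP; rewrite negb_or => /andP[/rhor h1 /vL h2]; apply: nx.
  by apply: cube_le (cube_sub _ _ _ _ h2 h1); rewrite lerD2l.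
pose f x := `|conv rho v x - v x|.
have n1 x : `|f x| <= B * (n%:R * r) by rewrite /f normr_id.
have := Io_bnd f (B * (n%:R * r)) _ L1 ms n1 sup.
move=> /(le_trans (ler_norm _)) /le_trans; apply.
rewrite -/V mulrA mulrAC; apply: (@le_trans _ _ ((B * n%:R * V) * (e / (B * n%:R * V + 1)))).
  by rewrite ler_wpM2l// !mulr_ge0.
by rewrite mulrCA ler_piMr ?(ltW e0)// ler_pdivrMr ?mul1r ?lerDl.
Qed.

Lemma moll_cvg_L1 U : Int U -> forall e : R, 0 < e ->
  exists2 r0 : R, 0 < r0 & forall r rho, r <= r0 -> mollifier r rho ->
    Io (fun x => `|conv rho U x - U x|) <= e.
Proof.
move=> iU e e0; have e3 : 0 < e / 3 by rewrite divr_gt0.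
have [v [sv vL hv]] := approx_Int _ iU _ e3.
have iv := sm0_Int _ sv vL.
have [r0 r00 hr] := moll_cvg_sm0 _ sv vL _ e3.
exists r0 => // r rho rr0 mr; have {}hr := hr _ _ rr0 mr.
have [iUv hUv] := moll_L1 _ _ mr _ (Int_sub _ _ iU iv).
have [iUc _] := moll_L1 _ _ mr _ iU; have [ivc _] := moll_L1 _ _ mr _ iv.
have i1 := Int_norm _ iUv.
have i2 := Int_norm _ (Int_sub _ _ ivc iv).
have i3 := Int_norm _ (Int_sub _ _ iU iv).
apply: (@le_trans _ _ (Io (fun x => (`|conv rho (fun z => U z - v z) x| + `|conv rho v x - v x|) + `|U x - v x|))).
  apply: Io_le.
  - by apply/Int_norm/Int_sub.
  - by apply: Int_add => //; exact: Int_add.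
  - move=> x; rewrite (conv_sub _ _ mr)//.
    have -> : conv rho U x - U x = ((conv rho U x - conv rho v x) + (conv rho v x - v x)) - (U x - v x) by ring.
    by apply: (le_trans (ler_normB _ _)); rewrite lerD2r ler_normD.
rewrite Io_add//; last exact: Int_add.
rewrite Io_add//.
have : Io (fun x => `|U x - v x|) <= e / 3 by [].
by move: (le_trans hUv hv) hr; lra.
Qed.

(** Weak convergence in L^2 against a fixed [W], split at the height [N]. The tail of [W] is small
    in L^2 and goes through [moll_bilinear], where [k] makes the share of [U] at most [e/4]; the
    bounded part only needs convergence in L^1. *)
Lemma moll_cvg_L2 U W : Int U -> Int (fun x => U x ^+ 2) -> Int W -> Int (fun x => W x ^+ 2) ->
  forall e : R, 0 < e -> exists2 r0 : R, 0 < r0 & forall r rho, r <= r0 -> mollifier r rho ->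
    `|Io (fun x => W x * conv rho U x) - Io (fun x => W x * U x)| <= e.
Proof.
move=> iU iU2 iW iW2 e e0.
have mU := Int_meas _ iU; have mW := Int_meas _ iW.
have A0 : 0 <= Io (fun x => U x ^+ 2) by apply: Io_ge0 => x; exact: sqr_ge0.
pose A := Io (fun x => U x ^+ 2) + 1.
have A1 : 0 < A by rewrite ltr_wpDl.
pose k := e / (4 * A).
have k0 : 0 < k by rewrite divr_gt0// mulr_gt0.
pose W1 (N : nat) x := if `|W x| <= N%:R then W x else 0.
have mW1 N : measurable_fun setT (W1 N).
  rewrite (_ : W1 N = fun x => W x * \1_(W @^-1` [set y | `|y| <= N%:R]) x).
    apply: measurable_funM => //; apply: measurable_indic.
    rewrite -[_ @^-1` _]setTI; apply: mW => //.
    have -> : [set y : R | `|y| <= N%:R] = `[- N%:R, N%:R]%classic.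
      by apply/seteqP; split => y /=; rewrite in_itv/= ler_norml.
    exact: measurable_itv.
  apply/funext => x; rewrite /W1 indicE; case: ifPn => h.
    by rewrite mem_set ?mulr1.
  by rewrite memNset ?mulr0// => h2; rewrite h2 in h.
have W1W N x : `|W1 N x| <= `|W x| by rewrite /W1; case: ifP; rewrite ?normr0.
have iW1 N : Int (W1 N) by apply: Int_dom (W1W N) => //; exact: Int_norm.
have W12 N x : `|(W x - W1 N x) ^+ 2| <= W x ^+ 2.
  rewrite /W1; case: ifP => _; first by rewrite subrr expr0n normr0 sqr_ge0.
  by rewrite subr0 ger0_norm ?sqr_ge0.
have [||||N hN] := @Io_dct R n (fun N x => (W x - W1 N x) ^+ 2) (fun=> 0) (fun x => W x ^+ 2) _ _ iW2 _ W12 (k * (e / 4)) _.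
- by move=> N; apply: measurable_funX; apply: measurable_funB.
- exact: measurable_cst.
- move=> x; apply/cvgrPdist_le => d d0; near=> N.
  rewrite /W1 ifT ?subrr ?expr0n/= ?subrr ?normr0 ?(ltW d0)//.
  near: N; exists (Num.bound `|W x|) => //= j hj; apply: (le_trans (ltW (archi_boundP (normr_ge0 _)))).
  by rewrite ler_nat.
- by rewrite mulr_gt0// divr_gt0.
have {hN} := hN N (leqnn N).
rewrite (Io_eq _ (fun x => (W x - W1 N x) ^+ 2)); last first.
  by move=> x; rewrite subr0 ger0_norm ?sqr_ge0.
move=> hN.
have iW2' : Int (fun x => W x - W1 N x) by exact: Int_sub.
have iW22 : Int (fun x => (W x - W1 N x) ^+ 2).
  by apply: Int_dom (W12 N) => //; apply: measurable_funX; apply: measurable_funB.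
have bd (T : R) : T <= 2^-1 * (k^-1 * Io (fun x => (W x - W1 N x) ^+ 2) + k * Io (fun x => U x ^+ 2)) -> T <= e / 4.
  move=> /le_trans; apply.
  have h1 : k^-1 * Io (fun x => (W x - W1 N x) ^+ 2) <= e / 4.
    by rewrite ler_pdivrMl.
  have h2 : k * Io (fun x => U x ^+ 2) <= e / 4.
    have -> : e / 4 = k * A by rewrite /k; field; rewrite lt0r_neq0.
    by rewrite ler_wpM2l ?(ltW k0)// lerDl.
  lra.
have N1 : 0 < N%:R + 1 :> R by rewrite ltr_wpDl.
have e4 : 0 < e / 4 / (N%:R + 1) by rewrite !divr_gt0.
have [r0 r00 hr] := moll_cvg_L1 _ iU _ e4.
exists r0 => // r rho rr0 mr; have {}hr := hr _ _ rr0 mr.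
have [srho rho0 rhor _ _] := mr.
have crho := sm0_continuous _ srho.
have [iUc _] := moll_L1 _ _ mr _ iU.
have cU : continuous (conv rho U) by exact: conv_continuous rhor iU.
have [Mc Mc0 hMc] := conv_bounded rho U _ crho rhor iU.
have b1 : `|Io (fun x => (W x - W1 N x) * conv rho U x)| <= e / 4.
  by apply: bd; exact: (moll_bilinear _ _ mr).
have iprod V : Int V -> Int (fun x => V x * conv rho U x).
  move=> iV; under eq_fun do rewrite mulrC.
  by apply: (Int_mulb _ _ Mc) => //; exact: continuous_measurable_rV.
have iWU : Int (fun x => (W x - W1 N x) * U x).
  apply: (Int_dom _ (fun x => 2^-1 * ((W x - W1 N x) ^+ 2 + U x ^+ 2))).
  - by apply: measurable_funM => //; exact: measurable_funB.
  - by apply: Int_scale; exact: Int_add.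
  - move=> x; rewrite normrM -(real_normK (num_real (W x - W1 N x))) -(real_normK (num_real (U x))).
    move: (`|W x - W1 N x|) (`|U x|) => a b; have := sqr_ge0 (a - b).
    by rewrite sqrrB; lra.
have b2 : `|Io (fun x => (W x - W1 N x) * U x)| <= e / 4.
  apply: bd; rewrite -!Io_scale// -Io_add; [|exact: Int_scale|exact: Int_scale].
  rewrite -Io_scale; last by apply: Int_add; exact: Int_scale.
  apply: Io_abs_le.
  - exact: Int_meas.
  - by apply: Int_scale; apply: Int_add; exact: Int_scale.
  - move=> x; rewrite normrM -(real_normK (num_real (W x - W1 N x))) -(real_normK (num_real (U x))).
    move: (`|W x - W1 N x|) (`|U x|) => a b.
    have h : 0 <= k^-1 * (a - k * b) ^+ 2 by rewrite mulr_ge0 ?invr_ge0 ?(ltW k0)// sqr_ge0.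
    have E : k^-1 * (a - k * b) ^+ 2 = k^-1 * a ^+ 2 + k * b ^+ 2 - 2 * (a * b).
      by field; rewrite lt0r_neq0.
    by rewrite E in h; lra.
have iW1U : Int (fun x => W1 N x * U x).
  apply: (Int_mulb _ _ N%:R) => // x; rewrite /W1.
  by case: ifP => // _; rewrite normr0.
have i3 := Int_sub _ _ iUc iU.
have b3 : `|Io (fun x => W1 N x * (conv rho U x - U x))| <= e / 4.
  apply: (@le_trans _ _ (Io (fun x => N%:R * `|conv rho U x - U x|))).
    apply: Io_abs_le.
    - by apply: measurable_funM => //; exact: Int_meas.
    - exact/Int_scale/Int_norm.
    - move=> x; rewrite normrM ler_wpM2r// /W1.
      by case: ifP => // _; rewrite normr0.
  rewrite Io_scale; last exact: Int_norm.
  apply: (@le_trans _ _ (N%:R * (e / 4 / (N%:R + 1)))); first by rewrite ler_wpM2l.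
  have e40 : 0 <= e / 4 by rewrite divr_ge0// ltW.
  by rewrite mulrCA ler_piMr// ler_pdivrMr// mul1r lerDl.
have i4 : Int (fun x => W1 N x * (conv rho U x - U x)).
  apply: (Int_mulb _ _ N%:R) => // x; rewrite /W1.
  by case: ifP => // _; rewrite normr0.
have iWUf : Int (fun x => W x * U x).
  have := Int_add _ _ iWU iW1U; apply: Int_eq => x; ring.
rewrite -Io_sub//; last exact: iprod.
rewrite (Io_eq _ (fun x => ((W x - W1 N x) * conv rho U x - (W x - W1 N x) * U x) + W1 N x * (conv rho U x - U x))); last first.
  by move=> x; ring.
have i5 := iprod _ iW2'.
rewrite Io_add//; last exact: Int_sub.
rewrite Io_sub//.
apply: (le_trans (ler_normD _ _)).
have := ler_normB (Io (fun x => (W x - W1 N x) * conv rho U x)) (Io (fun x => (W x - W1 N x) * U x)).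
lra.
Unshelve. all: by end_near. Qed.

End mollification.

(** * Kernels pointing into one side *)

Section kernels.
Context {R : realType}.

Lemma is_derive_step_aff (k : nat) (c al be t : R) :
  is_derive t 1 (fun t => c * step k (al * t + be)) (c * (al * step k.+1 (al * t + be))).
Proof.
have h := @is_derive_aff R (step k) al be t _ (is_derive_step k (al * t + be)).
have h2 := is_deriveM (is_derive_cst c t 1) h.
have -> : c * (al * step k.+1 (al * t + be)) = c *: (al * step k.+1 (al * t + be)) + step k (al * t + be) *: 0.
  by rewrite /GRing.scale/= mulr0 addr0.
exact: h2.
Qed.

Lemma continuous_of_is_derive (f df : R -> R) : (forall t : R, is_derive t 1 f (df t)) -> continuous f.
Proof. by move=> h t; apply/differentiable_continuous/derivable1_diffP; have [] := h t. Qed.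

Lemma int_step1 (d al be : R) : 0 < d -> al = 1 \/ al = -1 ->
  (\int[lebesgue_measure]_t (d^-1 * step 1 (d^-1 * (al * t + be)))%:E = 1)%E.
Proof.
move=> d0 hal; have al2 : al * al = 1 by case: hal => ->; rewrite ?mulr1 ?mulrNN ?mulr1.
pose L := `|be| + 2 * d + 1.
have L0 : - L < L by have := normr_ge0 be; rewrite /L; lra.
have E t : d^-1 * (al * t + be) = (d^-1 * al) * t + d^-1 * be by ring.
have dH (t : R) : is_derive t 1 (fun t => al * step 0 (d^-1 * al * t + d^-1 * be)) (d^-1 * step 1 (d^-1 * (al * t + be))).
  have := is_derive_step_aff 0 al (d^-1 * al) (d^-1 * be) t.
  congr is_derive; rewrite E.
  have -> : al * (d^-1 * al * step 1 (d^-1 * al * t + d^-1 * be)) = (al * al) * (d^-1 * step 1 (d^-1 * al * t + d^-1 * be)) by ring.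
  by rewrite al2 mul1r.
have cont : continuous (fun t => d^-1 * step 1 (d^-1 * (al * t + be))).
  rewrite (_ : (fun t : R => _) = fun t : R => d^-1 * step 1 (d^-1 * al * t + d^-1 * be)).
    by apply: continuous_of_is_derive => t; exact: is_derive_step_aff.
  by apply/funext => u; rewrite E.
have b1 := ler_norm be; have b2 := ler_norm (- be); rewrite normrN in b2.
have lo (y : R) : y <= d -> step 0 (d^-1 * y) = 0.
  by move=> h; apply: step_le1; rewrite ler_pdivrMl ?mulr1.
have hi (y : R) : 2 * d <= y -> step 0 (d^-1 * y) = 1.
  by move=> h; apply: step_ge2; rewrite ler_pdivlMl// mulrC.
have z (t : R) : (t < - L) || (L < t) -> d^-1 * step 1 (d^-1 * (al * t + be)) = 0.
  move=> tL; have [h|h] : (al * t + be < d) \/ (2 * d < al * t + be).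
    by case: hal => ->; rewrite ?mulN1r ?mul1r; case/orP: tL => h; rewrite /L in h; [left|right|right|left]; lra.
    rewrite stepS_lt1 ?mulr0// ltr_pdivrMl ?mulr1//.
  by rewrite stepS_gt2 ?mulr0// ltr_pdivlMl// mulrC.
rewrite (FTC_line _ _ _ _ L0 dH cont z) -!E; congr EFin.
case: hal => ->.
  rewrite !mul1r hi; last by rewrite /L; lra.
  by rewrite lo ?subr0//; rewrite /L; lra.
rewrite !mulN1r opprK lo; last by rewrite /L; lra.
by rewrite hi ?oppr0 ?add0r ?opprK//; rewrite /L; lra.
Qed.

Section kern.
Context {m : nat}.
Local Notation n := m.+1.
Variables (s d l T : R).
Hypotheses (hs : s = 1 \/ s = -1) (d0 : 0 < d) (l1 : 1 <= l) (T0 : 0 <= T).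

Let s2 : s * s = 1. Proof. by case: hs => ->; rewrite ?mulr1 ?mulrNN ?mulr1. Qed.
Let l0 : 0 < l. Proof. exact: lt_le_trans l1. Qed.

Definition kwid (i : 'I_n) : R := if i == ord_max then l * d else d.
Definition ksgn (i : 'I_n) : R := if i == ord_max then s else 1.
Definition kone i (t : R) : R := (kwid i)^-1 * step 1 ((kwid i)^-1 * (ksgn i * t)).

(* [krho] is supported at vertical offsets in [[l d, 2 l d]] on the side [s] and
   lateral offsets in [[d, 2 d]], so that convolution with it samples only
   points of a Lipschitz domain when [l] is large.  [s kK] is a vertical primitive
   of [krho - krho(. - s T e_n)]. *)
Definition krho (x : 'rV[R]_n) : R := \prod_i kone i (x ord0 i).
Definition kside (x : 'rV[R]_n) : R := \prod_(i < n | i != ord_max) kone i (x ord0 i).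
Definition kK (x : 'rV[R]_n) : R :=
  kside x * (step 0 ((l * d)^-1 * (s * ver x)) - step 0 ((l * d)^-1 * (s * ver x - T))).

Let ld0 : 0 < l * d. Proof. exact: mulr_gt0. Qed.
Lemma kwid_gt0 i : 0 < kwid i. Proof. by rewrite /kwid; case: ifP. Qed.
Lemma ksgnP i : ksgn i = 1 \/ ksgn i = -1. Proof. by rewrite /ksgn; case: ifP => // _; left. Qed.
Lemma kone_ge0 i t : 0 <= kone i t.
Proof. by rewrite mulr_ge0 ?step1_ge0// invr_ge0 ltW// kwid_gt0. Qed.

Lemma kone_supp i t : kone i t != 0 -> kwid i <= ksgn i * t <= 2 * kwid i.
Proof.
move=> h; have k0 := kwid_gt0 i; apply/andP; split; rewrite leNgt; apply/negP => h2; move/negP: h; apply; apply/eqP; rewrite /kone.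
  by rewrite stepS_lt1 ?mulr0// ltr_pdivrMl ?mulr1.
by rewrite stepS_gt2 ?mulr0// ltr_pdivlMl// mulrC.
Qed.

Lemma sm0_kone i f : sm0 f -> sm0 (fun x : 'rV[R]_n => kone i (f x)).
Proof.
move=> sf; apply: sm0_mul; first exact: sm0_cst.
apply: sm0_step; apply: sm0_mul; first exact: sm0_cst.
by apply: sm0_mul => //; exact: sm0_cst.
Qed.

Lemma sm0_coordB (x : 'rV[R]_n) i : sm0 (fun z : 'rV[R]_n => (x - z) ord0 i).
Proof.
have -> : (fun z : 'rV[R]_n => (x - z) ord0 i) = (fun z : 'rV[R]_n => x ord0 i - z ord0 i).
  by apply/funext => z; rewrite !mxE.
by apply: sm0_sub; [exact: sm0_cst|exact: sm0_coord].
Qed.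

Lemma sm0_prodP (J : Type) (r : seq J) (P : pred J) (F : J -> 'rV[R]_n -> R) : (forall j, sm0 (F j)) ->
  sm0 (fun x => \prod_(j <- r | P j) F j x).
Proof.
move=> h; rewrite (_ : (fun _ => _) = fun x => \prod_(j <- r) (if P j then F j x else 1)).
  by apply: sm0_prod => j; case: (P j) => //; exact: sm0_cst.
by apply/funext => x; rewrite big_mkcond.
Qed.

Lemma sm0_krho : sm0 krho.
Proof. by apply: sm0_prod => i; apply: sm0_kone; exact: sm0_coord. Qed.

Lemma sm0_kK_gen (c : 'I_n -> 'rV[R]_n -> R) : (forall i, sm0 (c i)) ->
  sm0 (fun x => (\prod_(i < n | i != ord_max) kone i (c i x)) *
   (step 0 ((l * d)^-1 * (s * c ord_max x)) - step 0 ((l * d)^-1 * (s * c ord_max x - T)))).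
Proof.
move=> sc; apply: sm0_mul; first by apply: sm0_prodP => i; exact: sm0_kone.
apply: sm0_sub; apply: sm0_step; apply: sm0_mul; try exact: sm0_cst.
  by apply: sm0_mul => //; exact: sm0_cst.
apply: sm0_sub; last exact: sm0_cst.
by apply: sm0_mul => //; exact: sm0_cst.
Qed.

Lemma sm0_kK : sm0 kK.
Proof. by apply: sm0_kK_gen => i; exact: sm0_coord. Qed.

Lemma sm0_kKB (x : 'rV[R]_n) : sm0 (fun z : 'rV[R]_n => kK (x - z)).
Proof.
rewrite (_ : (fun _ => _) = (fun z : 'rV[R]_n => (\prod_(i < n | i != ord_max) kone i ((x - z) ord0 i)) *
   (step 0 ((l * d)^-1 * (s * (x - z) ord0 ord_max)) - step 0 ((l * d)^-1 * (s * (x - z) ord0 ord_max - T)))))//.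
by apply: sm0_kK_gen => i; exact: sm0_coordB.
Qed.

Lemma krho_ge0 x : 0 <= krho x.
Proof. by apply: prodr_ge0 => i _; exact: kone_ge0. Qed.

Lemma kside_ge0 x : 0 <= kside x.
Proof. by apply: prodr_ge0 => i _; exact: kone_ge0. Qed.

Lemma kside_supp x i : kside x != 0 -> i != ord_max -> d <= x ord0 i <= 2 * d.
Proof.
rewrite /kside prodf_seq_neq0 => /allP/(_ i) h im.
have := h (mem_index_enum _); rewrite im => /= /kone_supp.
by rewrite /kwid /ksgn (negbTE im) mul1r.
Qed.

Lemma kK_supp x : kK x != 0 -> (forall i, i != ord_max -> d <= x ord0 i <= 2 * d) /\
  l * d <= s * ver x <= T + 2 * (l * d).
Proof.
rewrite mulf_eq0 negb_or => /andP[h1 h2]; split => [i|]; first exact: kside_supp.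
apply/andP; split; rewrite leNgt; apply/negP => h; move/negP: h2; apply; apply/eqP.
  have e1 : step 0 ((l * d)^-1 * (s * ver x)) = 0 by apply: step_le1; rewrite ler_pdivrMl// mulr1 ltW.
  have e2 : step 0 ((l * d)^-1 * (s * ver x - T)) = 0 by apply: step_le1; rewrite ler_pdivrMl// mulr1 lerBlDr (le_trans (ltW h))// lerDl.
  by rewrite e1 e2 subrr.
have e1 : step 0 ((l * d)^-1 * (s * ver x)) = 1.
  by apply: step_ge2; rewrite ler_pdivlMl// mulrC ltW// (le_lt_trans _ h)// lerDr.
have e2 : step 0 ((l * d)^-1 * (s * ver x - T)) = 1.
  by apply: step_ge2; rewrite ler_pdivlMl// mulrC lerBrDl ltW.
by rewrite e1 e2 subrr.
Qed.

(** [step 0] is monotone and the two steps of [kK] are ordered, so their difference lies in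
    [[0, 1]]. The resulting weight is at most that of a lateral average, whatever the length [T]. *)
Lemma kK_bound x : 0 <= kK x <= kside x.
Proof.
have h1 := step0_ge0 ((l * d)^-1 * (s * ver x)); have h2 := step0_le1 ((l * d)^-1 * (s * ver x)).
have h3 := step0_ge0 ((l * d)^-1 * (s * ver x - T)); have h4 := step0_le1 ((l * d)^-1 * (s * ver x - T)).
have mono : step 0 ((l * d)^-1 * (s * ver x - T)) <= step 0 ((l * d)^-1 * (s * ver x)).
  have le : (l * d)^-1 * (s * ver x - T) <= (l * d)^-1 * (s * ver x).
    by rewrite ler_wpM2l ?invr_ge0 ?(ltW ld0)// gerBl.
  have [ab|] := ltP ((l * d)^-1 * (s * ver x - T)) ((l * d)^-1 * (s * ver x)); last first.
    by move=> h; have -> : (l * d)^-1 * (s * ver x - T) = (l * d)^-1 * (s * ver x) by apply/eqP; rewrite eq_le le h.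
  have cs : {within `[(l * d)^-1 * (s * ver x - T), (l * d)^-1 * (s * ver x)], continuous (@step R 0)}.
    by apply: continuous_subspaceT; exact: continuous_step.
  have [c _ e] := @MVT R (step 0) (step 1) _ _ ab (fun y _ => is_derive_step 0 y) cs.
  by rewrite -subr_ge0 e mulr_ge0 ?step1_ge0// subr_ge0 ltW.
have k0 := kside_ge0 x.
by rewrite /kK mulr_ge0 ?subr_ge0//= ler_piMr//; lra.
Qed.

Lemma krho_supp x : krho x != 0 -> (forall i, i != ord_max -> d <= x ord0 i <= 2 * d) /\
  l * d <= s * ver x <= 2 * (l * d).
Proof.
rewrite /krho prodf_seq_neq0 => /allP h; split => [i im|].
  have := h i (mem_index_enum _) => /= /kone_supp.
  by rewrite /kwid /ksgn (negbTE im) mul1r.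
have := h ord_max (mem_index_enum _) => /= /kone_supp.
by rewrite /kwid /ksgn eqxx.
Qed.

Lemma ks_norm t : `|s * t| = `|t|.
Proof. by rewrite normrM; case: hs => ->; rewrite ?normrN normr1 mul1r. Qed.

Lemma ksupp_cube (x : 'rV[R]_n) (T' : R) : 0 <= T' -> (forall i, i != ord_max -> d <= x ord0 i <= 2 * d) ->
  l * d <= s * ver x <= T' + 2 * (l * d) -> cube R n (T' + 2 * (l * d)) x.
Proof.
move=> T'0 h1 /andP[h2 h3] i; have [->|im] := eqVneq i ord_max.
  by rewrite -ks_norm ger0_norm// (le_trans _ h2)// ltW.
have /andP[h4 h5] := h1 i im; rewrite ger0_norm ?(le_trans _ h4) ?(ltW d0)//.
apply: (le_trans h5); rewrite -[leLHS]add0r lerD// ler_wpM2l//.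
by rewrite ler_peMl// ltW.
Qed.

Lemma kK_cube x : kK x != 0 -> cube R n (T + 2 * (l * d)) x.
Proof. by move=> /kK_supp[h1 h2]; exact: ksupp_cube. Qed.

Lemma krho_cube x : krho x != 0 -> cube R n (2 * (l * d)) x.
Proof.
move=> /krho_supp[h1 h2]; have := @ksupp_cube x 0 (lexx 0) h1.
by rewrite add0r; apply.
Qed.

Lemma kone_measurable i (al be : R) : measurable_fun setT (fun t : R => kone i (al * t + be) : R).
Proof.
rewrite (_ : (fun t : R => _) = fun t : R => (kwid i)^-1 * step 1 ((kwid i)^-1 * (ksgn i * al) * t + (kwid i)^-1 * (ksgn i * be))).
  apply: continuous_measurable_fun; apply: continuous_of_is_derive => t; exact: is_derive_step_aff.
by apply/funext => u; rewrite /kone; congr (_ * step _ _); ring.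
Qed.

Lemma kone_int i (al be : R) : al = 1 \/ al = -1 -> (\int[lebesgue_measure]_t (kone i (al * t + be))%:E = 1)%E.
Proof.
move=> hal; rewrite -[RHS](@int_step1 (kwid i) (ksgn i * al) (ksgn i * be) (kwid_gt0 i)); last first.
  by case: (ksgnP i) => ->; case: hal => ->; rewrite ?mul1r ?mulr1 ?mulrNN ?mulr1; auto.
by apply: eq_integral => t _; rewrite /kone mulrDr mulrA.
Qed.

Lemma krho_mollifier : mollifier (2 * (l * d)) krho.
Proof.
split.
- exact: sm0_krho.
- exact: krho_ge0.
- exact: krho_cube.
- move=> x.
  have h := leb_prod R n (fun i t => kone i ((-1) * t + x ord0 i)) (fun=> 1)
    (fun i => kone_measurable i (-1) (x ord0 i)) (fun i t => kone_ge0 i _)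
    (fun i => kone_int i _ _ (or_intror erefl)).
  rewrite /Rintegral (_ : (\int[_]_(_ in _) _)%E = 1%E)//.
  rewrite -[RHS](_ : (\prod_(i < n) 1)%:E = 1%E); last by rewrite big1.
  rewrite -h; apply: eq_integral => z _; congr EFin; apply: eq_bigr => i _.
  by rewrite !mxE mulN1r addrC.
- move=> z.
  have h := leb_prod R n (fun i t => kone i (1 * t + (- z ord0 i))) (fun=> 1)
    (fun i => kone_measurable i 1 (- z ord0 i)) (fun i t => kone_ge0 i _)
    (fun i => kone_int i _ _ (or_introl erefl)).
  rewrite /Rintegral (_ : (\int[_]_(_ in _) _)%E = 1%E)//.
  rewrite -[RHS](_ : (\prod_(i < n) 1)%:E = 1%E); last by rewrite big1.
  rewrite -h; apply: eq_integral => x _; congr EFin; apply: eq_bigr => i _.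
  by rewrite !mxE mul1r.
Qed.

(** Each lateral factor has mass one, so only the vertical integral of [g] remains. *)
Lemma kside_int (x : 'rV[R]_n) (g : R -> R) (c : R) : measurable_fun setT g -> (forall t, 0 <= g t) ->
  (\int[lebesgue_measure]_t (g t)%:E = c%:E)%E ->
  Int (fun z : 'rV[R]_n => kside (x - z) * g (ver z)) /\ Io (fun z : 'rV[R]_n => kside (x - z) * g (ver z)) = c.
Proof.
move=> mg g0 hc.
pose f (i : 'I_n) (t : R) := if i == ord_max then g t else kone i ((-1) * t + x ord0 i).
have mf i : measurable_fun setT (f i : measurableTypeR R -> measurableTypeR R).
  by have [->|im] := eqVneq i ord_max; rewrite /f ?eqxx// (negbTE im); exact: kone_measurable.
have f0 i t : 0 <= f i t by rewrite /f; case: ifP => // _; exact: kone_ge0.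
have fc (i : 'I_n) : (\int[lebesgue_measure]_t (f i t)%:E = (if i == ord_max then c else 1)%:E)%E.
  by have [->|im] := eqVneq i ord_max; rewrite /f ?eqxx// (negbTE im); apply: kone_int; right.
have := leb_prod R n f _ mf f0 fc.
have -> : \prod_(i < n) (if i == ord_max then c else 1) = c.
  by rewrite (bigD1 ord_max)//= eqxx big1 ?mulr1// => i /negbTE ->.
have E (z : 'rV[R]_n) : \prod_(i < n) f i (z ord0 i) = kside (x - z) * g (ver z).
  rewrite (bigD1 ord_max)//= {1}/f eqxx mulrC; congr (_ * _).
  by apply: eq_bigr => i im; rewrite /f (negbTE im) !mxE mulN1r addrC.
under eq_integral do rewrite E.
move=> h; split; last by rewrite /Rintegral h.
apply/integrableP; split.
  apply/measurable_EFinP; apply: (@eq_measurable_fun _ _ _ _ _ (fun z : 'rV[R]_n => \prod_(i < n) f i (z ord0 i))).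
    by move=> z _; rewrite E.
  by apply: measurable_prod => i _; exact: (measurableT_comp (mf i) (measurable_coord i)).
under eq_integral do rewrite /= ger0_norm ?mulr_ge0 ?kside_ge0//.
by rewrite h ltry.
Qed.

Lemma kK_partial_max (w : 'rV[R]_n) : partial ord_max kK w = s * (krho w - krho (w - (s * T) *: basis_vec R ord_max)).
Proof.
apply: partial_val; apply/is_derive_line0.
have c1 (t : R) : kside (t *: basis_vec R ord_max + w) = kside w.
  apply: eq_bigr => i im; rewrite !mxE (negbTE im) andbF mulr0 add0r//.
have c2 (t : R) : ver (t *: basis_vec R ord_max + w) = t + ver w by rewrite /ver !mxE !eqxx mulr1.
have E : (fun t : R => kK (t *: basis_vec R ord_max + w)) =
  (fun t : R => kside w * step 0 ((l * d)^-1 * s * t + (l * d)^-1 * s * ver w) +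
     (- kside w) * step 0 ((l * d)^-1 * s * t + (l * d)^-1 * (s * ver w - T))).
  apply/funext => t; rewrite /kK c1 c2 mulrBr mulNr; congr (_ * step 0 _ - _ * step 0 _); ring.
rewrite E.
have h1 := is_derive_step_aff 0 (kside w) ((l * d)^-1 * s) ((l * d)^-1 * s * ver w) 0.
have h2 := is_derive_step_aff 0 (- kside w) ((l * d)^-1 * s) ((l * d)^-1 * (s * ver w - T)) 0.
apply: is_derive_eq.
rewrite !mulr0 !add0r.
have rE (w' : 'rV[R]_n) : krho w' = kside w' * ((l * d)^-1 * step 1 ((l * d)^-1 * (s * ver w'))).
  by rewrite /krho (bigD1 ord_max)//= mulrC /kone /kwid /ksgn eqxx.
rewrite !rE.
have -> : kside (w - (s * T) *: basis_vec R ord_max) = kside w.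
  by have := c1 (- (s * T)); rewrite scaleNr addrC.
have -> : s * ver (w - (s * T) *: basis_vec R ord_max) = s * ver w - T.
  have := c2 (- (s * T)); rewrite scaleNr addrC => ->.
  have -> : s * (- (s * T) + ver w) = s * ver w - (s * s) * T by ring.
  by rewrite s2 mul1r.
rewrite -(mulrA _ s (ver w)).
move: (step 1 _) (step 1 _) (kside w) => a1 a2 a3; ring.
Qed.

End kern.

(** The bound is the integral over the whole half-line, finite because [b > 1]. Its uniformity in
    the length [T] of the segment is what later allows [T] to be taken arbitrarily large. *)
Lemma pow_tail (s x A T b : R) : s = 1 \/ s = -1 -> 0 < A -> 0 < T -> 1 < b ->
  let g t := if 0 <= s * (x - t) <= T then (A + s * (x - t)) `^ (- b) else 0 in
  [/\ measurable_fun setT g, (forall t, 0 <= g t) &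
   exists2 c, (\int[lebesgue_measure]_t (g t)%:E = c%:E)%E & c <= A `^ (1 - b) / (b - 1)].
Proof.
move=> hs A0 T0 b1 g.
have s2 : s * s = 1 by case: hs => ->; rewrite ?mulr1 ?mulrNN ?mulr1.
pose lo := if s == 1 then x - T else x; pose hi := if s == 1 then x else x + T.
have lohi : lo < hi by rewrite /lo /hi; case: ifP => _; lra.
have memE t : (0 <= s * (x - t) <= T) = (t \in `[lo, hi]).
  rewrite in_itv/= /lo /hi; case: hs => ->; rewrite ?eqxx ?mul1r ?mulN1r.
    by apply/idP/idP => /andP[h1 h2]; apply/andP; split; lra.
  rewrite (_ : (-1 == 1 :> R) = false); last by apply/negbTE/eqP; lra.
  by apply/idP/idP => /andP[h1 h2]; apply/andP; split; lra.
have gE : g = (fun t => (A + s * (x - t)) `^ (- b)) \_ `[lo, hi].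
  apply/funext => t; rewrite /g patchE memE; case: ifPn => h; first by rewrite mem_set.
  by rewrite memNset// => h2; rewrite h2 in h.
have dl (t : R) : is_derive t 1 (fun t : R => A + s * (x - t)) (- s).
  apply: is_derive_eq; rewrite /GRing.scale/=; ring.
have cl : continuous (fun t : R => A + s * (x - t)) by exact: continuous_of_is_derive dl.
have mh : measurable_fun setT (fun t : R => (A + s * (x - t)) `^ (- b)).
  apply: (measurableT_comp (measurable_powR _)).
  exact: continuous_measurable_fun.
split.
- by rewrite gE; apply/(measurable_restrictT _ _).1 => //; exact: measurable_funTS.
- by move=> t; rewrite /g; case: ifP => // _; exact: powR_ge0.
pose H t := (s / (b - 1)) * (A + s * (x - t)) `^ (1 - b).
have b10 : b - 1 != 0 by rewrite subr_eq0 gt_eqF.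
have dH (t : R) : t \in `[lo, hi] -> is_derive t 1 H ((A + s * (x - t)) `^ (- b)).
  rewrite -memE => /andP[h _].
  have p0 : 0 < A + s * (x - t) by rewrite ltr_pwDl.
  have h1 := is_derive1_powR (1 - b) p0.
  have h2 : is_derive t 1 (fun t => (A + s * (x - t)) `^ (1 - b)) ((1 - b) * (A + s * (x - t)) `^ (1 - b - 1) * (- s)).
    have := @is_derive1_comp R (fun y : R => y `^ (1 - b)) (fun t : R => A + s * (x - t)) t _ _ h1 (dl t).
    by [].
  rewrite /H; apply: is_derive_eq.
  rewrite /GRing.scale/=.
  have -> : 1 - b - 1 = - b by ring.
  have -> : s / (b - 1) * ((1 - b) * (A + s * (x - t)) `^ (- b) * - s) = (s * s) * (A + s * (x - t)) `^ (- b) * ((b - 1) / (b - 1)) by field.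
  by rewrite s2 mul1r mulfV// mulr1.
have cH : {within `[lo, hi], continuous H}.
  by apply: derivable_within_continuous => t /dH[].
have ch : {within `[lo, hi], continuous (fun t : R => (A + s * (x - t)) `^ (- b))}.
  apply: derivable_within_continuous => t; rewrite -memE => /andP[h _].
  have p0 : 0 < A + s * (x - t) by rewrite ltr_pwDl.
  have h1 := is_derive1_powR (- b) p0.
  by have [] := @is_derive1_comp R (fun y : R => y `^ (- b)) (fun t => A + s * (x - t)) t _ _ h1 (dl t).
exists (H hi - H lo).
  rewrite gE.
  rewrite (_ : (\int[_]_(_ in _) _)%E = (\int[lebesgue_measure]_(t in `[lo, hi]) ((A + s * (x - t)) `^ (- b))%:E)%E).
    rewrite (continuous_FTC2 (F := H))//.
    - have [e1 e2 e3] := (continuous_within_itvP _ lohi).1 cH; split; [|exact: e2|exact: e3].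
      move=> t; rewrite in_itv/= => /andP[t1 t2]; by have [] : is_derive t 1 H ((A + s * (x - t)) `^ (- b)) by apply: dH; rewrite in_itv/= !ltW.
    - move=> t; rewrite in_itv/= => /andP[t1 t2].
      have h : is_derive t 1 H ((A + s * (x - t)) `^ (- b)) by apply: dH; rewrite in_itv/= !ltW.
      by rewrite derive1E; exact: derive_val.
  rewrite [RHS]integral_mkcond; apply: eq_integral => t _.
  by rewrite !patchE; case: ifP.
rewrite /H /lo /hi; case: hs => ->; rewrite ?eqxx.
  rewrite subrr mulr0 addr0 mulrC [X in _ - X]mulrC -mulrBl div1r ler_wpM2r ?invr_ge0 ?subr_ge0 ?(ltW b1)//.
  by rewrite gerBl powR_ge0.
rewrite (_ : (-1 == 1 :> R) = false); last by apply/negbTE/eqP; lra.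
rewrite subrr mulr0 addr0.
have p1 := powR_ge0 (A + -1 * (x - (x + T))) (1 - b).
rewrite [leLHS](_ : _ = (A `^ (1 - b) - (A + -1 * (x - (x + T))) `^ (1 - b)) / (b - 1)); last by ring.
by rewrite ler_wpM2r ?invr_ge0 ?subr_ge0 ?(ltW b1)// gerBl.
Qed.

End kernels.

(** * Euclidean norm and radial cutoffs *)

Section euclid.
Context {R : realType} {n : nat}.
Implicit Types x y : 'rV[R]_n.

Lemma dot_ge0 x : 0 <= dot x x.
Proof. by apply: sumr_ge0 => i _; rewrite -expr2 sqr_ge0. Qed.

Lemma enorm_ge0 x : 0 <= enorm x. Proof. exact: sqrtr_ge0. Qed.

Lemma sqr_enorm x : enorm x ^+ 2 = dot x x.
Proof. by rewrite sqr_sqrtr// dot_ge0. Qed.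

Lemma coord_dot x i : x ord0 i ^+ 2 <= dot x x.
Proof. by rewrite /dot (bigD1 i)//= -expr2 lerDl; apply: sumr_ge0 => j _; rewrite -expr2 sqr_ge0. Qed.

Lemma coord_enorm x i : `|x ord0 i| <= enorm x.
Proof. by rewrite -sqrtr_sqr ler_wsqrtr// coord_dot. Qed.

Lemma l1_enorm x : \sum_i `|x ord0 i| <= n%:R * enorm x.
Proof.
apply: (le_trans (ler_sum _ (fun i _ => coord_enorm x i))).
by rewrite sumr_const card_ord -[leLHS]mulr_natl.
Qed.

Lemma enorm_l1 x : enorm x <= \sum_i `|x ord0 i|.
Proof.
have s0 : 0 <= \sum_i `|x ord0 i| by apply: sumr_ge0.
rewrite -(ger0_norm s0) -sqrtr_sqr ler_wsqrtr// expr2 mulr_suml /dot.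
apply: ler_sum => i _; apply: (le_trans (ler_norm _)); rewrite normrM ler_wpM2l//.
by rewrite (bigD1 i)//= lerDl sumr_ge0.
Qed.

Lemma dot_basis i x : dot (basis_vec R i) x = x ord0 i.
Proof.
rewrite /dot (bigD1 i)//= big1 ?addr0; first by rewrite mxE !eqxx mul1r.
by move=> j ji; rewrite mxE (negbTE ji) andbF mul0r.
Qed.

Lemma dotC x y : dot x y = dot y x.
Proof. by apply: eq_bigr => i _; rewrite mulrC. Qed.

Lemma is_derive_dot x v : is_derive x v (fun y => dot y y) (2 * dot v x).
Proof.
apply/is_derive_line0.
have -> : (fun s : R => dot (s *: v + x) (s *: v + x)) = (fun s : R => dot v v * s ^+ 2 + 2 * dot v x * s + dot x x).
  apply/funext => s; rewrite /dot !mulr_sumr !mulr_suml -!big_split/=; apply: eq_bigr => i _.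
  by rewrite !mxE; ring.
apply: is_derive_eq; rewrite /GRing.scale/=; ring.
Qed.

Lemma is_derive_mulf (f g : 'rV[R]_n -> R) x v df dg : is_derive x v f df -> is_derive x v g dg ->
  is_derive x v (fun y => f y * g y) (f x * dg + g x * df).
Proof. exact: is_deriveM. Qed.

Lemma is_derive_mulc (c : R) (f : 'rV[R]_n -> R) x v df : is_derive x v f df -> is_derive x v (fun y => c * f y) (c * df).
Proof.
move=> h; have := is_derive_mulf _ _ x v _ _ (is_derive_cst c x v) h.
by rewrite mulr0 addr0.
Qed.

Lemma is_derive_dotl (c x v : 'rV[R]_n) : is_derive x v (fun y => dot c y) (dot c v).
Proof.
apply/is_derive_line0.
have -> : (fun s : R => dot c (s *: v + x)) = (fun s : R => dot c v * s + dot c x).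
  apply/funext => s; rewrite /dot !mulr_suml -!big_split/=; apply: eq_bigr => i _.
  by rewrite !mxE; ring.
by apply: is_derive_eq; rewrite scaler1 addr0.
Qed.

Lemma sm0_sum (J : Type) (r : seq J) (F : J -> 'rV[R]_n -> R) : (forall j, sm0 (F j)) ->
  sm0 (fun x => \sum_(j <- r) F j x).
Proof.
move=> h; elim: r => [|j r IH].
  by have := @sm0_cst R n 0; congr sm0; apply/funext => x; rewrite big_nil.
by have := sm0_add _ _ (h j) IH; congr sm0; apply/funext => x; rewrite big_cons.
Qed.

Lemma sm0_dotl x : sm0 (fun y => dot x y).
Proof. by apply: sm0_sum => i; apply: sm0_mul; [exact: sm0_cst|exact: sm0_coord]. Qed.

Lemma sm0_dot2 : sm0 (fun y : 'rV[R]_n => dot y y).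
Proof. by apply: sm0_sum => i; apply: sm0_mul; exact: sm0_coord. Qed.

End euclid.

Section cutoff.
Context {R : realType}.

(* [chi0 = F + 2 y F'] and [chi1 = chi0'] for the cutoff [F = 1 - step 0]. *)
Definition chi0 (y : R) := 1 - step 0 y - 2 * y * step 1 y.
Definition chi1 (y : R) := - (3 * step 1 y) - 2 * y * step 2 y.

Lemma is_derive_chi0 (y : R) : is_derive y 1 chi0 (chi1 y).
Proof.
have h0 := is_derive_step 0 y; have h1 := is_derive_step 1 y.
rewrite /chi0; apply: is_derive_eq; rewrite /chi1 /GRing.scale/=; ring.
Qed.

Definition chi2 (y : R) := - (5 * step 2 y) - 2 * y * step 3 y.

Lemma is_derive_chi1 (y : R) : is_derive y 1 chi1 (chi2 y).
Proof.
have h0 := is_derive_step 1 y; have h1 := is_derive_step 2 y.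
rewrite /chi1; apply: is_derive_eq; rewrite /chi2 /GRing.scale/=.
by move: (step 1 y) (step 2 y) (step 3 y) => a1 a2 a3; ring.
Qed.

Lemma chi0_lt1 y : y < 1 -> chi0 y = 1.
Proof. by move=> y1; rewrite /chi0 stepS_lt1// step_le1 ?(ltW y1)// mulr0 !subr0. Qed.

Lemma chi0_gt2 y : 2 < y -> chi0 y = 0.
Proof. by move=> y1; rewrite /chi0 stepS_gt2// step_ge2 ?(ltW y1)// mulr0 subrr subr0. Qed.

Lemma chi1_supp y : chi1 y != 0 -> 1 <= y <= 2.
Proof.
move=> h; apply/andP; split; rewrite leNgt; apply/negP => y1; move/negP: h; apply; apply/eqP.
  by rewrite /chi1 !stepS_lt1// !mulr0 oppr0 addr0.
by rewrite /chi1 !stepS_gt2// !mulr0 oppr0 addr0.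
Qed.

Lemma step1_supp k (y : R) : step k.+1 y != 0 -> 1 <= y <= 2.
Proof.
move=> h; apply/andP; split; rewrite leNgt; apply/negP => y1; move/negP: h; apply; apply/eqP.
  by rewrite stepS_lt1.
by rewrite stepS_gt2.
Qed.

Lemma ystep_bounded k : exists2 M : R, 0 < M & forall y : R, `|y * step k.+1 y| <= M.
Proof.
have [M M0 hM] := step_bounded (R := R) k.+1.
exists (2 * M); first exact: mulr_gt0.
move=> y; have [->|] := eqVneq (step k.+1 y) 0; first by rewrite mulr0 normr0 mulr_ge0// ltW.
move=> /step1_supp/andP[h1 h2]; rewrite normrM ler_pM//.
by rewrite ger0_norm// (le_trans _ h1).
Qed.

Lemma chi_bounded : exists2 H : R, 1 <= H & forall y, [/\ `|chi0 y| <= H, `|chi1 y| <= H & `|step 1 y| <= H].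
Proof.
have [M1 M10 hM1] := step_bounded (R := R) 1.
have [N1 N10 hN1] := ystep_bounded 0; have [N2 N20 hN2] := ystep_bounded 1.
exists (1 + 3 * M1 + 2 * N1 + 2 * N2); first by lra.
move=> y; have := hM1 y; have := hN1 y; have := hN2 y; rewrite !ler_norml => /andP[a1 a2] /andP[b1 b2] /andP[c1 c2].
have s0 := step0_ge0 y; have s1 := step0_le1 y.
have e1 : 2 * y * step 1 y = 2 * (y * step 1 y) by ring.
have e2 : 2 * y * step 2 y = 2 * (y * step 2 y) by ring.
by split; apply/andP; split; rewrite /chi0 /chi1 ?e1 ?e2; lra.
Qed.

Context {n : nat}.
Implicit Types x : 'rV[R]_n.

(** The variable [y = |x|^2 / r^2] of the radial cutoffs; it is polynomial in [x], so composing it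
    with steps stays in [sm0]. *)
Definition rad (r : R) x := (r ^+ 2)^-1 * dot x x.

Lemma sm0_rad r : sm0 (@rad r).
Proof. by apply: sm0_mul; [exact: sm0_cst|exact: sm0_dot2]. Qed.

Lemma sm0_chi0 f : sm0 f -> sm0 (fun x => chi0 (f x)).
Proof.
move=> sf; apply: sm0_sub; first by apply: sm0_sub; [exact: sm0_cst|exact: sm0_step].
by apply: sm0_mul; [apply: sm0_mul => //; exact: sm0_cst|exact: sm0_step].
Qed.

Lemma sm0_chi1 f : sm0 f -> sm0 (fun x => chi1 (f x)).
Proof.
move=> sf; apply: sm0_sub.
  have : sm0 (fun x => (-3) * step 1 (f x)) by apply: sm0_mul; [exact: sm0_cst|exact: sm0_step].
  by congr sm0; apply/funext => x; rewrite mulNr.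
by apply: sm0_mul; [apply: sm0_mul => //; exact: sm0_cst|exact: sm0_step].
Qed.

Lemma is_derive_rad r x i : is_derive x (basis_vec R i) (rad r) (2 * (r ^+ 2)^-1 * x ord0 i).
Proof.
have h := is_deriveM (is_derive_cst (r ^+ 2)^-1 x (basis_vec R i)) (is_derive_dot x (basis_vec R i)).
have -> : 2 * (r ^+ 2)^-1 * x ord0 i = (r ^+ 2)^-1 *: (2 * dot (basis_vec R i) x) + dot x x *: 0.
  by rewrite dot_basis /GRing.scale/=; ring.
exact: h.
Qed.

Lemma partial_rad (g dg : R -> R) r x i : (forall t : R, is_derive t 1 g (dg t)) ->
  is_derive x (basis_vec R i) (fun y => g (rad r y)) (dg (rad r x) * (2 * (r ^+ 2)^-1 * x ord0 i)).
Proof. by move=> h; apply: is_derive_scomp => //; exact: is_derive_rad. Qed.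

Lemma rad_le2 r x : 0 < r -> rad r x <= 2 -> enorm x <= 2 * r.
Proof.
move=> r0; rewrite /rad ler_pdivrMl ?exprn_gt0// => h.
rewrite -[leRHS]ger0_norm; last by rewrite mulr_ge0// ltW.
rewrite -sqrtr_sqr ler_wsqrtr// (le_trans h)//.
by rewrite exprMn mulrC ler_wpM2r ?sqr_ge0//; lra.
Qed.

Lemma rad_ge1 r x : 0 < r -> 1 <= rad r x -> r <= enorm x.
Proof.
move=> r0; rewrite /rad ler_pdivlMl ?exprn_gt0// mulr1 => h.
by rewrite -[leLHS]ger0_norm ?(ltW r0)// -sqrtr_sqr ler_wsqrtr.
Qed.

Lemma rad_lt1 r x : 0 < r -> enorm x < r -> rad r x < 1.
Proof.
move=> r0 h; rewrite ltNge; apply/negP => /(rad_ge1 _ _ r0); by rewrite leNgt h.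
Qed.

Lemma enorm_cube r x : enorm x <= r -> cube R n r x.
Proof. by move=> h i; exact: le_trans (coord_enorm x i) h. Qed.

End cutoff.

Lemma powRN_le {R : realType} (a z b : R) : 0 < a -> a <= z -> 0 <= b -> z `^ (- b) <= a `^ (- b).
Proof.
move=> a0 az b0; have z0 := lt_le_trans a0 az.
by rewrite !powRN lef_pV2 ?posrE ?powR_gt0// ge0_ler_powR// nnegrE ltW.
Qed.

(** Moving by [t] away from a height at most [M] loses at most [2 M] of the distance to 0 and
    otherwise gains [t]. The extra 2 pays for lateral displacements, at most [2 d <= 2], so that
    [sPhi_bound] has one constant for all coordinates. *)
Lemma abs_shift {R : realType} (y t M : R) : y <= M -> 1 <= M -> `|y| - (2 * M + 2) + t <= - (y - t).
Proof. by move=> yM M1; case: (ger0P y) => ?; lra. Qed.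

Lemma abs_shift2 {R : realType} (a z q d M : R) : a <= z + q -> q <= 2 * d -> d <= 1 -> 1 <= M -> a - (2 * M + 2) <= z.
Proof. by move=> *; lra. Qed.

Lemma sum_shift {R : realType} (S Z e r tau k : R) : S - k + tau <= Z -> e <= S -> r <= e -> 2 * k <= r -> r / 2 + tau <= Z.
Proof. by move=> *; lra. Qed.

(** * Integrals over boxes and horizontal strips *)

Section strip.
Context {R : realType} {m : nat}.
Local Notation n := m.+1.

Lemma Io_box (lo hi : 'I_n -> R) : (forall i, lo i <= hi i) ->
  let G (x : 'rV[R]_n) := \prod_(i < n) \1_(`[lo i, hi i]%classic) (x ord0 i) : R in
  Int G /\ Io G = \prod_(i < n) (hi i - lo i).
Proof.
move=> lohi G; pose g (i : 'I_n) : R -> R := \1_(`[lo i, hi i]%classic).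
have h := leb_prod R n g (fun i => hi i - lo i).
have mg i : measurable_fun setT (g i : measurableTypeR R -> measurableTypeR R) by exact: measurable_indic.
have g0 i t : 0 <= g i t by rewrite /g indicE.
have gi i : (\int[lebesgue_measure]_t (g i t)%:E = (hi i - lo i)%:E)%E.
  rewrite /g integral_indic// setIT [LHS]lebesgue_measure_itv/= lte_fin.
  by case: ltP => // ww; congr EFin; have := lohi i; lra.
have {}h := h mg g0 gi.
split; last by rewrite /Rintegral h.
apply/integrableP; split.
  apply/measurable_EFinP; apply: measurable_prod => i _.
  exact: (measurableT_comp (mg i) (measurable_coord i)).
under eq_integral do rewrite /= ger0_norm ?prodr_ge0//.
by rewrite h ltry.
Qed.

Lemma box_indic (lo hi : 'I_n -> R) (x : 'rV[R]_n) :
  (\prod_(i < n) \1_(`[lo i, hi i]%classic) (x ord0 i) : R) != 0 <-> forall i, lo i <= x ord0 i <= hi i.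
Proof.
rewrite prodf_seq_neq0; split => [/allP h i|h].
  have := h i (mem_index_enum _); rewrite /= indicE pnatr_eq0 eqb0 negbK inE /= in_itv/=.
  by [].
by apply/allP => i _; rewrite /= indicE pnatr_eq0 eqb0 negbK inE /= in_itv/= h.
Qed.

Lemma box_le1 (lo hi : 'I_n -> R) (x : 'rV[R]_n) :
  0 <= (\prod_(i < n) \1_(`[lo i, hi i]%classic) (x ord0 i) : R) <= 1.
Proof.
apply/andP; split; first by apply: prodr_ge0 => i _; rewrite indicE.
by apply: prodr_ile1 => i _; rewrite indicE; case: (_ \in _); rewrite ?lexx ?ler01.
Qed.

Lemma box_eq1 (lo hi : 'I_n -> R) (x : 'rV[R]_n) : (forall i, lo i <= x ord0 i <= hi i) ->
  (\prod_(i < n) \1_(`[lo i, hi i]%classic) (x ord0 i) : R) = 1.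
Proof. by move=> h; rewrite big1// => i _; rewrite indicE mem_set//= in_itv/= h. Qed.

Lemma prod_last (a b : R) : \prod_(i < n) (if i == ord_max then a else b) = b ^+ m * a.
Proof.
rewrite big_ord_recr/= eqxx; congr (_ * _).
rewrite (eq_bigr (fun=> b)); first by rewrite prodr_const card_ord.
by move=> i _; rewrite ifN// -val_eqE/= ltn_eqF.
Qed.

(** Compared with [Io_bnd] the volume is of order [L^m] instead of [L^(m+1)]; [tP2_bound] depends on
    this gain. *)
Lemma Io_bnd_strip (f : 'rV[R]_n -> R) (B L M : R) : 0 <= L -> 0 <= M -> measurable_fun setT f -> (forall x, `|f x| <= B) ->
  (forall x, f x != 0 -> cube R n L x /\ `|ver x| <= M) -> `|Io f| <= B * ((L + L) ^+ m * (M + M)).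
Proof.
move=> L0 M0 mf fB fL.
pose w (i : 'I_n) := if i == ord_max then M else L.
have w0 i : - w i <= w i by rewrite ge0_cp// /w; case: ifP.
have [IG IoG] := Io_box _ _ w0; set G := fun x => _ in IG IoG.
have E : \prod_(i < n) (w i - - w i) = (L + L) ^+ m * (M + M).
  by rewrite -prod_last; apply: eq_bigr => i _; rewrite opprK /w; case: ifP.
rewrite -E -IoG -Io_scale//.
apply: Io_abs_le => //; first exact: Int_scale.
move=> x; have [->|fx] := eqVneq (f x) 0.
  have /andP[G0 _] := box_le1 (fun i => - w i) w x.
  by rewrite normr0 mulr_ge0 // (le_trans _ (fB x)).
have [hL hM] := fL x fx.
rewrite (_ : G x = 1) ?mulr1//.
by apply: box_eq1 => i; rewrite -ler_norml /w; case: eqVneq => [->|].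
Qed.

End strip.

(** * The mollified potential on one side *)

Section side.
Context {R : realType} {m : nat}.
Local Notation n := m.+1.
Variables (s l M b Cu r0 : R) (c : 'rV[R]_n) (D : set 'rV[R]_n) (v : 'rV[R]_n -> 'rV[R]_n).
Hypotheses (hs : s = 1 \/ s = -1) (l1 : 1 <= l) (M1 : 1 <= M) (b1 : 1 < b) (Cu0 : 0 <= Cu) (r01 : 1 <= r0).
Hypothesis mD : measurable D.
(** At each of its points [D] contains a steep cone pointing inwards; the kernels with ratio [l] of
    vertical to lateral offset sample only such cones. *)
Hypothesis cone : forall (d : R) (x z : 'rV[R]_n), 0 < d -> D x ->
  (forall i, i != ord_max -> `|x ord0 i - z ord0 i| <= 2 * d) -> l * d <= s * (ver x - ver z) -> D z.
Hypothesis DM : forall x, D x -> s * ver x <= M.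
Hypothesis MD : forall x, s * ver x <= - M -> D x.
Hypothesis v0 : forall x, ~ D x -> v x = 0.
Hypothesis vloc : forall i L, 0 <= L -> Int (fun x : 'rV[R]_n => \1_(cube R n L) x * v x ord0 i).
Hypothesis vloc2 : forall i L, 0 <= L -> Int (fun x : 'rV[R]_n => \1_(cube R n L) x * (v x ord0 i) ^+ 2).
Hypothesis vdec : forall x i, r0 <= enorm x -> `|v x ord0 i| <= Cu * enorm x `^ (- b).
Hypothesis vdiv : forall phi L, 0 <= L -> sm phi -> (forall x, phi x != 0 -> cube R n L x) ->
  Io (fun x : 'rV[R]_n => \sum_j (v x ord0 j - \1_D x * c ord0 j) * partial j phi x) = 0.
Hypothesis vcurl : forall phi i j, test_function D phi ->
  Io (fun x : 'rV[R]_n => v x ord0 i * partial j phi x) = Io (fun x : 'rV[R]_n => v x ord0 j * partial i phi x).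
Hypothesis vam : forall i j, Int (fun x : 'rV[R]_n => x ord0 i * v x ord0 j - x ord0 j * v x ord0 i).
Hypothesis c0 : ver c = 0.

Let s2 : s * s = 1. Proof. by case: hs => ->; rewrite ?mulr1 ?mulrNN ?mulr1. Qed.
Let snorm t : `|s * t| = `|t|. Proof. by rewrite normrM; case: hs => ->; rewrite ?normrN normr1 mul1r. Qed.
Let l0 : 0 < l. Proof. exact: lt_le_trans l1. Qed.

Lemma Int_loc_mul (f : 'rV[R]_n -> R) i (L : R) : 0 <= L -> continuous f -> (forall x, f x != 0 -> cube R n L x) -> Int (fun x : 'rV[R]_n => f x * v x ord0 i).
Proof.
move=> L0 cf fL; have [B B0 fB] := bounded_of_supp _ _ cf fL.
have := Int_mulb _ f B (vloc i L L0) (continuous_measurable_rV _ _ _ cf) fB.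
apply: Int_eq => x; have [->|/fL h] := eqVneq (f x) 0; first by rewrite !mul0r.
by rewrite indicE mem_set// mul1r.
Qed.

Section fixed.
Variables r T d L : R.
Hypotheses (r0' : 0 < r) (T0 : 0 < T) (d0 : 0 < d) (d1 : d <= 1) (hL : 2 * r + T + 2 * l <= L).

Let ld0 : 0 < l * d. Proof. exact: mulr_gt0. Qed.
Let ldl : l * d <= l. Proof. by rewrite ler_piMr// ltW. Qed.
Let L0 : 0 <= L. Proof. by apply: le_trans hL; have := ltW l0; have := ltW r0'; have := ltW T0; lra. Qed.

Let K : 'rV[R]_n -> R := kK s d l T.
Let rho : 'rV[R]_n -> R := krho s d l.
(** The truncation makes the velocity integrable, as convolution requires; [hL] makes the cube
    contain every point that [K] samples from [cube R n (2 * r)]. *)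
Let U j (x : 'rV[R]_n) := \1_(cube R n L) x * v x ord0 j.
Let IU j : Int (U j). Proof. exact: vloc. Qed.
(** A mollified integral of [v_n] along a vertical segment of length about [T] leading into the
    domain; [sN] and [sNT] are the mollified velocities at its near and far ends. *)
Definition sPhi x := s * conv K (U ord_max) x.
Definition sN j := conv rho (U j).
Definition sNT j (x : 'rV[R]_n) := sN j (x - (s * T) *: basis_vec R ord_max).

Let sK : sm0 K. Proof. exact: sm0_kK. Qed.
Let mr : mollifier (2 * (l * d)) rho. Proof. exact: krho_mollifier. Qed.
Let srho : sm0 rho. Proof. exact: sm0_krho. Qed.
Let Kc x : K x != 0 -> cube R n (T + 2 * (l * d)) x. Proof. by apply: kK_cube => //; exact: ltW. Qed.
Let rhoc x : rho x != 0 -> cube R n (2 * (l * d)) x. Proof. by apply: krho_cube. Qed.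

Lemma sm_sPhi : sm sPhi.
Proof. by apply: sm_mul; [apply/sm_sm0/sm0_cst|exact: (sm_conv K (U ord_max) _ sK Kc)]. Qed.

Lemma continuous_sN j : continuous (sN j).
Proof. exact: (conv_continuous rho (U j) _ srho rhoc). Qed.

Lemma continuous_sNT j : continuous (sNT j).
Proof.
move=> x; apply: (@continuous_comp _ _ _ (fun x : 'rV[R]_n => x - (s * T) *: basis_vec R ord_max) (sN j)); last exact: continuous_sN.
by apply: continuousB; [exact: cvg_id|exact: cst_continuous].
Qed.

Let phi (x z : 'rV[R]_n) := K (x - z).

Let phi_partial x z j : partial j (phi x) z = - partial j K (x - z).
Proof.
apply: partial_val; apply/is_derive_line0.
have h := partialP K j (x - z) (sm0_derivable _ _ _ sK).
move/is_derive_line0 in h.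
have h2 := @is_derive_aff R (fun t : R => K (t *: basis_vec R j + (x - z))) (-1) 0 0 (partial j K (x - z)).
rewrite mulr0 addr0 in h2; have := h2 h; rewrite mulN1r.
congr is_derive; apply/funext => t; rewrite /phi; congr K.
by rewrite mulN1r addr0 scaleNr opprD addrCA.
Qed.

(** This is where the shape of the kernel counts: its support, reflected at [x], lies in the inward
    cone at [x], hence in [D], and the curl condition sees only test functions supported in [D]. The
    set [A] is a closed box around that support. *)
Let phi_test x : D x -> test_function D (phi x).
Proof.
move=> Dx.
pose tt (i : 'I_n) : R := if i == ord_max then T else 0.
pose A := \bigcap_(i in [set: 'I_n]) ((fun z : 'rV[R]_n => ksgn s i * (x - z) ord0 i) @^-1` `[kwid d l i, 2 * kwid d l i + tt i]).
have AE z : A z -> forall i, kwid d l i <= ksgn s i * (x ord0 i - z ord0 i) <= 2 * kwid d l i + tt i.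
  by move=> Az i; have := Az i Logic.I; rewrite /= in_itv/= !mxE.
apply: (sm_test _ A D (`|x| + (2 * l + T))).
- by apply: sm_sm0; exact: sm0_kKB.
- apply: closed_bigI => i _; apply: closed_comp; last exact: itv_closed.
  move=> z _; apply: sm0_continuous; apply: sm0_mul; [exact: sm0_cst|exact: sm0_coordB].
- move=> z /AE hz; apply: (cone d x z d0 Dx) => [i im|].
    have := hz i; rewrite /ksgn /kwid /tt (negbTE im) mul1r addr0 => /andP[h1 h2].
    by rewrite ger0_norm// (le_trans _ h1)// ltW.
  by have := hz ord_max; rewrite /ksgn /kwid eqxx => /andP[].
- move=> z /AE hz i; have /andP[h1 h2] := hz i.
  have xi := rV_norm_ge _ _ x i.
  have {}h2 : `|ksgn s i * (x ord0 i - z ord0 i)| <= 2 * l + T.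
    rewrite ger0_norm; last by apply: le_trans h1; rewrite ltW// kwid_gt0.
    apply: (le_trans h2); apply: lerD; last by rewrite /tt; case: ifP => // _; exact: ltW.
    rewrite ler_wpM2l// /kwid; case: ifP => // _; exact: le_trans d1 l1.
  have {}h2 : `|x ord0 i - z ord0 i| <= 2 * l + T.
    by move: h2; rewrite normrM; case: (ksgnP s hs i) => ->; rewrite ?normrN normr1 mul1r.
  by move: h2 xi; rewrite !ler_norml => /andP[? ?] /andP[? ?]; apply/andP; split; lra.
- move=> z /(kK_supp s d l T d0 l1 (ltW T0))[h1 h2] i _ /=; rewrite in_itv/=.
  have [->|im] := eqVneq i ord_max.
    rewrite /ksgn /kwid /tt eqxx; have -> : (x - z) ord0 ord_max = ver (x - z) by [].
    by rewrite [2 * _ + T]addrC.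
  by rewrite /ksgn /kwid /tt (negbTE im) mul1r addr0; exact: h1.
Qed.

Let pK_cube x z j : cube R n (2 * r) x -> partial j K (x - z) != 0 -> cube R n L z.
Proof.
move=> xr /(partial_supp _ _ _ _ Kc) h i; apply: (le_trans (cube_subl _ _ x z xr h i)).
by apply: le_trans hL; have := ldl; lra.
Qed.

Let conv_partial x i j : cube R n (2 * r) x ->
  conv (partial j K) (U i) x = - Io (fun z : 'rV[R]_n => v z ord0 i * partial j (phi x) z).
Proof.
move=> xr; rewrite -mulN1r -Io_scale; last first.
  have : Int (fun z : 'rV[R]_n => partial j (phi x) z * v z ord0 i).
    apply: (Int_loc_mul _ i L L0); first by apply/sm0_continuous/sm0_partialE; exact: sm0_kKB.
    move=> z; rewrite phi_partial oppr_eq0; exact: pK_cube.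
  by apply: Int_eq => z; rewrite mulrC.
apply: Io_eq => z; rewrite phi_partial /U indicE.
have [->|h] := eqVneq (partial j K (x - z)) 0; first by rewrite oppr0 mulr0 mul0r mulr0.
rewrite mem_set ?mul1r; last exact: pK_cube h.
by rewrite mulrN mulrN mulN1r opprK mulrC.
Qed.

(** The curl condition tested against [K (x - .)] exchanges indices: convolving [d_j K] with [v_n]
    equals convolving [d_n K] with [v_j]. By [kK_partial_max] the latter is, up to the sign [s], the
    difference of the mollified [v_j] at the two ends. *)
Lemma grad_sPhi x j : D x -> cube R n (2 * r) x -> is_derive x (basis_vec R j) sPhi (sN j x - sNT j x).
Proof.
move=> Dx xr.
have h := conv_is_derive K (U ord_max) _ j x sK Kc (IU ord_max).
have h2 := is_deriveM (is_derive_cst s x (basis_vec R j)) h.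
suff -> : sN j x - sNT j x = s *: conv (partial j K) (U ord_max) x + conv K (U ord_max) x *: 0 by exact: h2.
rewrite /GRing.scale/= mulr0 addr0 conv_partial// (vcurl _ _ _ (phi_test x Dx)) -conv_partial//.
have E (z : 'rV[R]_n) : partial ord_max K (x - z) * U j z = s * (rho (x - z) * U j z - rho (x - (s * T) *: basis_vec R ord_max - z) * U j z).
  rewrite kK_partial_max// -/rho (addrAC x).
  by move: (rho _) (rho _) (U j z) => a1 a2 a3; ring.
have I1 := conv_Int rho (U j) _ x (sm0_continuous _ srho) rhoc (IU j).
have I2 := conv_Int rho (U j) _ (x - (s * T) *: basis_vec R ord_max) (sm0_continuous _ srho) rhoc (IU j).
have -> : conv (partial ord_max K) (U j) x = s * (sN j x - sNT j x).
  apply: (etrans (Io_eq _ _ E)); apply: (etrans (Io_scale s _ (Int_sub _ _ I1 I2))).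
  congr (s * _); exact: Io_sub I1 I2.
by rewrite mulrA s2 mul1r.
Qed.

(** Every point sampled at the far end has a vertical coordinate of absolute value at least
    [T - 2 r - 2 l], so the decay of [v] passes to its average. *)
Lemma sNT_bound x j : cube R n (2 * r) x -> r0 <= T - 2 * r - 2 * l ->
  `|sNT j x| <= Cu * (T - 2 * r - 2 * l) `^ (- b).
Proof.
move=> xr rT; set B := _ * _.
have B0 : 0 <= B by rewrite mulr_ge0 ?powR_ge0.
pose y : 'rV[R]_n := x - (s * T) *: basis_vec R ord_max.
have IG := moll_Int_l _ _ mr y.
have -> : B = Io (fun z : 'rV[R]_n => B * rho (y - z)).
  have ri : Io (fun z : 'rV[R]_n => rho (y - z)) = 1 by case: mr.
  by rewrite (Io_scale B _ IG) ri mulr1.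
apply: Io_abs_le.
- apply: Int_meas; exact: (conv_Int rho (U j) _ y (sm0_continuous _ srho) rhoc (IU j)).
- exact: Int_scale.
move=> z; have g0 := krho_ge0 s d l d0 l1 (y - z).
have [->|h] := eqVneq (rho (y - z)) 0; first by rewrite mul0r normr0 mulr0.
rewrite normrM (ger0_norm g0) mulrC ler_wpM2r//.
have : `|U j z| <= `|v z ord0 j|.
  by rewrite /U indicE; case: (_ \in _); rewrite ?mul1r// mul0r normr0.
move=> /le_trans; apply.
have zT : T - 2 * r - 2 * l <= enorm z.
  apply: le_trans (coord_enorm z ord_max).
  have := rhoc _ h ord_max; have := xr ord_max; rewrite !mxE !eqxx mulr1 /= => h1 h2.
  have e : s * z ord0 ord_max = s * x ord0 ord_max - (s * s) * T - s * (x ord0 ord_max - s * T - z ord0 ord_max) by ring.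
  rewrite -[leRHS]snorm e s2 mul1r.
  rewrite -snorm in h1; rewrite -snorm in h2.
  have {}h2 : `|s * (x ord0 ord_max - s * T - z ord0 ord_max)| <= 2 * l.
    by apply: (le_trans h2); rewrite ler_wpM2l.
  move: h1 h2; rewrite !ler_norml => /andP[? ?] /andP[? ?].
  by rewrite -normrN; apply: le_trans (ler_norm _); lra.
have t0 : 0 < T - 2 * r - 2 * l by apply: lt_le_trans rT; apply: lt_le_trans r01.
apply: (le_trans (vdec z j (le_trans rT zT))).
by rewrite ler_wpM2l// powRN_le// (le_trans ler01 (ltW b1)).
Qed.

(** A point sampled at depth [tau] from [x] has l^1 norm at least [r/2 + tau]: up to a bounded loss,
    moving inwards moves away from the origin. Hence [v_n] there is at most a multiple of
    [(r/2 + tau)^(-b)], which [pow_tail] integrates. The factor [n^b] compares the l^1 and Euclidean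
    norms, and the bound is free of [T] and [d]. *)
Lemma sPhi_bound x : D x -> r <= enorm x -> 2 * n%:R * (2 * M + 2) <= r -> 2 * n%:R * r0 <= r ->
  `|sPhi x| <= Cu * n%:R `^ b * ((r / 2) `^ (1 - b) / (b - 1)).
Proof.
move=> Dx rx rM rr.
pose T' := T + 2 * (l * d).
have T'0 : 0 < T' by rewrite addr_gt0// mulr_gt0.
have A0 : 0 < r / 2 by rewrite divr_gt0.
have [mg g0 [cg ig cgl]] := pow_tail s (ver x) (r / 2) T' b hs A0 T'0 b1.
set g := fun t => if _ then _ else _ in mg g0 ig.
have [IG IoG] := kside_int s d l hs d0 l1 x g cg mg g0 ig.
have B0 : 0 <= Cu * n%:R `^ b by rewrite mulr_ge0 ?powR_ge0.
rewrite /sPhi snorm; apply: (@le_trans _ _ (Cu * n%:R `^ b * cg)); last exact: ler_wpM2l.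
rewrite -IoG -Io_scale//.
apply: Io_abs_le; last 1 first.
- move=> z; have /andP[k0 k1] := kK_bound s d l T d0 l1 (ltW T0) (x - z).
  have [->|h] := eqVneq (K (x - z)) 0.
    rewrite mul0r normr0; apply: mulr_ge0 => //; apply: mulr_ge0; [exact: kside_ge0|exact: g0].
  have [h1 h2] := kK_supp s d l T d0 l1 (ltW T0) _ h.
  rewrite normrM (ger0_norm k0) [leRHS]mulrCA ler_pM//.
  have : `|U ord_max z| <= `|v z ord0 ord_max|.
    by rewrite /U indicE; case: (_ \in _); rewrite ?mul1r// mul0r normr0.
  move=> /le_trans; apply.
  have vE : ver (x - z) = ver x - ver z by rewrite /ver !mxE.
  rewrite vE in h2; have /andP[h3 h4] := h2.
  have tau0 : 0 <= s * (ver x - ver z) by apply: le_trans h3; exact: ltW.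
  rewrite /g tau0 h4/=; set tau := s * (ver x - ver z) in h2 h3 h4 tau0 *.
  have zn : r / 2 + tau <= n%:R * enorm z.
    apply: le_trans (l1_enorm z).
    have : enorm x <= \sum_i `|x ord0 i| := enorm_l1 x.
    have : \sum_i (`|x ord0 i| - (2 * M + 2) + (if i == ord_max then tau else 0)) <= \sum_i `|z ord0 i|.
      apply: ler_sum => i _; have [->|im] := eqVneq i ord_max.
        have e : s * z ord0 ord_max = s * x ord0 ord_max - tau by rewrite /tau /ver; ring.
        have := DM x Dx; rewrite /ver => xM.
        have -> : `|z ord0 ord_max| = `|- (s * x ord0 ord_max - tau)| by rewrite normrN -e snorm.
        rewrite -(snorm (x _ _)); apply: le_trans (ler_norm _).
        exact: abs_shift.
      have := h1 i im; rewrite !mxE => /andP[h6 h7]; rewrite addr0.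
      have : `|x ord0 i| <= `|z ord0 i| + `|x ord0 i - z ord0 i|.
        by rewrite -{1}(subrK (z ord0 i) (x ord0 i)) addrC ler_normD.
      move=> h5; apply: (abs_shift2 _ _ _ _ _ h5 _ d1 M1).
      by rewrite ger0_norm// (le_trans (ltW d0)).
    have -> : \sum_i (`|x ord0 i| - (2 * M + 2) + (if i == ord_max then tau else 0)) =
       \sum_i `|x ord0 i| - n%:R * (2 * M + 2) + tau.
      rewrite big_split/= -big_mkcond/= big_pred1_eq sumrB sumr_const card_ord.
      by rewrite -[(2 * M + 2) *+ _]mulr_natl.
    rewrite -mulrA in rM; move=> q1 q2; apply: (sum_shift _ _ _ _ _ _ q1 q2 rx rM).
  have n0 : (0 : R) < n%:R by rewrite ltr0n.
  have t0 : 0 < r / 2 + tau by rewrite ltr_pwDl.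
  have ez : r0 <= enorm z.
    rewrite -(ler_pM2l n0); apply: le_trans zn; lra.
  apply: (le_trans (vdec z ord_max ez)); rewrite -mulrA ler_wpM2l//.
  have z0 : 0 < enorm z by apply: lt_le_trans ez; exact: lt_le_trans r01.
  have b0 : 0 <= b := le_trans ler01 (ltW b1).
  have := powRN_le _ _ b t0 zn b0; rewrite (powRM (- b) (ltW n0) (ltW z0)).
  have -> : (n%:R : R) `^ (- b) = (n%:R `^ b)^-1 := powRN _ _.
  by rewrite ler_pdivrMl ?powR_gt0.
- apply: Int_meas; exact: (conv_Int K (U ord_max) _ x (sm0_continuous _ sK) Kc (IU ord_max)).
- exact: Int_scale.
Qed.

End fixed.
End side.

(** * The energy identity on one side *)

Section identity.
Context {R : realType} {m : nat}.
Local Notation n := m.+1.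
Variables (s M b Cu r0 : R) (c : 'rV[R]_n) (D : set 'rV[R]_n) (v : 'rV[R]_n -> 'rV[R]_n).
Hypotheses (hs : s = 1 \/ s = -1) (M1 : 1 <= M) (b1 : 1 < b) (Cu0 : 0 <= Cu) (r01 : 1 <= r0).
Hypothesis mD : measurable D.
Hypothesis DM : forall x, D x -> s * ver x <= M.
Hypothesis MD : forall x, s * ver x <= - M -> D x.
Hypothesis v0 : forall x, ~ D x -> v x = 0.
Hypothesis vloc : forall i L, 0 <= L -> Int (fun x : 'rV[R]_n => \1_(cube R n L) x * v x ord0 i).
Hypothesis vdec : forall x i, r0 <= enorm x -> `|v x ord0 i| <= Cu * enorm x `^ (- b).
Hypothesis vdiv : forall phi L, 0 <= L -> sm phi -> (forall x, phi x != 0 -> cube R n L x) ->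
  Io (fun x : 'rV[R]_n => \sum_j (v x ord0 j - \1_D x * c ord0 j) * partial j phi x) = 0.
Hypothesis c0 : ver c = 0.
Variables (r : R) (Phi : 'rV[R]_n -> R) (N NT : 'I_n -> 'rV[R]_n -> R).
Hypotheses (r_gt0 : 0 < r) (sPhi : sm Phi) (cN : forall j, continuous (N j)) (cNT : forall j, continuous (NT j)).
Hypothesis gPhi : forall x j, D x -> cube R n (2 * r) x -> is_derive x (basis_vec R j) Phi (N j x - NT j x).

(** The velocity relative to the wave, extended by 0 outside [D]; [vdiv] says that this extension is
    divergence free on the whole space. *)
Definition divfree (x : 'rV[R]_n) j := v x ord0 j - \1_D x * c ord0 j.
Local Notation w := divfree.

Lemma IntS (f : 'rV[R]_n -> R) i (L : R) : 0 <= L -> continuous f -> (forall x, f x != 0 -> cube R n L x) ->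
  Int (fun x : 'rV[R]_n => f x * v x ord0 i).
Proof. exact: Int_loc_mul. Qed.

Lemma IntC (f : 'rV[R]_n -> R) (L : R) : 0 <= L -> continuous f -> (forall x, f x != 0 -> cube R n L x) -> Int f.
Proof.
move=> L0 cf fL; have [B B0 fB] := bounded_of_supp _ _ cf fL.
by apply: (Int_bnd _ B L) => //; exact: continuous_measurable_rV.
Qed.

Lemma IntSD (f : 'rV[R]_n -> R) (L : R) : 0 <= L -> continuous f -> (forall x, f x != 0 -> cube R n L x) ->
  Int (fun x : 'rV[R]_n => f x * \1_D x).
Proof.
move=> L0 cf fL; apply: (Int_dom _ (fun x => `|f x|)).
- apply: measurable_funM; [exact: continuous_measurable_rV|exact: measurable_indic].
- exact/Int_norm/(IntC f L).
- move=> x; rewrite normrM ler_piMr// indicE; case: (_ \in _); by rewrite ?normr1 ?normr0.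
Qed.

Lemma IntSw (f : 'rV[R]_n -> R) i (L : R) : 0 <= L -> continuous f -> (forall x, f x != 0 -> cube R n L x) ->
  Int (fun x : 'rV[R]_n => f x * w x i).
Proof.
move=> L0 cf fL; have := Int_sub _ _ (IntS f i L L0 cf fL) (Int_scale (c ord0 i) _ (IntSD f L L0 cf fL)).
by apply: Int_eq => x; rewrite /w; ring.
Qed.

(** With this factor [al * ver x >= 1] means depth at least [M], and all such points are in [D]. *)
Let al := - s / M.
Let rr : 0 <= 2 * r. Proof. by rewrite mulr_ge0// ltW. Qed.

Definition cch (x : 'rV[R]_n) := chi0 (rad r x).
Definition ckz (x : 'rV[R]_n) := chi1 (rad r x) * (2 * (r ^+ 2)^-1).
(** The derivative of [t * step 0 (al * t)]; it is 0 before depth [M] and 1 beyond depth [2 M]. *)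
Definition cG (t : R) := step 0 (al * t) + al * t * step 1 (al * t).
(** Built so that its gradient is a radial field plus [ckz cG e_n]; the step keeps its support
    inside [D], where the gradient of [Phi] is known. *)
Definition czeta (x : 'rV[R]_n) := ckz x * (ver x * step 0 (al * ver x)).
(* [cV] is the divergence-free field [(c.x) e_n - x_n c]. *)
Definition cV j (x : 'rV[R]_n) := dot c x * (j == ord_max)%:R - ver x * c ord0 j.

Lemma sm0_ver : sm0 (fun x : 'rV[R]_n => ver x).
Proof. exact: sm0_coord. Qed.

Lemma sm0_cch : sm0 cch.
Proof. apply: sm0_chi0; exact: sm0_rad. Qed.

Lemma sm0_ckz : sm0 ckz.
Proof. by apply: sm0_mul; [apply: sm0_chi1; exact: sm0_rad|exact: sm0_cst]. Qed.

Lemma sm0_czeta : sm0 czeta.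
Proof.
apply: sm0_mul; first exact: sm0_ckz.
apply: sm0_mul; first exact: sm0_ver.
apply: sm0_step; apply: sm0_mul; [exact: sm0_cst|exact: sm0_ver].
Qed.

Lemma sm0_cV j : sm0 (cV j).
Proof.
apply: sm0_sub; apply: sm0_mul; [exact: sm0_dotl|exact: sm0_cst|exact: sm0_ver|exact: sm0_cst].
Qed.

Lemma sm0_cG : sm0 (fun x : 'rV[R]_n => cG (ver x)).
Proof.
have h : sm0 (fun x : 'rV[R]_n => al * ver x) by apply: sm0_mul; [exact: sm0_cst|exact: sm0_ver].
apply: sm0_add; first exact: sm0_step.
by apply: sm0_mul => //; exact: sm0_step.
Qed.

Lemma cch_supp x : cch x != 0 -> cube R n (2 * r) x.
Proof.
move=> h; apply: enorm_cube; apply: rad_le2 => //; rewrite leNgt; apply/negP => h2.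
by move/eqP: h; apply; rewrite /cch chi0_gt2.
Qed.

Lemma ckz_supp x : ckz x != 0 -> r <= enorm x /\ enorm x <= 2 * r.
Proof.
rewrite mulf_eq0 negb_or => /andP[/chi1_supp/andP[h1 h2] _].
by split; [exact: rad_ge1|exact: rad_le2].
Qed.

Lemma ckz_cube x : ckz x != 0 -> cube R n (2 * r) x.
Proof. by move=> /ckz_supp[_ h]; exact: enorm_cube. Qed.

Let al_ge1 x : 1 <= al * ver x -> D x.
Proof.
move=> h; apply: MD; rewrite -lerN2 opprK; have M0 : 0 < M := lt_le_trans ltr01 M1.
by move: h; rewrite /al mulrAC ler_pdivlMr// mul1r mulNr.
Qed.

Lemma cG_D t : cG t != 0 -> 1 <= al * t.
Proof.
move=> h; rewrite leNgt; apply/negP => h1; move/eqP: h; apply.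
by rewrite /cG stepS_lt1// step_le1 ?(ltW h1)// mulr0 addr0.
Qed.

Lemma czeta_supp x : czeta x != 0 -> ckz x != 0 /\ D x.
Proof.
rewrite /czeta mulf_eq0 negb_or => /andP[h]; rewrite mulf_eq0 negb_or => /andP[_ h2].
split; first exact: h.
by apply: al_ge1; rewrite leNgt; apply/negP => h1; move/eqP: h2; apply; rewrite step_le1// ltW.
Qed.

Lemma czeta_cube x : czeta x != 0 -> cube R n (2 * r) x.
Proof. by move=> /czeta_supp[/ckz_cube]. Qed.

Lemma d_cch x j : is_derive x (basis_vec R j) cch (ckz x * x ord0 j).
Proof.
have := partial_rad chi0 chi1 r x j is_derive_chi0.
by rewrite mulrA.
Qed.

(** The radial coefficient [k] is left unspecified because [cV] is orthogonal to [x], so that only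
    the vertical part matters. *)
Lemma d_czeta x : exists k : R, forall j, is_derive x (basis_vec R j) czeta
  (k * x ord0 j + ckz x * cG (ver x) * (j == ord_max)%:R).
Proof.
pose k0 := 2 * (r ^+ 2)^-1.
exists (chi2 (rad r x) * k0 * k0 * (ver x * step 0 (al * ver x))) => j; pose e := basis_vec R j.
have h1 := partial_rad chi1 chi2 r x j is_derive_chi1.
have h1' := is_derive_mulf _ _ x e _ _ h1 (is_derive_cst k0 x e).
have h2 := is_derive_coord x e ord_max.
have h3 := is_derive_mulc al _ x e _ h2.
have h4 := is_derive_scomp (step 0) (step 1) _ x e _ (is_derive_step 0) h3.
have h6 := is_derive_mulf _ _ x e _ _ h1' (is_derive_mulf _ _ x e _ _ h2 h4).
apply: (is_derive_eq h6).
rewrite /ckz /cG /ver -/k0 /e !mxE eqxx/= /cst [ord_max == j]eq_sym.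
move: ((j == ord_max)%:R) (chi1 _) (chi2 _) (step 0 _) (step 1 _) => *; ring.
Qed.

Lemma d_cV x j : is_derive x (basis_vec R j) (cV j) 0.
Proof.
have h1 := is_derive_dotl c x (basis_vec R j).
have h2 := is_derive_coord x (basis_vec R j) ord_max.
have h3 := is_deriveB (is_derive_mulc ((j == ord_max)%:R) _ _ _ _ h1) (is_derive_mulc (c ord0 j) _ _ _ _ h2).
have -> : cV j = (fun y => (j == ord_max)%:R * dot c y) - (fun y => c ord0 j * y ord0 ord_max).
  by apply/funext => y; rewrite /cV mulrC (mulrC (ver y)).
apply: (is_derive_eq h3).
by rewrite dotC dot_basis mxE eqxx/= [ord_max == j]eq_sym mulrC subrr.
Qed.

Lemma cV_x x : \sum_j cV j x * x ord0 j = 0.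
Proof.
rewrite /cV; under eq_bigr do rewrite mulrBl.
rewrite sumrB (bigD1 ord_max)//= eqxx mulr1 big1 ?addr0; last first.
  by move=> j /negbTE ->; rewrite mulr0 mul0r.
under eq_bigr do rewrite -mulrA.
by rewrite -mulr_sumr -/(dot c x) mulrC subrr.
Qed.

Lemma cV_max x : cV ord_max x = dot c x.
Proof. by rewrite /cV eqxx mulr1 (_ : c ord0 ord_max = 0) ?mulr0 ?subr0. Qed.


Let gPhiE x j : D x -> cube R n (2 * r) x -> partial j Phi x = N j x - NT j x.
Proof. by move=> Dx xr; apply: partial_val; exact: gPhi. Qed.

(** [vdiv] tested against [Phi cch]. Off [D] the relative velocity is 0, so the gradient of [Phi]
    enters only where [gPhi] gives it. *)
Lemma ident_D : Io (fun x : 'rV[R]_n => \sum_j w x j * (cch x * (N j x - NT j x) + Phi x * (ckz x * x ord0 j))) = 0.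
Proof.
have sc := sm0_cch; have sm1 : sm (fun x => Phi x * cch x) by apply: sm_mul => //; exact: sm_sm0.
rewrite -[RHS](vdiv (fun x => Phi x * cch x) (2 * r) rr sm1); last first.
  by move=> x; rewrite mulf_eq0 negb_or => /andP[_ /cch_supp].
apply: Io_eq => x; apply: eq_bigr => j _; rewrite -/(w x j).
have [Dx|nD] := pselect (D x); last first.
  by rewrite /w v0// mxE indicE memNset// mul0r subr0 !mul0r.
have h := is_derive_mulf _ _ x (basis_vec R j) _ _ (partialP _ _ _ (sm_derivable _ j x sPhi)) (d_cch x j).
rewrite (partial_val _ _ _ _ h); congr (_ * _); rewrite addrC; congr (_ + _).
have [->|/cch_supp xr] := eqVneq (cch x) 0; first by rewrite !mul0r.
by rewrite gPhiE.
Qed.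

(** The divergence of [Phi czeta cV] integrates to 0. As [cV] is divergence free, orthogonal to [x]
    and has vertical component [c.x], the only terms left are [Phi ckz (c.x) cG] and
    [czeta cV . grad Phi]. *)
Lemma ident_V : Io (fun x : 'rV[R]_n => Phi x * (ckz x * dot c x * cG (ver x)) +
  czeta x * \sum_j cV j x * (N j x - NT j x)) = 0.
Proof.
pose f j x := cV j x * (Phi x * czeta x).
have sz : sm czeta by apply: sm_sm0; exact: sm0_czeta.
have sV j : sm (cV j) by apply: sm_sm0; exact: sm0_cV.
have sf j : sm (f j) by apply: sm_mul => //; exact: sm_mul.
have fc j x : f j x != 0 -> cube R n (2 * r) x.
  by rewrite /f mulf_eq0 negb_or mulf_eq0 negb_or => /andP[_ /andP[_ /czeta_cube]].
have p0 j : Io (partial j (f j)) = 0.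
  apply: (Io_partial0 (f j) j (2 * r)) => //.
  - exact: sm_continuous.
  - by move=> x; exact: sm_derivable.
  - by apply: sm_continuous; exact: sm_partialE.
  - exact: fc.
have Ip j : Int (partial j (f j)).
  apply: (IntC _ (2 * r)) => //; first by apply: sm_continuous; exact: sm_partialE.
  by move=> x; apply: partial_supp; exact: fc.
transitivity (Io (fun x : 'rV[R]_n => \sum_j partial j (f j) x)); last by rewrite Io_sum// big1.
apply: Io_eq => x; have [k hk] := d_czeta x.
have E j : partial j (f j) x = czeta x * (cV j x * (N j x - NT j x)) +
   (k * Phi x) * (cV j x * x ord0 j) + (Phi x * ckz x * cG (ver x)) * (cV j x * (j == ord_max)%:R).
  have h1 := is_derive_mulf _ _ x _ _ _ (partialP _ _ _ (sm_derivable _ j x sPhi)) (hk j).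
  have h2 := is_derive_mulf _ _ x _ _ _ (d_cV x j) h1.
  rewrite (partial_val _ _ _ _ h2).
  have -> : czeta x * (cV j x * (N j x - NT j x)) = czeta x * (cV j x * partial j Phi x).
    have [->|z0] := eqVneq (czeta x) 0; first by rewrite !mul0r.
    have [_ Dx] := czeta_supp x z0; by rewrite gPhiE//; exact: czeta_cube.
  by move: (partial j Phi x) (Phi x) (czeta x) (ckz x) (cV j x) (cG _) ((j == _)%:R) => *; ring.
under [RHS]eq_bigr do rewrite E.
rewrite !big_split/= -!mulr_sumr cV_x mulr0 addr0 addrC; congr (_ + _).
rewrite (bigD1 ord_max)//= eqxx mulr1 cV_max big1 ?addr0; last by move=> j /negbTE ->; rewrite mulr0.
by move: (Phi x) (ckz x) (cG _) (dot c x) => *; ring.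
Qed.

(** The two error terms: [tP1] is the contribution of [v] in the shell where the cutoff varies,
    [tP2] the part of the [c]-term close to the interface, where [cG] has not yet reached 1. *)
Definition tP1 (x : 'rV[R]_n) := \sum_j Phi x * ckz x * x ord0 j * v x ord0 j.
Definition tP2 (x : 'rV[R]_n) := Phi x * ckz x * dot c x * (1 - cG (ver x)) * \1_D x.

Let smI f : sm f -> (forall x, f x != 0 -> cube R n (2 * r) x) -> Int f.
Proof. by move=> sf; apply: IntC => //; exact: sm_continuous. Qed.

Let sm_k j : sm (fun x => Phi x * ckz x * x ord0 j).
Proof.
apply: sm_mul; last exact/sm_sm0/sm0_coord.
by apply: sm_mul => //; exact/sm_sm0/sm0_ckz.
Qed.

Let supp_k x y : Phi x * ckz x * y != 0 -> cube R n (2 * r) x.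
Proof. by rewrite mulf_eq0 negb_or mulf_eq0 negb_or => /andP[/andP[_ /ckz_cube]]. Qed.

Lemma tP1_Int : Int tP1.
Proof.
apply: Int_sum => j; apply: (IntS _ j (2 * r)) => //; first exact: sm_continuous.
by move=> x; exact: supp_k.
Qed.

Let sm_dc (g : 'rV[R]_n -> R) : sm g -> sm (fun x => Phi x * ckz x * (dot c x * g x)).
Proof.
move=> sg; apply: sm_mul; first by apply: sm_mul => //; exact/sm_sm0/sm0_ckz.
by apply: sm_mul => //; exact/sm_sm0/sm0_dotl.
Qed.

Let sm_G : sm (fun x : 'rV[R]_n => cG (ver x)). Proof. exact/sm_sm0/sm0_cG. Qed.
Let sm_1G : sm (fun x : 'rV[R]_n => 1 - cG (ver x)).
Proof. apply/sm_sm0/sm0_sub; [exact: sm0_cst|exact: sm0_cG]. Qed.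

Lemma tP2_Int : Int tP2.
Proof.
have h := IntSD _ _ rr (sm_continuous _ (sm_dc _ sm_1G)) (fun x => @supp_k x _).
by move: h; apply: Int_eq => x; rewrite /tP2 !mulrA.
Qed.

Let cB (f g : 'rV[R]_n -> R) : sm f -> continuous g -> continuous (fun x => f x * g x).
Proof. by move=> sf cg x; apply: continuousM; [exact: sm_continuous|exact: cg]. Qed.

Let IA (g : 'I_n -> 'rV[R]_n -> R) : (forall j, continuous (g j)) -> Int (fun x : 'rV[R]_n => \sum_j cch x * g j x * w x j).
Proof.
move=> cg; apply: Int_sum => j; apply: (IntSw _ j (2 * r)) => //; first by apply: cB => //; exact/sm_sm0/sm0_cch.
by move=> x; rewrite mulf_eq0 negb_or => /andP[/cch_supp].
Qed.

Let IB (g : 'I_n -> 'rV[R]_n -> R) : (forall j, continuous (g j)) -> Int (fun x : 'rV[R]_n => \sum_j czeta x * cV j x * g j x).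
Proof.
move=> cg; apply: Int_sum => j; apply: (IntC _ (2 * r)) => //.
  by apply: cB => //; apply: sm_mul; apply: sm_sm0; [exact: sm0_czeta|exact: sm0_cV].
by move=> x; rewrite -mulrA mulf_eq0 negb_or => /andP[/czeta_cube].
Qed.

(** In [ident_D] the term [Phi ckz (c.x)] on [D] is [tP2] plus its multiple by [cG]. The latter is
    too large to be estimated, and [ident_V] replaces it by [czeta cV . (N - NT)]. *)
Lemma side_identity : Io (fun x : 'rV[R]_n => \sum_j cch x * N j x * w x j) + Io (fun x : 'rV[R]_n => \sum_j czeta x * cV j x * N j x) =
  Io (fun x : 'rV[R]_n => \sum_j cch x * NT j x * w x j) + Io (fun x : 'rV[R]_n => \sum_j czeta x * cV j x * NT j x) - Io tP1 + Io tP2.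
Proof.
have IQ : Int (fun x : 'rV[R]_n => Phi x * ckz x * (dot c x * cG (ver x))).
  by apply: smI; [exact: sm_dc|move=> x; exact: supp_k].
have I1 := IA _ cN; have I2 := IA _ cNT; have I3 := IB _ cN; have I4 := IB _ cNT.
have eV : Io (fun x : 'rV[R]_n => Phi x * ckz x * (dot c x * cG (ver x))) +
   (Io (fun x : 'rV[R]_n => \sum_j czeta x * cV j x * N j x) - Io (fun x : 'rV[R]_n => \sum_j czeta x * cV j x * NT j x)) = 0.
  rewrite -Io_sub// -Io_add//; last exact: Int_sub.
  rewrite -[RHS]ident_V; apply: Io_eq => x; congr (_ + _); first by rewrite !mulrA.
  by rewrite mulr_sumr -sumrB; apply: eq_bigr => j _; move: (czeta x) (cV j x) (N j x) (NT j x) => *; ring.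
have eD : Io (fun x : 'rV[R]_n => \sum_j cch x * N j x * w x j) - Io (fun x : 'rV[R]_n => \sum_j cch x * NT j x * w x j) +
   (Io tP1 - (Io tP2 + Io (fun x : 'rV[R]_n => Phi x * ckz x * (dot c x * cG (ver x))))) = 0.
  have ip1 := tP1_Int; have ip2 := tP2_Int.
  rewrite -Io_sub// -Io_add// -Io_sub//; last exact: Int_add.
  rewrite -Io_add//; [|exact: Int_sub|by apply: Int_sub => //; exact: Int_add].
  rewrite -[RHS]ident_D; apply: Io_eq => x.
  have -> : \sum_j w x j * (cch x * (N j x - NT j x) + Phi x * (ckz x * x ord0 j)) =
    \sum_j (cch x * N j x * w x j - cch x * NT j x * w x j) + \sum_j w x j * (Phi x * (ckz x * x ord0 j)).
    by rewrite -big_split/=; apply: eq_bigr => j _; move: (w x j) (cch x) (N j x) (NT j x) => *; ring.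
  rewrite -sumrB; congr (_ + _).
  have -> : tP2 x + Phi x * ckz x * (dot c x * cG (ver x)) = Phi x * ckz x * dot c x * \1_D x.
    rewrite /tP2 indicE; case: (boolP (x \in D)) => [_|]; first by rewrite !mulr1; move: (cG _) => *; ring.
    rewrite notin_setE => nD; rewrite !mulr0 add0r.
    have [->|/cG_D/al_ge1] := eqVneq (cG (ver x)) 0; first by rewrite !mulr0.
    by [].
  have -> : Phi x * ckz x * dot c x * \1_D x = \sum_j Phi x * ckz x * x ord0 j * (\1_D x * c ord0 j).
    rewrite /dot mulr_sumr mulr_suml; apply: eq_bigr => j _.
    by move: (\1_D x) => *; ring.
  by rewrite /tP1 -sumrB; apply: eq_bigr => j _; rewrite /w; move: (\1_D x) => *; ring.
move: eV eD; lra.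
Qed.


Variables (H B : R).
Hypotheses (r0r : r0 <= r) (B0 : 0 <= B).
Hypothesis bPhi : forall x, D x -> r <= enorm x -> `|Phi x| <= B.
Hypothesis hH : forall y : R, [/\ `|chi0 y| <= H, `|chi1 y| <= H & `|step 1 y| <= H].

Let H0 : 0 <= H. Proof. by have [+ _ _] := hH 0; apply: le_trans. Qed.
Let kr := H * (2 * (r ^+ 2)^-1).
Let k20 : 0 <= 2 * (r ^+ 2)^-1. Proof. by rewrite mulr_ge0// invr_ge0 exprn_ge0// ltW. Qed.
Let kr0 : 0 <= kr. Proof. exact: mulr_ge0. Qed.

Let ckz_le x : `|ckz x| <= kr.
Proof. by rewrite /ckz normrM (ger0_norm k20) ler_wpM2r//; have [] := hH (rad r x). Qed.

Let bD x : ckz x != 0 -> D x -> `|Phi x * ckz x| <= B * kr.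
Proof. by move=> /ckz_supp[h _] Dx; rewrite normrM ler_pM// bPhi. Qed.

Lemma tP1_bound : `|Io tP1| <= B * kr * (n%:R * (2 * r * (Cu * r `^ (- b)))) * (2 * r + 2 * r) ^+ n.
Proof.
apply: Io_bnd => //.
- exact: Int_meas tP1_Int.
- move=> x; have X0 : 0 <= B * kr * (n%:R * (2 * r * (Cu * r `^ (- b)))).
    apply: mulr_ge0; first exact: mulr_ge0.
    by apply: mulr_ge0 => //; apply: mulr_ge0 => //; apply: mulr_ge0 => //; exact: powR_ge0.
  have E : tP1 x = Phi x * ckz x * \sum_j x ord0 j * v x ord0 j.
    by rewrite mulr_sumr; apply: eq_bigr => j _; rewrite mulrA.
  have [k0|k0] := eqVneq (ckz x) 0; first by rewrite E k0 mulr0 mul0r normr0.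
  have [Dx|nD] := pselect (D x); last first.
    by rewrite E big1 ?mulr0 ?normr0// => j _; rewrite v0// mxE mulr0.
  have [h1 h2] := ckz_supp x k0.
  rewrite E normrM ler_pM//; first exact: bD.
  apply: (le_trans (ler_norm_sum _ _ _)).
  apply: (@le_trans _ _ (\sum_(j < n) 2 * r * (Cu * r `^ (- b)))).
    apply: ler_sum => j _; rewrite normrM ler_pM//; first exact: le_trans (coord_enorm x j) h2.
    apply: (le_trans (vdec x j (le_trans r0r h1))); rewrite ler_wpM2l// powRN_le//.
    exact: le_trans ler01 (ltW b1).
  by rewrite sumr_const card_ord -[leLHS]mulr_natl.
- move=> x h; apply: ckz_cube; apply: contraNneq h => k0.
  by apply/eqP; rewrite /tP1 big1// => j _; rewrite k0 mulr0 !mul0r.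
Qed.

Let cG_bound t : `|1 - cG t| <= 2 + 2 * H.
Proof.
have s0 := step0_ge0 (al * t); have s1 := step0_le1 (al * t).
have : `|al * t * step 1 (al * t)| <= 2 * H.
  have [->|h] := eqVneq (step 1 (al * t)) 0; first by rewrite mulr0 normr0 mulr_ge0.
  have /andP[h1 h2] := step1_supp 0 _ h.
  rewrite normrM ler_pM//; last by have [] := hH (al * t).
  by rewrite ger0_norm// (le_trans _ h1).
rewrite /cG; move: (al * t * step 1 (al * t)) s0 s1 => z s0 s1.
by rewrite !ler_norml => /andP[? ?]; apply/andP; split; lra.
Qed.

Let dotc_le x : enorm x <= 2 * r -> `|dot c x| <= (\sum_i `|c ord0 i|) * (2 * r).
Proof.
move=> xr; rewrite mulr_suml; apply: (le_trans (ler_norm_sum _ _ _)); apply: ler_sum => i _.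
by rewrite normrM ler_wpM2l// (le_trans (coord_enorm x i)).
Qed.

(** On the support [s x_n <= M] because of [D], and [- s x_n <= 2 M] because [1 - cG] vanishes
    deeper down; the strip saves one factor [r]. *)
Lemma tP2_bound : `|Io tP2| <= B * kr * ((\sum_i `|c ord0 i|) * (2 * r)) * (2 + 2 * H) *
  ((2 * r + 2 * r) ^+ m * (2 * M + 2 * M)).
Proof.
have M0 : 0 < M := lt_le_trans ltr01 M1.
have S0 : 0 <= \sum_i `|c ord0 i| by exact: sumr_ge0.
apply: Io_bnd_strip => //; first by rewrite mulr_ge0// ltW.
- exact: Int_meas tP2_Int.
- move=> x; have X0 : 0 <= B * kr * ((\sum_i `|c ord0 i|) * (2 * r)) * (2 + 2 * H).
    apply: mulr_ge0; last by apply: addr_ge0 => //; exact: mulr_ge0.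
    by apply: mulr_ge0; apply: mulr_ge0.
  have [k0|k0] := eqVneq (ckz x) 0; first by rewrite /tP2 k0 mulr0 !mul0r normr0.
  have [Dx|nD] := pselect (D x); last first.
    by rewrite /tP2 indicE memNset// mulr0 normr0.
  have [h1 h2] := ckz_supp x k0.
  rewrite /tP2 indicE mem_set// mulr1 normrM ler_pM// normrM ler_pM//; first exact: bD.
  exact: dotc_le.
- move=> x; rewrite /tP2 mulf_eq0 negb_or => /andP[h].
  rewrite indicE; have [Dx|nD] := pselect (D x); last by rewrite memNset// eqxx.
  move=> _; move: h; rewrite mulf_eq0 negb_or => /andP[/supp_k xr h]; split => //.
  have xM := DM x Dx.
  have {}h : al * ver x <= 2.
    rewrite leNgt; apply/negP => h2; move/eqP: h; apply.
    by rewrite /cG stepS_gt2// step_ge2 ?(ltW h2)// mulr0 addr0 subrr.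
  have : - s * ver x <= 2 * M by move: h; rewrite /al mulrAC ler_pdivrMr.
  have -> : `|ver x| = `|s * ver x|.
    by rewrite normrM; case: hs => ->; rewrite ?normrN normr1 mul1r.
  rewrite mulNr => h'; rewrite ler_norml; apply/andP; split; lra.
Qed.

(** [cV . v] is the combination of [x_i v_n - x_n v_i] with coefficients [c_i], integrable by
    hypothesis, and [czeta] is at most [2 r kr], of order [1/r]. *)
Lemma zeta_bound : (forall i j, Int (fun x : 'rV[R]_n => x ord0 i * v x ord0 j - x ord0 j * v x ord0 i)) ->
  `|Io (fun x : 'rV[R]_n => \sum_j czeta x * cV j x * v x ord0 j)| <=
  kr * (2 * r) * \sum_i `|c ord0 i| * Io (fun x : 'rV[R]_n => `|x ord0 i * v x ord0 ord_max - x ord0 ord_max * v x ord0 i|).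
Proof.
move=> iA; pose A i (x : 'rV[R]_n) := x ord0 i * v x ord0 ord_max - x ord0 ord_max * v x ord0 i.
have IA' i : Int (fun x => `|c ord0 i| * `|A i x|) by apply: Int_scale; apply: Int_norm; exact: iA.
have -> : \sum_i `|c ord0 i| * Io (fun x : 'rV[R]_n => `|A i x|) = Io (fun x => \sum_i `|c ord0 i| * `|A i x|).
  by rewrite Io_sum//; apply: eq_bigr => i _; rewrite Io_scale//; apply: Int_norm; exact: iA.
rewrite -Io_scale; last exact: Int_sum.
apply: Io_abs_le.
- apply: Int_meas; apply: Int_sum => j; apply: (IntS _ j (2 * r)) => //.
    by apply: sm_continuous; apply: sm_mul; apply: sm_sm0; [exact: sm0_czeta|exact: sm0_cV].
  by move=> x; rewrite mulf_eq0 negb_or => /andP[/czeta_cube].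
- by apply: Int_scale; exact: Int_sum.
move=> x.
have -> : \sum_j czeta x * cV j x * v x ord0 j = czeta x * \sum_i c ord0 i * A i x.
  have -> : \sum_i c ord0 i * A i x = dot c x * v x ord0 ord_max - ver x * \sum_i c ord0 i * v x ord0 i.
    rewrite /dot mulr_suml mulr_sumr -sumrB; apply: eq_bigr => i _; rewrite /A /ver; ring.
  transitivity (czeta x * \sum_j cV j x * v x ord0 j).
    by rewrite mulr_sumr; apply: eq_bigr => j _; rewrite mulrA.
  congr (_ * _); rewrite /cV; under eq_bigr do rewrite mulrBl.
  rewrite sumrB; congr (_ - _); last by rewrite mulr_sumr; apply: eq_bigr => j _; rewrite mulrA.
  rewrite (bigD1 ord_max)//= eqxx mulr1 big1 ?addr0// => j /negbTE ->; by rewrite mulr0 mul0r.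
rewrite normrM ler_pM//.
  have [->|z0] := eqVneq (czeta x) 0; first by rewrite normr0; exact: mulr_ge0.
  have [k0 _] := czeta_supp x z0; have [h1 h2] := ckz_supp x k0.
  rewrite /czeta normrM ler_pM// normrM -[leRHS]mulr1 ler_pM//.
    exact: le_trans (coord_enorm x _) h2.
  by rewrite ger0_norm ?step0_ge0// step0_le1.
by apply: (le_trans (ler_norm_sum _ _ _)); apply: ler_sum => i _; rewrite normrM.
Qed.

End identity.

Lemma fin_min {R : realType} {k : nat} (P : 'I_k -> R -> Prop) :
  (forall j, exists2 r0 : R, 0 < r0 & forall r, r <= r0 -> P j r) ->
  exists2 r0 : R, 0 < r0 & forall r, r <= r0 -> forall j, P j r.
Proof.
move=> h; have h' j : exists r0 : R, 0 < r0 /\ forall r, r <= r0 -> P j r.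
  by have [r0 a1 a2] := h j; exists r0.
have [f hf] := choice h'.
exists (\big[Order.min/1]_(j < k) f j).
  by apply/bigmin_gtP; split => // j _; have [] := hf j.
move=> r rm j; have [_] := hf j; apply; apply: (le_trans rm).
exact: bigmin_le_cond.
Qed.

Lemma Int_mul2 {R : realType} {n : nat} (f g : 'rV[R]_n -> R) : Int f -> Int g ->
  Int (fun x => f x ^+ 2) -> Int (fun x => g x ^+ 2) -> Int (fun x => f x * g x).
Proof.
move=> If Ig If2 Ig2; apply: (Int_dom _ _ _ (Int_add _ _ If2 Ig2)).
  by apply: measurable_funM; exact: Int_meas.
move=> x; rewrite ler_norml; have := sqr_ge0 (f x + g x); have := sqr_ge0 (f x - g x).
have := sqr_ge0 (f x); have := sqr_ge0 (g x).
by move=> *; apply/andP; split; nra.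
Qed.

(** The final bookkeeping: [a] and [b] come from the mollified velocity, for which the identity
    holds, and [a'] and [b'] from the velocity itself, for which the bounds are wanted. The three
    errors [e/2], [e/4], [e/4] add up to [e]. *)
Lemma norm_lin {R : realType} (I1 I2 I3 I4 a a' b b' X Y P1 P2 p1 p2 p3 e : R) :
  I1 = a' -> I2 = b' -> I3 = a -> I4 = b -> I3 + I4 = X + Y - P1 + P2 -> `|X| + `|Y| <= e / 2 -> `|P1| <= p1 -> `|P2| <= p2 -> `|I2| <= p3 ->
  `|a - a'| <= e / 4 -> `|b - b'| <= e / 4 -> `|I1| <= p1 + p2 + p3 + e.
Proof.
move=> -> -> -> -> h1 hX; have hX1 := ler_norm X; have hX2 := ler_norm (- X); rewrite normrN in hX2.
have hY1 := ler_norm Y; have hY2 := ler_norm (- Y); rewrite normrN in hY2.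
rewrite !ler_norml => /andP[? ?] /andP[? ?] /andP[? ?] /andP[? ?] /andP[? ?].
by apply/andP; split; lra.
Qed.

(** * The energy estimate on one side *)

Section side.
Context {R : realType} {m : nat}.
Local Notation n := m.+1.
Variables (s l M b Cu r0 : R) (c : 'rV[R]_n) (D : set 'rV[R]_n) (v : 'rV[R]_n -> 'rV[R]_n).
Hypotheses (hs : s = 1 \/ s = -1) (l1 : 1 <= l) (M1 : 1 <= M) (b1 : 1 < b) (Cu0 : 0 <= Cu) (r01 : 1 <= r0).
Hypothesis mD : measurable D.
Hypothesis cone : forall (d : R) (x z : 'rV[R]_n), 0 < d -> D x ->
  (forall i, i != ord_max -> `|x ord0 i - z ord0 i| <= 2 * d) -> l * d <= s * (ver x - ver z) -> D z.
Hypothesis DM : forall x, D x -> s * ver x <= M.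
Hypothesis MD : forall x, s * ver x <= - M -> D x.
Hypothesis v0 : forall x, ~ D x -> v x = 0.
Hypothesis vloc : forall i L, 0 <= L -> Int (fun x : 'rV[R]_n => \1_(cube R n L) x * v x ord0 i).
Hypothesis vloc2 : forall i L, 0 <= L -> Int (fun x : 'rV[R]_n => \1_(cube R n L) x * (v x ord0 i) ^+ 2).
Hypothesis vdec : forall x i, r0 <= enorm x -> `|v x ord0 i| <= Cu * enorm x `^ (- b).
Hypothesis vdiv : forall phi L, 0 <= L -> sm phi -> (forall x, phi x != 0 -> cube R n L x) ->
  Io (fun x : 'rV[R]_n => \sum_j (v x ord0 j - \1_D x * c ord0 j) * partial j phi x) = 0.
Hypothesis vcurl : forall phi i j, test_function D phi ->
  Io (fun x : 'rV[R]_n => v x ord0 i * partial j phi x) = Io (fun x : 'rV[R]_n => v x ord0 j * partial i phi x).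
Hypothesis vam : forall i j, Int (fun x : 'rV[R]_n => x ord0 i * v x ord0 j - x ord0 j * v x ord0 i).
Hypothesis c0 : ver c = 0.
Local Notation w := (divfree c D v).

Lemma IntSw2 (f : 'rV[R]_n -> R) j (L : R) : 0 <= L -> continuous f -> (forall x, f x != 0 -> cube R n L x) ->
  Int (fun x : 'rV[R]_n => (f x * w x j) ^+ 2).
Proof.
move=> L0 cf fL; have [B B0 fB] := bounded_of_supp _ _ cf fL.
have mfw := Int_meas _ (IntSw c D v mD vloc f j L L0 cf fL).
have I1 := Int_scale (2 * B ^+ 2) _ (vloc2 j L L0).
have I2 := Int_scale (2 * B ^+ 2 * (c ord0 j) ^+ 2) _ (Int_cube (n := n) L L0).
apply: (Int_dom _ _ _ (Int_add _ _ I1 I2)); first exact: measurable_funX.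
move=> x; have [f0|/fL h] := eqVneq (f x) 0.
  rewrite f0 mul0r expr0n/= normr0 !indicE.
  have b2 : 0 <= 2 * B ^+ 2 by rewrite mulr_ge0// sqr_ge0.
  apply: addr_ge0; first by rewrite (mulr_ge0 b2)// mulr_ge0// sqr_ge0.
  by apply: mulr_ge0 => //; rewrite (mulr_ge0 b2)// sqr_ge0.
rewrite ger0_norm ?sqr_ge0// !indicE mem_set// mul1r mulr1 exprMn.
have hf : f x ^+ 2 <= B ^+ 2 by rewrite -real_normK ?num_real// lerXn2r ?nnegrE.
apply: (@le_trans _ _ (B ^+ 2 * (2 * v x ord0 j ^+ 2 + 2 * c ord0 j ^+ 2))); last by rewrite le_eqVlt; apply/orP; left; apply/eqP; ring.
rewrite ler_pM ?sqr_ge0// /divfree indicE; have := sqr_ge0 (v x ord0 j + c ord0 j); have := sqr_ge0 (v x ord0 j); have := sqr_ge0 (c ord0 j).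
by case: (_ \in _) => /=; rewrite ?mul1r ?mul0r ?subr0; nra.
Qed.

Section fixed.
Variables (r H e : R).
Hypotheses (r_gt0 : 0 < r) (e0 : 0 < e) (r0r : r0 <= r) (rM : 2 * n%:R * (2 * M + 2) <= r) (rr0 : 2 * n%:R * r0 <= r).
Hypothesis hH : forall y : R, [/\ `|chi0 y| <= H, `|chi1 y| <= H & `|step 1 y| <= H].

Local Notation ch := (cch (m := m) r).
Local Notation Z := (fun j x => czeta s M r x * cV c j x).
Let kr := H * (2 * (r ^+ 2)^-1).
Let B := Cu * n%:R `^ b * ((r / 2) `^ (1 - b) / (b - 1)).
Let KA := \sum_i `|c ord0 i| * Io (fun x : 'rV[R]_n => `|x ord0 i * v x ord0 ord_max - x ord0 ord_max * v x ord0 i|).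

Let rr : 0 <= 2 * r. Proof. by rewrite mulr_ge0// ltW. Qed.
Let smch : sm ch. Proof. by apply: sm_sm0; exact: sm0_cch. Qed.
Let smZ j : sm (Z j). Proof. by apply: sm_mul; apply: sm_sm0; [exact: sm0_czeta|exact: sm0_cV]. Qed.
Let chc x : ch x != 0 -> cube R n (2 * r) x. Proof. exact: cch_supp. Qed.
Let Zc j x : Z j x != 0 -> cube R n (2 * r) x.
Proof. by rewrite /= mulf_eq0 negb_or => /andP[/(czeta_cube s M D M1 MD r r_gt0)]. Qed.
Let l0 : 0 < l. Proof. exact: lt_le_trans l1. Qed.
Let Iw j : Int (fun x => ch x * w x j).
Proof. exact: (IntSw c D v mD vloc _ j (2 * r) rr (sm_continuous _ smch) chc). Qed.
Let IZ j : Int (Z j).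
Proof. exact: (IntC _ (2 * r) rr (sm_continuous _ (smZ j)) (@Zc j)). Qed.

Let IZ2 j : Int (fun x => Z j x ^+ 2).
Proof.
apply: (IntC (fun x => Z j x * Z j x) (2 * r) rr (sm_continuous _ (sm_mul _ _ (smZ j) (smZ j)))).
by move=> x; rewrite mulf_eq0 orbb; exact: Zc.
Qed.
Let Iw2 j : Int (fun x => (ch x * w x j) ^+ 2).
Proof. exact: (IntSw2 _ j _ rr (sm_continuous _ smch) chc). Qed.

(** With [r] fixed, [T] is taken so large that the far-end terms are at most [e/2]; then [d] so
    small that mollified velocities may be replaced by [v] at a cost of [e/4] twice. The order
    matters: the truncation radius [L], hence [U], depends on [T], while the bound [B] of the
    potential depends on neither [T] nor [d]. *)
Lemma side_est_e : `|Io (fun x : 'rV[R]_n => \sum_j ch x * w x j * v x ord0 j)| <=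
  B * kr * (n%:R * (2 * r * (Cu * r `^ (- b)))) * (2 * r + 2 * r) ^+ n +
  B * kr * ((\sum_i `|c ord0 i|) * (2 * r)) * (2 + 2 * H) * ((2 * r + 2 * r) ^+ m * (2 * M + 2 * M)) +
  kr * (2 * r) * KA + e.
Proof.
pose KX := \sum_j Io (fun x => `|ch x * w x j|) + \sum_j Io (fun x => `|Z j x|).
have KX0 : 0 <= KX by apply: addr_ge0; apply: sumr_ge0 => j _; apply: Io_ge0.
(* Chosen so that [Cu t^(-b) KX <= e / 2], using [t^(-b) <= 1/t]; [T] is then set so that the far
   end is at distance at least [t]. *)
pose t := r0 + 2 * Cu * (KX + 1) / e.
have k0 : 0 <= 2 * Cu * (KX + 1) / e by apply: divr_ge0; [apply: mulr_ge0; [exact: mulr_ge0|exact: addr_ge0]|exact: ltW].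
have t1 : 1 <= t by rewrite (le_trans r01)// lerDl.
have t0 : 0 < t := lt_le_trans ltr01 t1.
have tb : Cu * t `^ (- b) * KX <= e / 2.
  have h1 : t `^ (- b) <= t^-1 by rewrite -powR_inv1 ?(ltW t0)// ler_powR// lerN2 ltW.
  apply: (@le_trans _ _ (Cu * t^-1 * KX)); first by rewrite ler_wpM2r// ler_wpM2l.
  rewrite mulrAC ler_pdivrMr// mulrAC ler_pdivlMr// mulrC mulrA.
  have : 2 * Cu * (KX + 1) <= e * t.
    by rewrite [leRHS]mulrC -ler_pdivrMr// /t lerDr (le_trans ler01).
  by apply: le_trans; rewrite ler_wpM2l ?mulr_ge0// lerDl.
pose T := t + 2 * r + 2 * l.
have T0 : 0 < T by apply: addr_gt0; [apply: addr_gt0 => //|]; exact: mulr_gt0.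
pose L := 2 * r + T + 2 * l.
have l20 : 0 <= 2 * l by apply: mulr_ge0 => //; exact: ltW.
have L0 : 0 <= L by apply: addr_ge0 => //; apply: addr_ge0 => //; exact: ltW.
pose U j (x : 'rV[R]_n) := \1_(cube R n L) x * v x ord0 j.
have IU j : Int (U j) by exact: vloc.
have IU2 j : Int (fun x => U j x ^+ 2).
  have := vloc2 j L L0; apply: Int_eq => x; rewrite /U exprMn; congr (_ * _).
  by rewrite indicE; case: (_ \in _); rewrite ?expr1n ?expr0n.
pose e1 := e / (4 * n%:R).
have n0 : (0 : R) < n%:R by rewrite ltr0n.
have e10 : 0 < e1 by rewrite divr_gt0// mulr_gt0.
pose P j d := 0 < d -> d <= 1 ->
  `|Io (fun x => ch x * w x j * conv (krho s d l) (U j) x) - Io (fun x => ch x * w x j * U j x)| <= e1 /\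
  `|Io (fun x => Z j x * conv (krho s d l) (U j) x) - Io (fun x => Z j x * U j x)| <= e1.
have [d' d'0 hd'] : exists2 d0 : R, 0 < d0 & forall d, d <= d0 -> forall j, P j d.
  apply: fin_min => j.
  have [ra ra0 ha] := moll_cvg_L2 (U j) _ (IU j) (IU2 j) (Iw j) (Iw2 j) e1 e10.
  have [rb rb0 hb] := moll_cvg_L2 (U j) _ (IU j) (IU2 j) (IZ j) (IZ2 j) e1 e10.
  exists (Num.min ra rb / (2 * l)); first by rewrite divr_gt0 ?lt_min ?ra0// mulr_gt0.
  move=> d; rewrite ler_pdivlMr ?mulr_gt0// => hd d0 d1.
  have e2 : 2 * (l * d) = d * (2 * l) by ring.
  move: hd; rewrite -e2 le_min => /andP[h1 h2].
  have mr := krho_mollifier (m := m) s d l hs d0 l1.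
  by split; [exact: ha h1 mr|exact: hb h2 mr].
pose d := Num.min d' 1.
have d0 : 0 < d by rewrite lt_min d'0 ltr01.
have d1 : d <= 1 by rewrite ge_min lexx orbT.
have hd j : P j d by apply: hd'; rewrite ge_min lexx.
have hLL : 2 * r + T + 2 * l <= L by [].
pose Ph := sPhi s l v T d L; pose NN := sN s l v d L; pose NT := sNT s l v T d L.
have sPh : sm Ph by exact: (sm_sPhi s l v hs l1 vloc r T d L r_gt0 T0 d0 hLL).
have cNN j : continuous (NN j) by exact: (continuous_sN s l v hs l1 vloc r T d L r_gt0 T0 d0 hLL).
have cNT j : continuous (NT j) by exact: (continuous_sNT s l v hs l1 vloc r T d L r_gt0 T0 d0 hLL).
have gPh x j : D x -> cube R n (2 * r) x -> is_derive x (basis_vec R j) Ph (NN j x - NT j x).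
  exact: (grad_sPhi s l D v hs l1 cone vloc vcurl r T d L r_gt0 T0 d0 d1 hLL).
have bPh x : D x -> r <= enorm x -> `|Ph x| <= B.
  by move=> Dx xr; exact: (sPhi_bound s l M b Cu r0 D v hs l1 M1 b1 Cu0 r01 DM vloc vdec r T d L).
have tE : T - 2 * r - 2 * l = t by rewrite /T; ring.
have bNT x j : cube R n (2 * r) x -> `|NT j x| <= Cu * t `^ (- b).
  move=> xr; rewrite -tE; apply: (sNT_bound s l b Cu r0 v hs l1 b1 Cu0 r01 vloc vdec r T d L) => //.
  by rewrite tE /t lerDl.
have B0 : 0 <= B.
  rewrite /B; apply: mulr_ge0; first by apply: mulr_ge0 => //; exact: powR_ge0.
  by apply: divr_ge0; [exact: powR_ge0|rewrite subr_ge0 ltW].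
have id := side_identity s M c D v M1 mD MD v0 vloc vdiv c0 r Ph NN NT r_gt0 sPh cNN cNT gPh.
have b1' := tP1_bound b Cu r0 D v b1 Cu0 v0 vloc vdec r Ph r_gt0 sPh H B r0r B0 bPh hH.
have b2' := tP2_bound s M c D hs M1 mD DM r Ph r_gt0 sPh H B B0 bPh hH.
have b3' := zeta_bound s M c D v M1 MD vloc r r_gt0 H hH vam.
have cch_c : continuous ch := sm_continuous _ smch.
have IwN (g : 'I_n -> 'rV[R]_n -> R) j : (forall j, continuous (g j)) -> Int (fun x => ch x * g j x * w x j).
  move=> cg; apply: (IntSw c D v mD vloc (fun x => ch x * g j x) j (2 * r) rr).
    by move=> x; apply: continuousM; [exact: cch_c|exact: cg].
  by move=> x; rewrite mulf_eq0 negb_or => /andP[/chc].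
have IZN (g : 'I_n -> 'rV[R]_n -> R) j : (forall j, continuous (g j)) -> Int (fun x => Z j x * g j x).
  move=> cg; apply: (IntC _ (2 * r) rr).
    move=> x; exact: (continuousM (sm_continuous _ (smZ j) x) (cg j x)).
  by move=> x; rewrite mulf_eq0 negb_or => /andP[/Zc].
have cubeU x j : cube R n (2 * r) x -> U j x = v x ord0 j.
  move=> xr; rewrite /U indicE mem_set ?mul1r// => i; apply: (le_trans (xr i)).
  by rewrite /L -addrA lerDl addr_ge0 ?(ltW T0)// mulr_ge0// ltW.
have IwU j : Int (fun x => ch x * w x j * U j x) by exact: Int_mul2.
have IZU j : Int (fun x => Z j x * U j x) by exact: Int_mul2.
have S1 : Io (fun x : 'rV[R]_n => \sum_j ch x * w x j * v x ord0 j) = \sum_j Io (fun x => ch x * w x j * U j x).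
  rewrite -Io_sum//; apply: Io_eq => x; apply: eq_bigr => j _.
  by have [->|/chc/cubeU ->//] := eqVneq (ch x) 0; rewrite !mul0r.
have S2 : Io (fun x : 'rV[R]_n => \sum_j Z j x * v x ord0 j) = \sum_j Io (fun x => Z j x * U j x).
  rewrite -Io_sum//; apply: Io_eq => x; apply: eq_bigr => j _.
  by have [->|/Zc/cubeU ->//] := eqVneq (Z j x) 0; rewrite !mul0r.
have S3 : Io (fun x : 'rV[R]_n => \sum_j ch x * NN j x * w x j) = \sum_j Io (fun x => ch x * w x j * NN j x).
  rewrite Io_sum; last by move=> j; exact: IwN.
  by apply: eq_bigr => j _; apply: Io_eq => x; rewrite mulrAC.
have S4 : Io (fun x : 'rV[R]_n => \sum_j Z j x * NN j x) = \sum_j Io (fun x => Z j x * NN j x).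
  by rewrite Io_sum// => j; exact: IZN.
have X1 : `|Io (fun x : 'rV[R]_n => \sum_j ch x * NT j x * w x j)| <= Cu * t `^ (- b) * \sum_j Io (fun x => `|ch x * w x j|).
  rewrite Io_sum; last by move=> j; exact: IwN.
  rewrite mulr_sumr; apply: (le_trans (ler_norm_sum _ _ _)); apply: ler_sum => j _.
  rewrite -Io_scale; last exact: Int_norm.
  apply: Io_abs_le; [exact: Int_meas (IwN _ j cNT)|exact/Int_scale/Int_norm|move=> x].
  have [->|/chc xr] := eqVneq (ch x) 0; first by rewrite !mul0r normr0 mulr0.
  by rewrite mulrAC normrM mulrC ler_wpM2r// bNT.
have X2 : `|Io (fun x : 'rV[R]_n => \sum_j Z j x * NT j x)| <= Cu * t `^ (- b) * \sum_j Io (fun x => `|Z j x|).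
  rewrite Io_sum; last by move=> j; exact: IZN.
  rewrite mulr_sumr; apply: (le_trans (ler_norm_sum _ _ _)); apply: ler_sum => j _.
  rewrite -Io_scale; last exact: Int_norm.
  apply: Io_abs_le; [exact: Int_meas (IZN _ j cNT)|exact/Int_scale/Int_norm|move=> x].
  have [->|/Zc xr] := eqVneq (Z j x) 0; first by rewrite !mul0r normr0 mulr0.
  by rewrite normrM mulrC ler_wpM2r// bNT.
have ne1 : n%:R * e1 = e / 4 by rewrite /e1; field; rewrite ?gt_eqF.
have D1 : `|\sum_j Io (fun x => ch x * w x j * NN j x) - \sum_j Io (fun x => ch x * w x j * U j x)| <= e / 4.
  rewrite -ne1 -sumrB; apply: (le_trans (ler_norm_sum _ _ _)).
  rewrite mulr_natl -[n in leRHS]card_ord -sumr_const; apply: ler_sum => j _.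
  by have [] := hd j d0 d1.
have D2 : `|\sum_j Io (fun x => Z j x * NN j x) - \sum_j Io (fun x => Z j x * U j x)| <= e / 4.
  rewrite -ne1 -sumrB; apply: (le_trans (ler_norm_sum _ _ _)).
  rewrite mulr_natl -[n in leRHS]card_ord -sumr_const; apply: ler_sum => j _.
  by have [] := hd j d0 d1.
apply: (norm_lin _ _ _ _ _ _ _ _ _ _ _ _ _ _ _ _ S1 S2 S3 S4 id _ b1' b2' b3' D1 D2).
apply: (le_trans (lerD X1 X2)); rewrite -mulrDr; exact: tb.
Qed.
End fixed.

(** Count of powers of [r] at [b = m + eps]: [tP1] gives [1 + m - 2 b <= - eps] since [m >= 1],
    [tP2] gives exactly [m - b = - eps], and the angular momentum term gives [-1]. The constants do
    not depend on [e], which tends to 0. *)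
Lemma side_est (eps : R) : (0 < m)%N -> 0 < eps -> eps <= 1 -> b = m%:R + eps ->
  exists C r1 : R, forall r, r1 <= r ->
  `|Io (fun x : 'rV[R]_n => \sum_j cch r x * w x j * v x ord0 j)| <= C * r `^ (- eps).
Proof.
move=> m0 eps0 eps1 bE; have [H H1 hH] := @chi_bounded R.
pose KA := \sum_i `|c ord0 i| * Io (fun x : 'rV[R]_n => `|x ord0 i * v x ord0 ord_max - x ord0 ord_max * v x ord0 i|).
pose CB := Cu * n%:R `^ b * ((1 / 2) `^ (1 - b) / (b - 1)).
pose C1 := CB * (H * 2) * (n%:R * (2 * Cu)) * 4 ^+ n.
pose C2 := CB * (H * 2) * ((\sum_i `|c ord0 i|) * 2) * (2 + 2 * H) * (4 ^+ m * (2 * M + 2 * M)).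
pose C3 := H * 4 * KA.
have H0 : 0 <= H := le_trans ler01 H1.
have b10 : 0 <= b - 1 by rewrite subr_ge0 ltW.
have CB0 : 0 <= CB by rewrite !mulr_ge0 ?powR_ge0// invr_ge0.
have S0 : 0 <= \sum_i `|c ord0 i| by exact: sumr_ge0.
have M0 : 0 <= M := le_trans ler01 M1.
have p4 k : 0 <= (4 : R) ^+ k by exact: exprn_ge0.
have CH0 : 0 <= CB * (H * 2) by apply: mulr_ge0 => //; exact: mulr_ge0.
have C10 : 0 <= C1 by apply: mulr_ge0 => //; apply: mulr_ge0 => //; apply: mulr_ge0 => //; exact: mulr_ge0.
have M20 : 0 <= 2 * M by exact: mulr_ge0.
have C20 : 0 <= C2.
  apply: mulr_ge0; last by apply: mulr_ge0 => //; exact: addr_ge0.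
  apply: mulr_ge0; last by apply: addr_ge0 => //; exact: mulr_ge0.
  by apply: mulr_ge0 => //; exact: mulr_ge0.
have C30 : 0 <= C3.
  apply: mulr_ge0; first exact: mulr_ge0.
  by apply: sumr_ge0 => i _; apply: mulr_ge0 => //; exact: Io_ge0.
exists (C1 + C2 + C3), (Num.max 1 (Num.max r0 (Num.max (2 * n%:R * (2 * M + 2)) (2 * n%:R * r0)))) => r.
rewrite !ge_max => /andP[r1 /andP[r2 /andP[r3 r4]]].
have rp : 0 < r := lt_le_trans ltr01 r1.
have rn : r != 0 by rewrite gt_eqF.
have h4 : 2 * r + 2 * r = 4 * r by ring.
apply/ler_addgt0Pr => e e0; apply: (le_trans (side_est_e r H e rp e0 r2 r3 r4 hH)); rewrite lerD2r.
have pE : (r / 2) `^ (1 - b) = (1 / 2) `^ (1 - b) * r `^ (1 - b).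
  by rewrite -powRM ?(ltW rp)//; congr (_ `^ _); field.
rewrite -/KA h4 pE (mulrDl (C1 + C2)) (mulrDl C1); apply: lerD; first apply: lerD.
- have -> : Cu * n%:R `^ b * ((1 / 2) `^ (1 - b) * r `^ (1 - b) / (b - 1)) * (H * (2 / r ^+ 2)) *
     (n%:R * (2 * r * (Cu * r `^ (- b)))) * (4 * r) ^+ n = C1 * (r `^ (1 - b) * r `^ (- b) * r ^+ m).
    rewrite /C1 /CB exprMn [r ^+ n]exprS.
    move: (r `^ _) (r `^ _) ((1 / 2) `^ _) (n%:R `^ b) (n%:R) (4 ^+ n) (r ^+ m) => a1 a2 a3 a4 a5 a6 a7.
    by field; rewrite rn/= subr_eq0 gt_eqF.
  rewrite ler_wpM2l// -powR_mulrn ?(ltW rp)// -!powRD; try by apply/implyP => /eqP; rewrite (negbTE rn).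
  rewrite ler_powR// bE; have : (1 : R) <= m%:R by rewrite ler1n.
  by lra.
- have -> : Cu * n%:R `^ b * ((1 / 2) `^ (1 - b) * r `^ (1 - b) / (b - 1)) * (H * (2 / r ^+ 2)) *
     ((\sum_i `|c ord0 i|) * (2 * r)) * (2 + 2 * H) * ((4 * r) ^+ m * (2 * M + 2 * M)) = C2 * (r `^ (1 - b) * r ^+ m * r^-1).
    rewrite /C2 /CB exprMn.
    move: (r `^ _) ((1 / 2) `^ _) (n%:R `^ b) (n%:R) (4 ^+ m) (r ^+ m) (\sum_i _) => a1 a3 a4 a5 a6 a7 a8.
    by field; rewrite rn/= subr_eq0 gt_eqF.
  rewrite ler_wpM2l// -powR_mulrn ?(ltW rp)// -powR_inv1 ?(ltW rp)// -!powRD; try by apply/implyP => /eqP; rewrite (negbTE rn).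
  by rewrite ler_powR// bE; lra.
- have -> : H * (2 / r ^+ 2) * (2 * r) * KA = C3 * r^-1 by rewrite /C3; field.
  by rewrite ler_wpM2l// -powR_inv1 ?(ltW rp)// ler_powR// lerN2.
Qed.
End side.

Lemma exponent_le {R : realType} (a e : R) : 1 <= a -> 0 < e -> - (a + e) - (a + e) + (a + 1) <= - e.
Proof. by move=> *; lra. Qed.

(** * The two sides together *)

Section twosided.
Context {R : realType} {m : nat}.
Local Notation n := m.+1.
Variables (b Cu r0 eps : R) (c : 'rV[R]_n) (D1 D2 : set 'rV[R]_n) (v : 'rV[R]_n -> 'rV[R]_n).
Hypotheses (m0 : (0 < m)%N) (eps0 : 0 < eps) (eps1 : eps <= 1) (bE : b = m%:R + eps) (Cu0 : 0 <= Cu) (r01 : 1 <= r0).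
Hypotheses (mD1 : measurable D1) (mD2 : measurable D2).
Hypothesis D12 : forall x, D1 x -> D2 x -> False.
Hypothesis null : leb R n (~` (D1 `|` D2)) = 0%E.
Hypothesis v0 : forall x, ~ (D1 `|` D2) x -> v x = 0.
Hypothesis vloc : forall i L, 0 <= L -> Int (fun x : 'rV[R]_n => \1_(cube R n L) x * v x ord0 i).
Hypothesis vloc2 : forall i L, 0 <= L -> Int (fun x : 'rV[R]_n => \1_(cube R n L) x * (v x ord0 i) ^+ 2).
Hypothesis vdec : forall x i, r0 <= enorm x -> `|v x ord0 i| <= Cu * enorm x `^ (- b).
Let v_ (D : set 'rV[R]_n) x : 'rV[R]_n := \1_D x *: v x.
Hypothesis vdiv : forall D, D = D1 \/ D = D2 -> forall phi L, 0 <= L -> sm phi -> (forall x, phi x != 0 -> cube R n L x) ->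
  Io (fun x : 'rV[R]_n => \sum_j (v_ D x ord0 j - \1_D x * c ord0 j) * partial j phi x) = 0.
Hypothesis vam : forall i j, Int (fun x : 'rV[R]_n => x ord0 i * v x ord0 j - x ord0 j * v x ord0 i).
Hypothesis vest : forall D, D = D1 \/ D = D2 -> exists C r1 : R, forall r, r1 <= r ->
  `|Io (fun x : 'rV[R]_n => \sum_j cch r x * divfree c D (v_ D) x j * v_ D x ord0 j)| <= C * r `^ (- eps).

Let vloc_ D : D = D1 \/ D = D2 -> forall i L, 0 <= L -> Int (fun x : 'rV[R]_n => \1_(cube R n L) x * v_ D x ord0 i).
Proof.
move=> hD i L L0; apply: (Int_dom _ _ _ (Int_norm _ (vloc i L L0))).
  have h : measurable_fun setT (fun x : 'rV[R]_n => \1_D x * (\1_(cube R n L) x * v x ord0 i)).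
    apply: measurable_funM; last exact: (Int_meas _ (vloc i L L0)).
    by apply: measurable_indic; case: hD => ->.
  apply: (eq_measurable_fun _ _ h) => x _; rewrite /v_ mxE mulrCA //.
move=> x; rewrite /v_ mxE mulrCA normrM ler_piMl// indicE; case: (_ \in _); by rewrite ?normr1 ?normr0.
Qed.

Let Io_ae (f g : 'rV[R]_n -> R) : Int f -> Int g -> (forall x, (D1 `|` D2) x -> f x = g x) -> Io f = Io g.
Proof.
move=> If Ig fg; rewrite /Rintegral; congr fine; apply: ae_eq_integral => //.
- exact: measurable_int If.
- exact: measurable_int Ig.
exists (~` (D1 `|` D2)); split => //.
  by apply: measurableC; exact: measurableU.
by move=> x /= h Dx; apply: h => _; congr EFin; exact: fg.
Qed.

Let v_sum x j : v_ D1 x ord0 j + v_ D2 x ord0 j = v x ord0 j.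
Proof.
rewrite /v_ !mxE !indicE; have [h1|h1] := pselect (D1 x).
  by rewrite mem_set// memNset ?mul1r ?mul0r ?addr0// => h2; exact: (D12 x).
have [h2|h2] := pselect (D2 x); first by rewrite (memNset h1) mul0r add0r mem_set// mul1r.
by rewrite v0 ?mxE ?mulr0 ?addr0// => -[].
Qed.

(** The indicators of the two sides add up to 1 almost everywhere, and [c . grad phi] integrates to
    0 over the whole space, so [c] disappears. On a single side it would leave a boundary term. *)
Lemma div_total phi L : 0 <= L -> sm phi -> (forall x, phi x != 0 -> cube R n L x) ->
  Io (fun x : 'rV[R]_n => \sum_j v x ord0 j * partial j phi x) = 0.
Proof.
move=> L0 sp pL.
have cp j := sm_continuous _ (sm_partialE _ j sp).
have ps j x := partial_supp phi L j x pL.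
have e1 := vdiv D1 (or_introl erefl) phi L L0 sp pL.
have e2 := vdiv D2 (or_intror erefl) phi L L0 sp pL.
have I1 : Int (fun x : 'rV[R]_n => \sum_j (v_ D1 x ord0 j - \1_D1 x * c ord0 j) * partial j phi x).
  have : Int (fun x : 'rV[R]_n => \sum_j partial j phi x * divfree c D1 (v_ D1) x j).
    by apply: Int_sum => j; apply: (IntSw c D1 (v_ D1) mD1 (vloc_ D1 (or_introl erefl)) (partial j phi) j L L0 (cp j) (ps j)).
  by apply: Int_eq => x; apply: eq_bigr => j _; rewrite mulrC.
have I2 : Int (fun x : 'rV[R]_n => \sum_j (v_ D2 x ord0 j - \1_D2 x * c ord0 j) * partial j phi x).
  have : Int (fun x : 'rV[R]_n => \sum_j partial j phi x * divfree c D2 (v_ D2) x j).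
    by apply: Int_sum => j; apply: (IntSw c D2 (v_ D2) mD2 (vloc_ D2 (or_intror erefl)) (partial j phi) j L L0 (cp j) (ps j)).
  by apply: Int_eq => x; apply: eq_bigr => j _; rewrite mulrC.
have Ij j : Int (fun x : 'rV[R]_n => v x ord0 j * partial j phi x).
  have := IntS v vloc (partial j phi) j L L0 (cp j) (ps j).
  by apply: Int_eq => x; rewrite mulrC.
have Ip j : Int (partial j phi) := IntC _ L L0 (cp j) (ps j).
have p0 j : Io (partial j phi) = 0.
  apply: (Io_partial0 phi j L) => //; [exact: sm_continuous|by move=> x; exact: sm_derivable].
have Ic : Int (fun x : 'rV[R]_n => \sum_j c ord0 j * partial j phi x).
  by apply: Int_sum => j; exact: Int_scale.
have ec : Io (fun x : 'rV[R]_n => \sum_j c ord0 j * partial j phi x) = 0.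
  rewrite Io_sum; last by move=> j; exact: Int_scale.
  by rewrite big1// => j _; rewrite Io_scale// p0 mulr0.
transitivity (Io (fun x : 'rV[R]_n => (\sum_j (v_ D1 x ord0 j - \1_D1 x * c ord0 j) * partial j phi x +
    \sum_j (v_ D2 x ord0 j - \1_D2 x * c ord0 j) * partial j phi x) + \sum_j c ord0 j * partial j phi x)); last first.
  rewrite Io_add//; last exact: Int_add.
  by rewrite Io_add// e1 e2 ec !addr0.
apply: Io_ae; [exact: Int_sum|by apply: Int_add => //; exact: Int_add|move=> x Dx].
rewrite -!big_split/=; apply: eq_bigr => j _.
rewrite -!mulrDl; congr (_ * _); rewrite -v_sum.
have : \1_D1 x + \1_D2 x = 1 :> R.
  rewrite !indicE; case: Dx => h.
    by rewrite mem_set// memNset ?addr0// => h2; exact: (D12 x).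
  by rewrite [x \in D2]mem_set// memNset ?add0r// => h2; exact: (D12 x).
move: (\1_D1 x) (\1_D2 x) (v_ D1 x ord0 j) (v_ D2 x ord0 j) => a1 a2 w1 w2 h.
have -> : a2 = 1 - a1 by rewrite -h; ring.
ring.
Qed.

(** [div_total] removes [v . grad ((c.x) F)] from the integral of [cch c.v], and only the angular
    momentum of the shell remains. *)
Lemma cv_bound : exists C : R, 0 <= C /\ forall r, 0 < r ->
  `|Io (fun x : 'rV[R]_n => cch r x * dot c (v x))| <= C * r^-1.
Proof.
have [H H1 hH] := @chi_bounded R.
have H0 : 0 <= H := le_trans ler01 H1.
pose A i j (x : 'rV[R]_n) := x ord0 i * v x ord0 j - x ord0 j * v x ord0 i.
pose G x := \sum_j \sum_i `|c ord0 i| * `|A i j x|.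
have IG : Int G by apply: Int_sum => j; apply: Int_sum => i; apply: Int_scale; apply: Int_norm; exact: vam.
exists (H * 4 * Io G); split.
  apply: mulr_ge0; first exact: mulr_ge0.
  by apply: Io_ge0 => x; apply: sumr_ge0 => j _; apply: sumr_ge0 => i _; exact: mulr_ge0.
move=> r rp; have rr : 0 <= 2 * r by rewrite mulr_ge0// ltW.
pose F (x : 'rV[R]_n) := 1 - step 0 (rad r x).
have sF : sm0 F by apply: sm0_sub; [exact: sm0_cst|apply: sm0_step; exact: sm0_rad].
pose phi x := dot c x * F x.
have sp : sm phi by apply: sm_sm0; apply: sm0_mul => //; exact: sm0_dotl.
have pL x : phi x != 0 -> cube R n (2 * r) x.
  rewrite /phi mulf_eq0 negb_or => /andP[_ h]; apply: enorm_cube; apply: rad_le2 => //.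
  rewrite leNgt; apply/negP => h2; move/eqP: h; apply.
  by rewrite /F step_ge2 ?subrr// ltW.
have dphi x j : partial j phi x = dot c x * (- step 1 (rad r x) * (2 * (r ^+ 2)^-1 * x ord0 j)) + F x * c ord0 j.
  have h1 := is_derive_dotl c x (basis_vec R j).
  have h2 : is_derive x (basis_vec R j) F (- step 1 (rad r x) * (2 * (r ^+ 2)^-1 * x ord0 j)).
    apply: (partial_rad (fun y => 1 - step 0 y) (fun y => - step 1 y)) => t.
    have h := is_derive_step 0 t; by apply: (is_derive_eq (is_deriveB (is_derive_cst (1 : R) t 1) h)); exact: sub0r.
  by rewrite (partial_val _ _ _ _ (is_derive_mulf _ _ _ _ _ _ h1 h2)) (dotC c (basis_vec R j)) dot_basis.
(* The double sum is [(c.x)(x.v) - |x|^2 (c.v)]. On the support of [step 1] its weights [x_j / r^2]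
   are [O(1/r)], and they multiply integrable densities. *)
pose W (x : 'rV[R]_n) := 2 * (r ^+ 2)^-1 * step 1 (rad r x) * \sum_j x ord0 j * \sum_i c ord0 i * A i j x.
have E x : cch r x * dot c (v x) = \sum_j v x ord0 j * partial j phi x + W x.
  have e1 : \sum_j x ord0 j * \sum_i c ord0 i * A i j x = dot c x * dot x (v x) - dot x x * dot c (v x).
    rewrite {1 3}/dot mulr_sumr mulr_suml -sumrB.
    have e0 j : \sum_i c ord0 i * A i j x = dot c x * v x ord0 j - x ord0 j * dot c (v x).
      rewrite /dot mulr_suml mulr_sumr -sumrB; apply: eq_bigr => i _; rewrite /A; ring.
    under eq_bigr do rewrite e0.
    rewrite -/(dot c x).
    by apply: eq_bigr => j _; move: (dot c x) (dot c (v x)) => *; ring.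
  have e2 : \sum_j v x ord0 j * partial j phi x =
     - (dot c x * step 1 (rad r x) * (2 * (r ^+ 2)^-1)) * dot x (v x) + F x * dot c (v x).
    rewrite /dot !mulr_sumr -big_split/= -/(dot c x); apply: eq_bigr => j _; rewrite dphi.
    by move: (dot c x) (step 1 _) (F x) ((r ^+ 2)^-1) => *; ring.
  rewrite /W e1 e2 /cch /chi0 /F {2}/rad.
  by move: (dot c x) (dot x x) (dot c (v x)) (dot x (v x)) (step 1 _) (step 0 _) ((r ^+ 2)^-1) => *; ring.
have sS : sm0 (fun x : 'rV[R]_n => 2 * (r ^+ 2)^-1 * step 1 (rad r x)).
  by apply: sm0_mul; [exact: sm0_cst|apply: sm0_step; exact: sm0_rad].
have k0 : 0 <= 2 * (r ^+ 2)^-1 by rewrite mulr_ge0// invr_ge0 exprn_ge0// ltW.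
have Wb x : `|W x| <= H * 4 * r^-1 * G x.
  have [h|h] := eqVneq (step 1 (rad r x)) 0.
    rewrite /W h mulr0 mul0r normr0 mulr_ge0//; first by rewrite !mulr_ge0// invr_ge0 ltW.
    by apply: sumr_ge0 => j _; apply: sumr_ge0 => i _; exact: mulr_ge0.
  have /andP[y1 y2] := step1_supp 0 _ h.
  have xr := rad_le2 _ _ rp y2.
  have -> : H * 4 * r^-1 * G x = 2 * (r ^+ 2)^-1 * H * (2 * r * G x) by field; rewrite gt_eqF.
  rewrite /W normrM ler_pM//.
    by rewrite normrM (ger0_norm k0) ler_wpM2l//; have [] := hH (rad r x).
  rewrite /G mulr_sumr; apply: (le_trans (ler_norm_sum _ _ _)); apply: ler_sum => j _.
  rewrite normrM ler_pM//; first exact: le_trans (coord_enorm x j) xr.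
  by apply: (le_trans (ler_norm_sum _ _ _)); apply: ler_sum => i _; rewrite normrM.
have cp j := sm_continuous _ (sm_partialE _ j sp).
have ps j x := partial_supp phi (2 * r) j x pL.
have ID : Int (fun x : 'rV[R]_n => \sum_j v x ord0 j * partial j phi x).
  apply: Int_sum => j; have := IntS v vloc (partial j phi) j (2 * r) rr (cp j) (ps j).
  by apply: Int_eq => x; rewrite mulrC.
have Ich : Int (fun x : 'rV[R]_n => cch r x * dot c (v x)).
  have : Int (fun x : 'rV[R]_n => \sum_j c ord0 j * (cch r x * v x ord0 j)).
    apply: Int_sum => j; apply: Int_scale.
    apply: (IntS v vloc (cch r) j (2 * r) rr); last by move=> x; exact: cch_supp.
    by apply: sm0_continuous; exact: sm0_cch.
  by apply: Int_eq => x; rewrite /dot mulr_sumr; apply: eq_bigr => j _; rewrite mulrCA.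
have IW : Int W.
  by have := Int_sub _ _ Ich ID; apply: Int_eq => x; rewrite E addrAC subrr add0r.
rewrite (Io_eq _ _ E) Io_add// (div_total phi (2 * r) rr sp pL) add0r.
rewrite [H * 4 * Io G]mulrC -mulrA [Io G * _]mulrC -Io_scale//.
apply: Io_abs_le => //; [exact: Int_meas|exact: Int_scale].
Qed.

Let V x := \sum_j (v x ord0 j) ^+ 2.
Let V0 x : 0 <= V x. Proof. by apply: sumr_ge0 => j _; exact: sqr_ge0. Qed.

Let IntV (f : 'rV[R]_n -> R) (L : R) : 0 <= L -> continuous f -> (forall x, f x != 0 -> cube R n L x) -> Int (fun x => f x * V x).
Proof.
move=> L0 cf fL; have [B B0 fB] := bounded_of_supp _ _ cf fL.
have : Int (fun x : 'rV[R]_n => \sum_j f x * (\1_(cube R n L) x * (v x ord0 j) ^+ 2)).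
  by apply: Int_sum => j; apply: (Int_mulb _ _ B (vloc2 j L L0)) => //; exact: continuous_measurable_rV.
apply: Int_eq => x; rewrite /V mulr_sumr; apply: eq_bigr => j _.
have [->|/fL h] := eqVneq (f x) 0; first by rewrite !mul0r.
by rewrite indicE mem_set// mul1r.
Qed.

(** On each side the one-sided integrand is the indicator of that side times [cch (|v|^2 - c.v)], so
    the two estimates add up over the whole space, and [cv_bound] takes care of [c.v]. *)
Lemma energy : exists C r1 : R, forall r, r1 <= r -> Io (fun x => cch r x * V x) <= C * r `^ (- eps).
Proof.
have [C1 [r1 h1]] := vest D1 (or_introl erefl).
have [C2 [r2 h2]] := vest D2 (or_intror erefl).
have [C [C0 hC]] := cv_bound.
exists (C1 + C2 + C), (Num.max 1 (Num.max r1 r2)) => r.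
rewrite !ge_max => /andP[r_1 /andP[rr1 rr2]].
have rp : 0 < r := lt_le_trans ltr01 r_1.
have rr : 0 <= 2 * r by rewrite mulr_ge0// ltW.
have {}h1 := h1 r rr1; have {}h2 := h2 r rr2; have {}hC := hC r rp.
have cc : continuous (cch (m := m) r) by apply: sm0_continuous; exact: sm0_cch.
have cs := @cch_supp R m r rp.
have I1 : Int (fun x => cch r x * V x) by exact: (IntV _ (2 * r)).
have I2 : Int (fun x : 'rV[R]_n => cch r x * dot c (v x)).
  have : Int (fun x : 'rV[R]_n => \sum_j c ord0 j * (cch r x * v x ord0 j)).
    by apply: Int_sum => j; apply: Int_scale; exact: (IntS v vloc (cch r) j (2 * r) rr cc cs).
  by apply: Int_eq => x; rewrite /dot mulr_sumr; apply: eq_bigr => j _; rewrite mulrCA.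
pose g x := cch r x * V x - cch r x * dot c (v x).
have Ig : Int g by exact: Int_sub.
have eD D x : \sum_j cch r x * divfree c D (v_ D) x j * v_ D x ord0 j = \1_D x * g x.
  rewrite /g /V /dot -mulrBr -sumrB mulrCA !mulr_sumr; apply: eq_bigr => j _.
  rewrite /divfree /v_ !mxE indicE; case: (_ \in _) => /=; rewrite ?mul0r ?mulr0 ?mul1r//; ring.
have ID (D : set 'rV[R]_n) : measurable D -> Int (fun x : 'rV[R]_n => \1_D x * g x).
  move=> mD; apply: (Int_mulb g \1_D 1 Ig); first exact: measurable_indic.
  by move=> x; rewrite indicE; case: (_ \in _); rewrite ?normr1 ?normr0.
have eg : Io g = Io (fun x => \1_D1 x * g x) + Io (fun x => \1_D2 x * g x).
  rewrite -Io_add; [|exact: ID|exact: ID].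
  apply: Io_ae => //; first by apply: Int_add; exact: ID.
  move=> x [h|h]; rewrite -mulrDl !indicE.
    by rewrite mem_set// memNset ?addr0 ?mul1r// => h3; exact: (D12 x).
  by rewrite [x \in D2]mem_set// memNset ?add0r ?mul1r// => h3; exact: (D12 x).
rewrite (Io_eq _ _ (eD D1)) in h1; rewrite (Io_eq _ _ (eD D2)) in h2.
have re : r^-1 <= r `^ (- eps) by rewrite -powR_inv1 ?(ltW rp)// ler_powR// lerN2.
have := ler_wpM2l C0 re; rewrite Io_sub// in eg.
move: h1 h2 hC; rewrite !ler_norml => /andP[_ ?] /andP[_ ?] /andP[_ ?].
rewrite 2!mulrDl; lra.
Qed.

Lemma powR_small (C e : R) : 0 < e -> exists r1 : R, forall r, r1 <= r -> C * r `^ (- eps) <= e.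
Proof.
move=> e0; pose K := Num.max 1 (C / e).
have K0 : 0 < K by rewrite lt_max ltr01.
exists (K `^ eps^-1) => r hr.
have r0' : 0 < r by apply: lt_le_trans hr; exact: powR_gt0.
have Kr : K <= r `^ eps.
  have := @ge0_ler_powR R eps (ltW eps0) (K `^ eps^-1) r.
  rewrite !nnegrE powR_ge0 ltW// => /(_ isT isT hr).
  by rewrite -powRrM mulVf ?gt_eqF// powRr1// ltW.
have p0 : 0 < r `^ eps by exact: powR_gt0.
rewrite powRN ler_pdivrMr// mulrC -ler_pdivrMr//.
by apply: le_trans Kr; rewrite le_max lexx orbT.
Qed.

(** The cutoff is 1 for [|x| < r] but need not be nonnegative in the shell beyond. Adding [be] times
    the indicator of a cube restores a majorant of the left side, at a cost of order [r^(n - 2 b)],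
    which tends to 0. *)
Lemma V_zero (L : R) : 0 <= L -> Io (fun x => \1_(cube R n L) x * V x) <= 0.
Proof.
move=> L0; have [H H1 hH] := @chi_bounded R.
have H0 : 0 <= H := le_trans ler01 H1.
have [C [r1 hC]] := energy.
apply/ler_addgt0Pr => e e0; rewrite add0r.
pose C4 := H * (n%:R * Cu ^+ 2) * 4 ^+ n.
have C40 : 0 <= C4 by apply: mulr_ge0; [rewrite !mulr_ge0// sqr_ge0|exact: exprn_ge0].
have [r2 hr2] := powR_small (C + C4) e e0.
pose r := Num.max r1 (Num.max r2 (Num.max r0 (n%:R * L + 1))).
have [rr1 rr2 rr0 rL] : [/\ r1 <= r, r2 <= r, r0 <= r & n%:R * L + 1 <= r].
  by split; rewrite /r !le_max lexx ?orbT.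
have r_1 : 1 <= r := le_trans r01 rr0.
have rp : 0 < r := lt_le_trans ltr01 r_1.
have rr : 0 <= 2 * r by rewrite mulr_ge0// ltW.
have cc : continuous (cch (m := m) r) by apply: sm0_continuous; exact: sm0_cch.
have cs := @cch_supp R m r rp.
have I1 : Int (fun x => cch r x * V x) by exact: (IntV _ (2 * r)).
pose be := H * (n%:R * (Cu * r `^ (- b)) ^+ 2).
have be0 : 0 <= be by apply: mulr_ge0 => //; apply: mulr_ge0 => //; exact: sqr_ge0.
have I2 : Int (fun x => be * \1_(cube R n (2 * r)) x) by apply: Int_scale; exact: Int_cube.
apply: le_trans (hr2 r rr2); rewrite mulrDl.
apply: (@le_trans _ _ (Io (fun x => cch r x * V x + be * \1_(cube R n (2 * r)) x))); last first.
  rewrite Io_add//; apply: lerD; first exact: hC.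
  rewrite Io_scale; last exact: Int_cube.
  rewrite Io_cube// (_ : 2 * r + 2 * r = 4 * r); last by ring.
  have -> : be * (4 * r) ^+ n = C4 * (r `^ (- b) * r `^ (- b) * r ^+ n).
    rewrite /be /C4 [(4 * r) ^+ n]exprMn; move: (r `^ _) (4 ^+ n) (r ^+ n) => *; ring.
  have rn : r != 0 by rewrite gt_eqF.
  rewrite ler_wpM2l// -powR_mulrn ?(ltW rp)// -!powRD; try by apply/implyP => /eqP; rewrite (negbTE rn).
  rewrite ler_powR// bE; have : (1 : R) <= m%:R by rewrite ler1n.
  by rewrite -(natr1 m) => m1; exact: exponent_le.
apply: Io_le; [|exact: Int_add|].
  have : Int (fun x : 'rV[R]_n => \sum_j \1_(cube R n L) x * (v x ord0 j) ^+ 2) by apply: Int_sum => j; exact: vloc2.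
  by apply: Int_eq => x; rewrite mulr_sumr.
move=> x; have b2 : 0 <= be * \1_(cube R n (2 * r)) x by rewrite mulr_ge0.
have [xr|xr] := ltP (enorm x) r.
  rewrite /cch chi0_lt1 ?mul1r; last exact: rad_lt1.
  apply: (@le_trans _ _ (V x)); last by rewrite lerDl.
  by rewrite ler_piMl// indicE; case: (_ \in _).
rewrite [\1_(cube R n L) x]indicE memNset ?mul0r; last first.
  move=> xL; have : enorm x <= n%:R * L.
    apply: (le_trans (enorm_l1 x)); rewrite mulr_natl -[n in leRHS]card_ord -sumr_const.
    by apply: ler_sum => i _; exact: xL.
  by move: xr rL; lra.
have [->|h] := eqVneq (cch r x) 0; first by rewrite mul0r add0r.
rewrite indicE mem_set ?mulr1; last exact: cs.
have Vb : V x <= n%:R * (Cu * r `^ (- b)) ^+ 2.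
  rewrite mulr_natl -[n in leRHS]card_ord -sumr_const; apply: ler_sum => j _.
  rewrite -real_normK ?num_real// lerXn2r ?nnegrE//; first by rewrite mulr_ge0// powR_ge0.
  apply: (le_trans (vdec x j (le_trans rr0 xr))); rewrite ler_wpM2l// powRN_le//.
  by rewrite bE addr_ge0// ltW.
have [+ _ _] := hH (rad r x); rewrite -/(cch r x) => hc.
have : `|cch r x * V x| <= be by rewrite normrM (ger0_norm (V0 x)) ler_pM.
by rewrite ler_norml => /andP[+ _]; lra.
Qed.

Lemma v_ae0 : {ae leb R n, forall x, v x = 0}.
Proof.
have h (k : nat) : {ae leb R n, forall x, cube R n k%:R x -> V x = 0}.
  have L0 : 0 <= k%:R :> R by [].
  have I : Int (fun x => \1_(cube R n k%:R) x * V x).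
    have : Int (fun x : 'rV[R]_n => \sum_j \1_(cube R n k%:R) x * (v x ord0 j) ^+ 2) by apply: Int_sum => j; exact: vloc2.
    by apply: Int_eq => x; rewrite mulr_sumr.
  have e : (\int[leb R n]_x `|(\1_(cube R n k%:R) x * V x)%:E| = 0)%E.
    under eq_integral do rewrite gee0_abs ?lee_fin ?mulr_ge0//.
    rewrite -[LHS]fineK; last exact: (integrable_fin_num measurableT I).
    congr EFin; apply/eqP; rewrite eq_le V_zero//=.
    by apply: Io_ge0 => x; rewrite mulr_ge0.
  have mI : measurable_fun setT (fun x => (\1_(cube R n k%:R) x * V x)%:E) by exact: measurable_int I.
  have := (ae_eq_integral_abs _ measurableT mI).1 e.
  apply: filterS => x hx xk; have := EFin_inj (hx Logic.I).
  by rewrite indicE mem_set// mul1r.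
have := ae_foralln h.
apply: filterS => x hx.
have [k hk] : exists k : nat, `|x| <= k%:R by exists (Num.bound `|x|); apply/ltW/archi_boundP.
have /eqP := hx k (cube_exhaust _ _ _ _ hk); rewrite psumr_eq0; last by move=> j _; exact: sqr_ge0.
move=> /allP hj; apply/rowP => j; rewrite mxE; apply/eqP; rewrite -sqrf_eq0.
exact: (hj j (mem_index_enum _)).
Qed.

End twosided.

Lemma ver_pt {R : realType} {m : nat} (x' : 'rV[R]_m) (t : R) : ver (pt x' t) = t.
Proof. by rewrite /ver mxE unlift_none. Qed.

Lemma hor_pt {R : realType} {m : nat} (x' : 'rV[R]_m) (t : R) : hor (pt x' t) = x'.
Proof. by apply/rowP => i; rewrite !mxE liftK. Qed.

(** * Waves *)

Section geometry.
Context {R : realType} {m : nat} (eta : 'rV[R]_m -> R) (heta : Ck_bdd 2 eta).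
Local Notation n := m.+1.

Lemma eta_bounded : exists M : R, forall x, `|eta x| <= M.
Proof. by case: heta. Qed.

Lemma eta_lip : exists2 k : R, 0 <= k & forall x y, `|eta x - eta y| <= k * \sum_i `|x ord0 i - y ord0 i|.
Proof.
have [_ _ h] := heta.
have h' i : exists M : R, forall x, `|partial i eta x| <= M by have [_ [_ [M hM] _]] := h i; exists M.
have [M hM] := choice h'.
exists (\sum_i `|M i|); first exact: sumr_ge0.
apply: lip_of_partials; first by move=> i x; have [] := h i.
move=> i x; apply: (le_trans (hM i x)); apply: (le_trans (ler_norm _)).
by rewrite (bigD1 i)//= lerDl sumr_ge0.
Qed.

Lemma measurable_hor : measurable_fun setT (@hor R m).
Proof.
apply: measurable_fun_rV => i; apply: (eq_measurable_fun (fun x : 'rV[R]_n => x ord0 (lift ord_max i) : measurableTypeR R)).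
  by move=> x _; rewrite mxE.
exact: measurable_coord.
Qed.

Lemma measurable_height : measurable_fun setT (fun x : 'rV[R]_n => ver x - eta (hor x)).
Proof.
apply: measurable_funB; first exact: (measurable_coord ord_max).
apply: (measurableT_comp (continuous_measurable_rV _ _ eta _) measurable_hor).
by have [] := heta.
Qed.

Lemma measurable_below : measurable (below eta).
Proof.
have -> : below eta = (fun x : 'rV[R]_n => ver x - eta (hor x)) @^-1` `]-oo, 0[.
  by apply/seteqP; split => x /=; rewrite /below /= in_itv/= subr_lt0.
by rewrite -[X in measurable X]setTI; exact: measurable_height.
Qed.

Lemma measurable_above : measurable (above eta).
Proof.
have -> : above eta = (fun x : 'rV[R]_n => ver x - eta (hor x)) @^-1` `]0, +oo[.
  by apply/seteqP; split => x /=; rewrite /above /= in_itv/= andbT subr_gt0.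
by rewrite -[X in measurable X]setTI; exact: measurable_height.
Qed.

(** Each vertical line meets the complement in the single point of height [eta x']. *)
Lemma graph_null : leb R n (~` (below eta `|` above eta)) = 0%E.
Proof.
have mU : measurable (below eta `|` above eta) := measurableU _ _ measurable_below measurable_above.
have mG := measurableC mU.
rewrite -[X in leb R n X]setIT -integral_indic// (leb_tonelli _ _ (fun x => (\1_(~` (below eta `|` above eta)) x)%:E)).
- rewrite (eq_integral (fun=> 0%E)) ?integral0// => x' _.
  transitivity (\int[lebesgue_measure]_t (\1_[set eta x'] t)%:E)%E; last first.
    by rewrite integral_indic// setIT; exact: lebesgue_measure_set1.
  apply: eq_integral => t _; rewrite !indicE.
  suff -> : (pt x' t \in ~` (below eta `|` above eta)) = (t \in [set eta x']) by [].
  apply/idP/idP; rewrite !inE.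
    rewrite /= /below /above /= ver_pt hor_pt => /not_orP[/negP h1 /negP h2].
    by apply/eqP; rewrite eq_le !leNgt h1 h2.
  by move=> -> [] ; rewrite /below /above /= ver_pt hor_pt ltxx.
- by apply/measurable_EFinP; exact: measurable_indic.
- by move=> x; rewrite lee_fin.
Qed.

(** One definition for both fluids, so that the one-sided estimate is proved only once: [s = 1] is
    [below] and [s = -1] is [above]. *)
Definition side (s : R) : set 'rV[R]_n := [set x | s * (ver x - eta (hor x)) < 0].

Lemma side_below : side 1 = below eta.
Proof. by apply/seteqP; split => x; rewrite /side /below /= mul1r subr_lt0. Qed.

Lemma side_above : side (-1) = above eta.
Proof. by apply/seteqP; split => x; rewrite /side /above /= mulN1r oppr_lt0 subr_gt0. Qed.

(** [k] is a Lipschitz constant of [eta] for the l^1 norm. Lateral displacements of at most [2 d] in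
    [m] coordinates change [eta] by at most [2 m k d], which the vertical drop [l d] exceeds. *)
Lemma side_cone : exists2 l : R, 1 <= l & forall s d (x z : 'rV[R]_n), s = 1 \/ s = -1 -> 0 < d -> side s x ->
  (forall i, i != ord_max -> `|x ord0 i - z ord0 i| <= 2 * d) -> l * d <= s * (ver x - ver z) -> side s z.
Proof.
have [k k0 hk] := eta_lip.
exists (1 + k * (m%:R * 2)); first by rewrite lerDl !mulr_ge0.
move=> s d x z hs d0 Dx xz h.
have e : `|s * (eta (hor x) - eta (hor z))| <= k * (m%:R * 2) * d.
  rewrite normrM (_ : `|s| = 1) ?mul1r; last by case: hs => ->; rewrite ?normrN normr1.
  apply: (le_trans (hk _ _)); rewrite -mulrA ler_wpM2l// -mulrA mulr_natl -[m in leRHS]card_ord -sumr_const.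
  by apply: ler_sum => i _; rewrite !mxE; apply: xz; rewrite eq_sym neq_lift.
move: Dx; rewrite /side /=; move: h e; rewrite mulrDl mul1r ler_norml => h /andP[e1 e2] Dx.
have -> : s * (ver z - eta (hor z)) = s * (ver x - eta (hor x)) - s * (ver x - ver z) + s * (eta (hor x) - eta (hor z)) by ring.
move: (s * (ver x - eta (hor x))) (s * (ver x - ver z)) (s * (eta _ - eta _)) h e1 e2 Dx => a1 a2 a3; lra.
Qed.

Lemma side_bounds : exists2 M : R, 1 <= M & forall s, s = 1 \/ s = -1 ->
  (forall x, side s x -> s * ver x <= M) /\ (forall x, s * ver x <= - M -> side s x).
Proof.
have [M hM] := eta_bounded; exists (Num.max 1 (M + 1)); first by rewrite le_max lexx.
move=> s hs; have MM : M + 1 <= Num.max 1 (M + 1) by rewrite le_max lexx orbT.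
have e x : `|s * eta x| <= M.
  by rewrite normrM (_ : `|s| = 1) ?mul1r//; case: hs => ->; rewrite ?normrN normr1.
split => x; have := e (hor x); rewrite ler_norml => /andP[? ?]; rewrite /side /= mulrBr; lra.
Qed.

End geometry.

(** * From the weak formulations to identities and integrability on the whole space *)

Lemma test_cube {R : realType} {n : nat} (D : set 'rV[R]_n) f : test_function D f ->
  exists2 L : R, 0 <= L & forall x, f x != 0 -> cube R n L x.
Proof.
case=> _ cp _; have := compact_bounded cp => -[M [Mr hM]].
exists (`|M| + 1); first by rewrite addr_ge0.
move=> x fx; apply: cube_exhaust; apply: (hM (`|M| + 1)).
  by rewrite (le_lt_trans (ler_norm _))// ltrDl.
exact: subset_closure.
Qed.

Lemma Rintegral_indic {R : realType} {n : nat} (D : set 'rV[R]_n) f :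
  integral_rV D f = Io (fun x => \1_D x * f x).
Proof.
rewrite Rintegral_mkcond; apply: Io_eq => x; rewrite patchE indicE.
by case: ifP => _; rewrite ?mul1r ?mul0r.
Qed.

Lemma integrable_Int {R : realType} {n : nat} (D : set 'rV[R]_n) f : measurable D ->
  (leb R n).-integrable D (EFin \o f) <-> Int (fun x => \1_D x * f x).
Proof.
move=> mD; rewrite (integrable_mkcond _ mD) (_ : (EFin \o f) \_ D = EFin \o (fun x => \1_D x * f x))//.
apply/funext => x; rewrite patchE /= indicE.
by case: ifP => _; rewrite ?mul1r ?mul0r.
Qed.

Section extract.
Context {R : realType} {m : nat}.
Local Notation n := m.+1.
Variables (Om D : set 'rV[R]_n) (u : 'rV[R]_n -> 'rV[R]_n).
Hypotheses (mOm : measurable Om) (mD : measurable D) (DOm : D `<=` Om).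

Lemma loc_Int (f : 'rV[R]_n -> R) (L : R) : loc_integrable setT Om f -> Int (fun x => \1_(cube R n L) x * (\1_Om x * f x)).
Proof.
move=> h; have := h (cube R n L) (compact_cube L) (@subsetT _ _).
rewrite integrable_Int; last by apply: measurableI => //; exact: measurable_cube.
by apply: Int_eq => x; rewrite indicI mulrCA mulrA.
Qed.

Let v_ (A : set 'rV[R]_n) x : 'rV[R]_n := \1_A x *: (\1_Om x *: u x).

Lemma v_E x i : v_ D x ord0 i = \1_D x * u x ord0 i.
Proof.
rewrite /v_ !mxE !indicE; case: (boolP (x \in D)) => [|_]; last by rewrite !mul0r.
by rewrite inE => /DOm h; rewrite [x \in Om]mem_set// !mul1r.
Qed.

Lemma extract_div eta c : incompressible eta D setT c u ->
  forall phi L, 0 <= L -> sm phi -> (forall x, phi x != 0 -> cube R n L x) ->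
  Io (fun x : 'rV[R]_n => \sum_j (v_ D x ord0 j - \1_D x * c ord0 j) * partial j phi x) = 0.
Proof.
move=> h phi L L0 sp pL.
have tp : test_function setT phi.
  by apply: (sm_test phi (cube R n L) setT L sp) => //; exact: closed_cube.
have := h phi tp.
rewrite Rintegral_indic => e.
transitivity (surface_integral eta (fun x : 'rV[R]_n => 0 * phi x)).
  rewrite -e; apply: Io_eq => x; rewrite mul0r addr0 /dot mulr_sumr; apply: eq_bigr => j _.
  by rewrite v_E !mxE mulrA mulrBr.
rewrite /surface_integral -[RHS](@Io_0 R m); apply: Io_eq => x; by rewrite !mul0r.
Qed.

End extract.

Lemma ord2P (i : 'I_2) : i = 0 \/ i = 1.
Proof. by case: i => -[|[|//]] h; [left|right]; exact: val_inj. Qed.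

Lemma ord3P (i : 'I_3) : [\/ i = 0, i = 1 | i = 2%:R].
Proof. by case: i => -[|[|[|//]]] h; [apply: Or31|apply: Or32|apply: Or33]; exact: val_inj. Qed.

Lemma perp0 {R : realType} (x : 'rV[R]_2) : perp x ord0 0 = - x ord0 1.
Proof. by rewrite mxE. Qed.

Lemma perp1 {R : realType} (x : 'rV[R]_2) : perp x ord0 1 = x ord0 0.
Proof. by rewrite mxE. Qed.

Section curl.
Context {R : realType}.

Lemma sum_ord2 (f : 'I_2 -> R) : \sum_i f i = f 0 + f 1.
Proof. by rewrite 2!big_ord_recl big_ord0 addr0; congr (f _ + f _); exact: val_inj. Qed.

Lemma extract_curl2 (D : set 'rV[R]_2) (v u : 'rV[R]_2 -> 'rV[R]_2) : irrotational (m := 1) D u ->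
  (forall x i, v x ord0 i = \1_D x * u x ord0 i) ->
  (forall i L, 0 <= L -> Int (fun x : 'rV[R]_2 => \1_(cube R 2 L) x * v x ord0 i)) ->
  forall phi i j, test_function D phi ->
  Io (fun x : 'rV[R]_2 => v x ord0 i * partial j phi x) = Io (fun x : 'rV[R]_2 => v x ord0 j * partial i phi x).
Proof.
move=> hu vE vloc phi + + tp; have [L L0 pL] := test_cube D phi tp.
have [cp _ _] := tp.
have cpj j : continuous (partial j phi) by have [_ /(_ j)[_ []]] := cp 1%N.
have I i j : Int (fun x : 'rV[R]_2 => v x ord0 i * partial j phi x).
  have := IntS v vloc (partial j phi) i L L0 (cpj j) (fun x => partial_supp phi L j x pL).
  by apply: Int_eq => x; rewrite mulrC.
have e : Io (fun x : 'rV[R]_2 => v x ord0 1 * partial 0 phi x) = Io (fun x : 'rV[R]_2 => v x ord0 0 * partial 1 phi x).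
  have := hu phi tp; rewrite /curl2_pairing Rintegral_indic => /eqP; rewrite oppr_eq0 => /eqP e.
  apply/eqP; rewrite -subr_eq0 -Io_sub//; apply/eqP; rewrite -[RHS]e; apply: Io_eq => x.
  by rewrite /dot sum_ord2 !vE /gradperp perp0 perp1 !mxE; move: (\1_D x) (partial 0 phi x) (partial 1 phi x) => *; ring.
move=> i j; case: (ord2P i) => ->; case: (ord2P j) => ->; [exact: erefl|exact: esym e|exact: e|exact: erefl].
Qed.

Lemma extract_curl3 (D : set 'rV[R]_3) (v u : 'rV[R]_3 -> 'rV[R]_3) : irrotational (m := 2) D u ->
  (forall x i, v x ord0 i = \1_D x * u x ord0 i) ->
  (forall i L, 0 <= L -> Int (fun x : 'rV[R]_3 => \1_(cube R 3 L) x * v x ord0 i)) ->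
  forall phi i j, test_function D phi ->
  Io (fun x : 'rV[R]_3 => v x ord0 i * partial j phi x) = Io (fun x : 'rV[R]_3 => v x ord0 j * partial i phi x).
Proof.
move=> hu vE vloc phi + + tp; have [L L0 pL] := test_cube D phi tp.
have [cp _ _] := tp.
have cpj j : continuous (partial j phi) by have [_ /(_ j)[_ []]] := cp 1%N.
have I i j : Int (fun x : 'rV[R]_3 => v x ord0 i * partial j phi x).
  have := IntS v vloc (partial j phi) i L L0 (cpj j) (fun x => partial_supp phi L j x pL).
  by apply: Int_eq => x; rewrite mulrC.
have key k i j : (forall x, cross (grad phi x) (u x) ord0 k = partial j phi x * u x ord0 i - partial i phi x * u x ord0 j) ->
   Io (fun x : 'rV[R]_3 => v x ord0 i * partial j phi x) = Io (fun x : 'rV[R]_3 => v x ord0 j * partial i phi x).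
  move=> hk; have := hu k phi tp; rewrite /curl3_pairing Rintegral_indic => /eqP; rewrite oppr_eq0 => /eqP e.
  apply/eqP; rewrite -subr_eq0 -Io_sub//; apply/eqP; rewrite -[RHS]e; apply: Io_eq => x.
  by rewrite hk !vE; ring.
have e0 := key 0 2%:R 1; have e1 := key 1 0 2%:R; have e2 := key 2%:R 1 0.
have {}e0 : Io (fun x : 'rV[R]_3 => v x ord0 2%:R * partial 1 phi x) = Io (fun x : 'rV[R]_3 => v x ord0 1 * partial 2%:R phi x).
  by apply: e0 => x; rewrite !mxE.
have {}e1 : Io (fun x : 'rV[R]_3 => v x ord0 0 * partial 2%:R phi x) = Io (fun x : 'rV[R]_3 => v x ord0 2%:R * partial 0 phi x).
  by apply: e1 => x; rewrite !mxE.
have {}e2 : Io (fun x : 'rV[R]_3 => v x ord0 1 * partial 0 phi x) = Io (fun x : 'rV[R]_3 => v x ord0 0 * partial 1 phi x).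
  by apply: e2 => x; rewrite !mxE.
move=> i j; case: (ord3P i) => ->; case: (ord3P j) => ->.
- exact: erefl.
- exact: esym e2.
- exact: e1.
- exact: e2.
- exact: erefl.
- exact: esym e0.
- exact: esym e1.
- exact: e0.
- exact: erefl.
Qed.

End curl.

Section angular.
Context {R : realType}.

(** The hypothesis concerns the density [rho] times the quantity wanted; as [1/rho] is bounded,
    dividing by [rho] keeps it integrable. *)
Lemma Int_weight {n : nat} (Om : set 'rV[R]_n) (rho f g : 'rV[R]_n -> R) (K : R) : measurable Om ->
  measurable_fun setT rho -> (forall x, 0 < rho x) -> (forall x, (rho x)^-1 <= K) ->
  (leb R n).-integrable Om (EFin \o f) -> (forall x, f x = rho x * g x) -> Int (fun x => \1_Om x * g x).
Proof.
move=> mOm mr r0 rK /(integrable_Int Om f mOm).1 h fg.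
have mri : measurable_fun setT (fun x => (rho x)^-1 : R).
  have : measurable_fun setT (fun x => (rho x) `^ (-1)) by exact: (measurableT_comp (measurable_powR _ )).
  by apply: eq_measurable_fun => x _; rewrite powR_inv1// ltW.
have := Int_mulb _ (fun x => (rho x)^-1) K h mri.
have b x : `|(rho x)^-1| <= K by rewrite ger0_norm// invr_ge0 ltW.
move=> /(_ b); apply: Int_eq => x; rewrite fg; field.
by rewrite gt_eqF.
Qed.

Lemma extract_am2 (Om : set 'rV[R]_2) (rho : 'rV[R]_2 -> R) (u : 'rV[R]_2 -> 'rV[R]_2) (K : R) : measurable Om ->
  measurable_fun setT rho -> (forall x, 0 < rho x) -> (forall x, (rho x)^-1 <= K) ->
  finite_angular_momentum (m := 1) Om rho u ->
  forall i j, Int (fun x : 'rV[R]_2 => \1_Om x * (x ord0 i * u x ord0 j - x ord0 j * u x ord0 i)).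
Proof.
move=> mOm mr r0 rK h.
have e : Int (fun x : 'rV[R]_2 => \1_Om x * (x ord0 0 * u x ord0 1 - x ord0 1 * u x ord0 0)).
  apply: (Int_weight Om rho _ _ K mOm mr r0 rK h) => x.
  by rewrite /dot sum_ord2 perp0 perp1 !mxE; ring.
have z i : Int (fun x : 'rV[R]_2 => \1_Om x * (x ord0 i * u x ord0 i - x ord0 i * u x ord0 i)).
  by apply: Int_eq (@Int_0 R 2) => x; rewrite subrr mulr0.
have e' : Int (fun x : 'rV[R]_2 => \1_Om x * (x ord0 1 * u x ord0 0 - x ord0 0 * u x ord0 1)).
  by apply: Int_eq (Int_scale (-1) _ e) => x; ring.
move=> i j; case: (ord2P i) => ->; case: (ord2P j) => ->; [exact: z|exact: e|exact: e'|exact: z].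
Qed.

Lemma extract_am3 (Om : set 'rV[R]_3) (rho : 'rV[R]_3 -> R) (u : 'rV[R]_3 -> 'rV[R]_3) (K : R) : measurable Om ->
  measurable_fun setT rho -> (forall x, 0 < rho x) -> (forall x, (rho x)^-1 <= K) ->
  finite_angular_momentum (m := 2) Om rho u ->
  forall i j, Int (fun x : 'rV[R]_3 => \1_Om x * (x ord0 i * u x ord0 j - x ord0 j * u x ord0 i)).
Proof.
move=> mOm mr r0 rK h.
have z i : Int (fun x : 'rV[R]_3 => \1_Om x * (x ord0 i * u x ord0 i - x ord0 i * u x ord0 i)).
  by apply: Int_eq (@Int_0 R 3) => x; rewrite subrr mulr0.
have sym i j : Int (fun x : 'rV[R]_3 => \1_Om x * (x ord0 i * u x ord0 j - x ord0 j * u x ord0 i)) ->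
   Int (fun x : 'rV[R]_3 => \1_Om x * (x ord0 j * u x ord0 i - x ord0 i * u x ord0 j)).
  by move=> hij; apply: Int_eq (Int_scale (-1) _ hij) => x; ring.
have e0 : Int (fun x : 'rV[R]_3 => \1_Om x * (x ord0 1 * u x ord0 2%:R - x ord0 2%:R * u x ord0 1)).
  by apply: (Int_weight Om rho _ _ K mOm mr r0 rK (h 0)) => x; rewrite !mxE/=; ring.
have e1 : Int (fun x : 'rV[R]_3 => \1_Om x * (x ord0 2%:R * u x ord0 0 - x ord0 0 * u x ord0 2%:R)).
  by apply: (Int_weight Om rho _ _ K mOm mr r0 rK (h 1)) => x; rewrite !mxE/=; ring.
have e2 : Int (fun x : 'rV[R]_3 => \1_Om x * (x ord0 0 * u x ord0 1 - x ord0 1 * u x ord0 0)).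
  by apply: (Int_weight Om rho _ _ K mOm mr r0 rK (h 2%:R)) => x; rewrite !mxE/=; ring.
move=> i j; case: (ord3P i) => ->; case: (ord3P j) => ->.
- exact: z.
- exact: e2.
- exact: sym e1.
- exact: sym e2.
- exact: z.
- exact: e0.
- exact: e1.
- exact: sym e0.
- exact: z.
Qed.

End angular.

(** * Triviality of vortex sheets with finite angular momentum *)

Section sheet.
Context {R : realType}.

(** [irrotational] is defined by cases on [m], so the dimension has to be concrete before the
    pairing can be unfolded. *)
Lemma extract_curl {m : nat} (D : set 'rV[R]_m.+1) (v u : 'rV[R]_m.+1 -> 'rV[R]_m.+1) : m = 1%N \/ m = 2%N -> irrotational D u ->
  (forall x i, v x ord0 i = \1_D x * u x ord0 i) ->
  (forall i L, 0 <= L -> Int (fun x : 'rV[R]_m.+1 => \1_(cube R m.+1 L) x * v x ord0 i)) ->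
  forall phi i j, test_function D phi ->
  Io (fun x : 'rV[R]_m.+1 => v x ord0 i * partial j phi x) = Io (fun x : 'rV[R]_m.+1 => v x ord0 j * partial i phi x).
Proof. by case=> hm; subst m; [exact: extract_curl2|exact: extract_curl3]. Qed.

Lemma extract_am {m : nat} (Om : set 'rV[R]_m.+1) (rho : 'rV[R]_m.+1 -> R) (u : 'rV[R]_m.+1 -> 'rV[R]_m.+1) (K : R) :
  m = 1%N \/ m = 2%N -> measurable Om ->
  measurable_fun setT rho -> (forall x, 0 < rho x) -> (forall x, (rho x)^-1 <= K) ->
  finite_angular_momentum Om rho u ->
  forall i j, Int (fun x : 'rV[R]_m.+1 => \1_Om x * (x ord0 i * u x ord0 j - x ord0 j * u x ord0 i)).
Proof. by case=> hm; subst m; [exact: extract_am2|exact: extract_am3]. Qed.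

Context {m : nat}.
Local Notation n := m.+1.

Lemma measurable_density (eta : 'rV[R]_m -> R) (a b : R) : Ck_bdd 2 eta -> measurable_fun setT (sheet_density eta a b).
Proof.
move=> heta; apply: (eq_measurable_fun (fun x => \1_(below eta) x * a + (1 - \1_(below eta) x) * b)).
  move=> x _; rewrite /sheet_density indicE; case: ifP => h.
    by rewrite mem_set// mul1r subrr mul0r addr0.
  by rewrite memNset ?mul0r ?add0r ?subr0 ?mul1r//; rewrite /below /= h.
have mi : measurable_fun setT (\1_(below eta) : 'rV[R]_n -> R) by apply: measurable_indic; exact: measurable_below.
by apply: measurable_funD; apply: measurable_funM => //; apply: measurable_funB.
Qed.

Lemma density_inv (eta : 'rV[R]_m -> R) (a b : R) x : 0 < a -> 0 < b ->
  0 < sheet_density eta a b x /\ (sheet_density eta a b x)^-1 <= a^-1 + b^-1.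
Proof.
move=> a0 b0; rewrite /sheet_density; case: ifP => _; split => //.
  by rewrite lerDl invr_ge0 ltW.
by rewrite lerDr invr_ge0 ltW.
Qed.

(** The hypotheses of the previous sections are verified for [v], which is [u] off the interface and
    0 on it, and for the restrictions of [v] to the two fluids, with [s = 1] and [s = -1]. *)
Lemma sheet_trivial (hm : m = 1%N \/ m = 2%N) (g sigma rho_m rho_p : R) (c' : 'rV[R]_m)
  (eps : R) (heps : 0 < eps) (heps4 : eps < 1 / 4)
  (eta : 'rV[R]_m -> R) (heta : Ck_bdd 2 eta)
  (u : 'rV[R]_n -> 'rV[R]_n) (P : 'rV[R]_n -> R) :
  0 < rho_m -> 0 < rho_p ->
  case_II g sigma rho_m rho_p c' eta u P ->
  bigO_infty (above eta `|` below eta) (fun x => enorm (u x)) (m%:R + eps) ->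
  finite_angular_momentum (above eta `|` below eta) (sheet_density eta rho_m rho_p) u ->
  {ae leb R n, forall x, (above eta `|` below eta) x -> u x = 0}.
Proof.
move=> rm0 rp0 [[uloc uloc2 _] [div_m div_p] [cur_m cur_p] _] [C0 [r00 [r000 hdec]]] ham.
set Om := above eta `|` below eta in uloc uloc2 hdec ham *.
have mb : measurable (below eta) := measurable_below eta heta.
have ma : measurable (above eta) := measurable_above eta heta.
have mOm : measurable Om := measurableU _ _ ma mb.
pose v x : 'rV[R]_n := \1_Om x *: u x.
pose v_ (D : set 'rV[R]_n) x : 'rV[R]_n := \1_D x *: v x.
(* The constants in [bigO_infty] come without a sign or a lower bound of 1; the estimates use
   [Cu >= 0] and [r0 >= 1]. *)
pose b := m%:R + eps; pose Cu := `|C0|; pose r0 := Num.max 1 r00.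
have m0 : (0 < m)%N by case: hm => ->.
have b1 : 1 < b by rewrite /b ltr_pwDr// ler1n.
have r01 : 1 <= r0 by rewrite le_max lexx.
have v0 x : ~ (below eta `|` above eta) x -> v x = 0.
  by move=> h; rewrite /v indicE memNset ?scale0r// => -[h1|h1]; apply: h; [right|left].
have vloc i L : 0 <= L -> Int (fun x : 'rV[R]_n => \1_(cube R n L) x * v x ord0 i).
  move=> L0; have := loc_Int Om mOm _ L (uloc i).
  by apply: Int_eq => x; rewrite /v mxE.
have vloc2 i L : 0 <= L -> Int (fun x : 'rV[R]_n => \1_(cube R n L) x * v x ord0 i ^+ 2).
  move=> L0; have := loc_Int Om mOm _ L (uloc2 i).
  apply: Int_eq => x; rewrite /v mxE exprMn indicE; congr (_ * (_ * _)).
  by rewrite indicE; case: (_ \in _); rewrite ?expr1n ?expr0n.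
have vdec x i : r0 <= enorm x -> `|v x ord0 i| <= Cu * enorm x `^ (- b).
  rewrite ge_max => /andP[_ h]; rewrite /v mxE indicE.
  have X0 : 0 <= Cu * enorm x `^ (- b) by apply: mulr_ge0; [exact: normr_ge0|exact: powR_ge0].
  case: (boolP (x \in Om)) => [|_]; last by rewrite mul0r normr0.
  rewrite inE mul1r => /hdec/(_ h); rewrite ger0_norm ?enorm_ge0// => h2.
  apply: (le_trans (coord_enorm _ i)); apply: (le_trans h2).
  by rewrite ler_wpM2r ?powR_ge0// ler_norm.
have vdiv D : D = below eta \/ D = above eta -> forall phi L, 0 <= L -> sm phi -> (forall x, phi x != 0 -> cube R n L x) ->
    Io (fun x : 'rV[R]_n => \sum_j (v_ D x ord0 j - \1_D x * pt c' 0 ord0 j) * partial j phi x) = 0.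
  case=> ->.
    by apply: (extract_div Om _ u _ eta (pt c' 0) div_m) => x h; right.
  by apply: (extract_div Om _ u _ eta (pt c' 0) div_p) => x h; left.
have vam i j : Int (fun x : 'rV[R]_n => x ord0 i * v x ord0 j - x ord0 j * v x ord0 i).
  have := extract_am Om _ u (rho_m^-1 + rho_p^-1) hm mOm (measurable_density eta rho_m rho_p heta) _ _ ham i j.
  move=> h; apply: (Int_eq _ _ _ (h _ _)).
  - by move=> x; rewrite /v !mxE; ring.
  - by move=> x; have [] := density_inv eta rho_m rho_p x rm0 rp0.
  - by move=> x; have [] := density_inv eta rho_m rho_p x rm0 rp0.
have D12 x : below eta x -> above eta x -> False.
  by rewrite /below /above /= => h1 h2; have := lt_trans h1 h2; rewrite ltxx.
have est s : s = 1 \/ s = -1 -> side eta s = below eta \/ side eta s = above eta -> irrotational (side eta s) u ->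
   exists C r1 : R, forall r, r1 <= r ->
  `|Io (fun x : 'rV[R]_n => \sum_j cch r x * divfree (pt c' 0) (side eta s) (v_ (side eta s)) x j * v_ (side eta s) x ord0 j)| <= C * r `^ (- eps).
  move=> hs hD hcur; set D := side eta s in hD hcur *.
  have mD : measurable D by case: hD => ->.
  have DOm : D `<=` Om by move=> x; case: hD => -> h; [right|left].
  have [l l1 hl] := side_cone eta heta; have [M M1 hM] := side_bounds eta heta.
  have [DM MD] := hM s hs.
  have vE x i : v_ D x ord0 i = \1_D x * u x ord0 i by exact: v_E.
  have vDE x i : v_ D x ord0 i = \1_D x * v x ord0 i by rewrite [LHS]mxE.
  have abs1 x i : `|v_ D x ord0 i| <= `|v x ord0 i|.
    by rewrite vDE normrM ler_piMl// indicE; case: (_ \in _); rewrite ?normr1 ?normr0.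
  have vDloc i L : 0 <= L -> Int (fun x : 'rV[R]_n => \1_(cube R n L) x * v_ D x ord0 i).
    move=> L0; have := Int_mulb _ \1_D 1 (vloc i L L0) (measurable_indic mD).
    have b' x : `|\1_D x : R| <= 1 by rewrite indicE; case: (_ \in _); rewrite ?normr1 ?normr0.
    by move=> /(_ b'); apply: Int_eq => x; rewrite vDE mulrCA.
  have vDloc2 i L : 0 <= L -> Int (fun x : 'rV[R]_n => \1_(cube R n L) x * v_ D x ord0 i ^+ 2).
    move=> L0; have := Int_mulb _ \1_D 1 (vloc2 i L L0) (measurable_indic mD).
    have b' x : `|\1_D x : R| <= 1 by rewrite indicE; case: (_ \in _); rewrite ?normr1 ?normr0.
    move=> /(_ b'); apply: Int_eq => x; rewrite vDE exprMn mulrCA; congr (_ * (_ * _)).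
    by rewrite indicE; case: (_ \in _); rewrite ?expr1n ?expr0n.
  have vDam i j : Int (fun x : 'rV[R]_n => x ord0 i * v_ D x ord0 j - x ord0 j * v_ D x ord0 i).
    have := Int_mulb _ \1_D 1 (vam i j) (measurable_indic mD).
    have b' x : `|\1_D x : R| <= 1 by rewrite indicE; case: (_ \in _); rewrite ?normr1 ?normr0.
    by move=> /(_ b'); apply: Int_eq => x; rewrite !vDE; ring.
  have cone' (d : R) (x z : 'rV[R]_n) : 0 < d -> D x ->
    (forall i, i != ord_max -> `|x ord0 i - z ord0 i| <= 2 * d) -> l * d <= s * (ver x - ver z) -> D z.
    by move=> d0 Dx h1 h2; exact: (hl s d x z).
  have vD0 x : ~ D x -> v_ D x = 0 by move=> Dx; rewrite /v_ indicE memNset// scale0r.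
  have vDdec x i : r0 <= enorm x -> `|v_ D x ord0 i| <= Cu * enorm x `^ (- b).
    by move=> h; apply: (le_trans (abs1 x i)); exact: vdec.
  have vDcurl := extract_curl D (v_ D) u hm hcur vE vDloc.
  have eps1 : eps <= 1 by lra.
  exact: (side_est s l M b Cu r0 (pt c' 0) D (v_ D) hs l1 M1 b1 (normr_ge0 _) r01 mD cone' DM MD
    vD0 vDloc vDloc2 vDdec (vdiv D hD) vDcurl vDam (ver_pt c' 0) eps m0 heps eps1 erefl).
have := v_ae0 b Cu r0 eps (pt c' 0) (below eta) (above eta) v m0 heps _ erefl (normr_ge0 _) r01 mb ma D12 (graph_null eta heta) v0 vloc vloc2 vdec vdiv vam.
move=> h; have {h} : {ae leb R n, forall x, v x = 0}.
  apply: h; first by lra.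
  by move=> D [->|->]; [rewrite -side_below|rewrite -side_above]; apply: est; rewrite ?side_below ?side_above; auto.
apply: filterS => x + Omx; by rewrite /v indicE mem_set// scale1r.
Qed.

End sheet.

(** * Dipole moments *)

Section dipole.
Context {R : realType} {n : nat}.
Implicit Types p x : 'rV[R]_n.

Lemma is_derive_enorm x v : 0 < enorm x -> is_derive x v (@enorm R n) (dot v x / enorm x).
Proof.
move=> x0; apply/is_derive_line0.
have h := is_derive_dot x v; move/is_derive_line0 in h.
have q0 : 0 < dot x x by rewrite -sqr_enorm exprn_gt0.
have e : 0 *: v + x = x by rewrite scale0r add0r.
have h2 : is_derive (dot (0 *: v + x) (0 *: v + x)) 1 Num.sqrt (2 * enorm x)^-1.
  by rewrite e; exact: is_derive1_sqrt.
have := @is_derive1_comp R Num.sqrt (fun s : R => dot (s *: v + x) (s *: v + x)) 0 _ _ h2 h.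
congr is_derive.
by field; rewrite gt_eqF.
Qed.

Lemma partial_dipole p x (k : nat) j : 0 < enorm x ->
  partial j (fun y => dot p y / enorm y ^+ k.+1) x =
  p ord0 j / enorm x ^+ k.+1 - k.+1%:R * dot p x * x ord0 j / enorm x ^+ k.+3.
Proof.
move=> x0; apply: partial_val; set e := basis_vec R j.
have xn : enorm x != 0 by rewrite gt_eqF.
have hE := is_derive_enorm x e x0.
have hV : is_derive x e (fun y => (enorm y ^+ k.+1)^-1) ((- (enorm x ^+ k.+1) ^- 2 * (k.+1%:R * enorm x ^+ k)) * (dot e x / enorm x)).
  apply/is_derive_line0; move/is_derive_line0 in hE.
  have e0 : 0 *: e + x = x by rewrite scale0r add0r.
  have h1 : is_derive (enorm x) 1 (fun t : R => t ^+ k.+1) (k.+1%:R * enorm x ^+ k).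
    have := is_deriveX k.+1 (is_derive_id (enorm x) (1 : R)); rewrite exprfctE.
    by rewrite /GRing.scale/= mulr1.
  have h2 : is_derive (enorm (0 *: e + x)) 1 (fun t : R => (t ^+ k.+1)^-1) (- (enorm x ^+ k.+1) ^- 2 * (k.+1%:R * enorm x ^+ k)).
    rewrite e0; have nz : enorm x ^+ k.+1 != 0 by rewrite expf_neq0.
    exact: (@is_deriveV R (fun t : R => t ^+ k.+1) _ _ _ nz h1).
  exact: (@is_derive1_comp R (fun t => (t ^+ k.+1)^-1) (fun s : R => enorm (s *: e + x)) 0 _ _ h2 hE).
have hp := is_derive_dotl p x e.
have h := is_derive_mulf _ _ x e _ _ hp hV.
apply: (is_derive_eq h); rewrite /e (dotC p (basis_vec R j)) !dot_basis [enorm x ^+ k.+3]exprS [enorm x ^+ k.+2]exprS [enorm x ^+ k.+1]exprS expr2.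
have y0 : enorm x ^+ k != 0 by rewrite expf_neq0.
by move: (enorm x ^+ k) y0 => y y0; field; rewrite xn y0.
Qed.
End dipole.

Section dipole_zero.
Context {R : realType} {m : nat} (eta : 'rV[R]_m -> R) (heta : Ck_bdd 2 eta).
Local Notation n := m.+1.
Variables (s : R) (u : 'rV[R]_n -> 'rV[R]_n) (p : 'rV[R]_n).
Hypotheses (hs : s = 1 \/ s = -1).

Let A (x : 'rV[R]_n) := \sum_i p ord0 i * (x ord0 i * u x ord0 ord_max - ver x * u x ord0 i).

Lemma dot_le (q x : 'rV[R]_n) : `|dot q x| <= (\sum_i `|q ord0 i|) * enorm x.
Proof.
rewrite mulr_suml; apply: (le_trans (ler_norm_sum _ _ _)); apply: ler_sum => i _.
by rewrite normrM ler_wpM2l// coord_enorm.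
Qed.

(** The dipole field is [p / |x|^n] plus a multiple of [x]. The radial part has no angular momentum,
    and [p] has no vertical component, so the dipole contributes exactly [- x_n |p|^2 / |x|^n] to
    [A]; the remainder [w] contributes at most [2 S |x| |w|]. *)
Lemma angular_lower (C e r0 : R) x : ver p = 0 -> 0 < enorm x -> 0 <= C ->
  enorm (u x - grad (fun y => dot p y / enorm y ^+ n) x) <= C * enorm x `^ (- (n%:R + e)) ->
  `|ver x| * dot p p / enorm x ^+ n - 2 * (\sum_i `|p ord0 i|) * C * enorm x `^ (- (m%:R + e)) <= `|A x|.
Proof.
move=> p0 x0 C0; set w := u x - _ => hw.
have xn : enorm x != 0 by rewrite gt_eqF.
set S := \sum_i _; have S0 : 0 <= S by exact: sumr_ge0.
pose g j := p ord0 j / enorm x ^+ n - n%:R * dot p x * x ord0 j / enorm x ^+ m.+3.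
have uE j : u x ord0 j = w ord0 j + g j.
  by rewrite /w !mxE partial_dipole// -/(g j) subrK.
have gen (f : 'I_n -> R) : \sum_i p ord0 i * (x ord0 i * f ord_max - ver x * f i) =
    dot p x * f ord_max - ver x * \sum_i p ord0 i * f i.
  rewrite /dot mulr_suml mulr_sumr -sumrB; apply: eq_bigr => i _; ring.
have pn : p ord0 ord_max = 0 by [].
have gs : \sum_i p ord0 i * g i = dot p p / enorm x ^+ n - n%:R * dot p x * dot p x / enorm x ^+ m.+3.
  have E i : p ord0 i * g i = p ord0 i * p ord0 i / enorm x ^+ n - n%:R * dot p x * (p ord0 i * x ord0 i) / enorm x ^+ m.+3.
    by rewrite /g; move: (dot p x) (enorm x ^+ n)^-1 (enorm x ^+ m.+3)^-1 => *; ring.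
  by under eq_bigr do rewrite E; rewrite sumrB -!mulr_suml -mulr_sumr.
have AE : A x = (dot p x * w ord0 ord_max - ver x * dot p w) - ver x * dot p p / enorm x ^+ n.
  rewrite /A gen uE; under eq_bigr do rewrite uE mulrDr.
  rewrite big_split/= gs -/(dot p w) /g pn -/(ver x).
  by move: (dot p x) (dot p p) (dot p w) (w ord0 ord_max) (ver x) (enorm x ^+ n)^-1 (enorm x ^+ m.+3)^-1 => *; ring.
have h1 : `|dot p x * w ord0 ord_max - ver x * dot p w| <= 2 * S * enorm x * enorm w.
  apply: (le_trans (ler_normB _ _)); rewrite !normrM.
  have := ler_pM (normr_ge0 _) (normr_ge0 _) (dot_le p x) (coord_enorm w ord_max).
  have := ler_pM (normr_ge0 _) (normr_ge0 _) (coord_enorm x ord_max) (dot_le p w).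
  rewrite -/S -/(ver x) => b1 b2; apply: (le_trans (lerD b2 b1)).
  by rewrite le_eqVlt; apply/orP; left; apply/eqP; ring.
have h2 : 2 * S * enorm x * enorm w <= 2 * S * C * enorm x `^ (- (m%:R + e)).
  have -> : enorm x `^ (- (m%:R + e)) = enorm x * enorm x `^ (- (n%:R + e)).
    rewrite -{2}[enorm x]powRr1 ?enorm_ge0// -powRD; last by apply/implyP => /eqP; rewrite (negbTE xn).
    by congr (_ `^ _); rewrite -(natr1 m); ring.
  have -> : 2 * S * C * (enorm x * enorm x `^ (- (n%:R + e))) = 2 * S * enorm x * (C * enorm x `^ (- (n%:R + e))) by ring.
  by rewrite ler_wpM2l// !mulr_ge0// enorm_ge0.
have P0 := dot_ge0 p.
have h3 : `|ver x * dot p p / enorm x ^+ n| = `|ver x| * dot p p / enorm x ^+ n.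
  have i0 : 0 <= (enorm x ^+ n)^-1 by rewrite invr_ge0 exprn_ge0 ?enorm_ge0.
  by rewrite !normrM (ger0_norm P0) (ger0_norm i0).
rewrite -h3 AE; have := le_trans h1 h2.
have := ler_normB (dot p x * w ord0 ord_max - ver x * dot p w) (dot p x * w ord0 ord_max - ver x * dot p w - ver x * dot p p / enorm x ^+ n).
rewrite opprB addrC subrK; lra.
Qed.

(** If [|p| > 0], the density is at least [q / h^m] on a box of volume [(2 h)^m h], so its integral
    there is at least a multiple of [h], while integrability bounds it by [K] for all [h]. *)
Lemma dipole_zero : (0 < m)%N -> 
  (forall i j, Int (fun x : 'rV[R]_n => \1_(side eta s) x * (x ord0 i * u x ord0 j - x ord0 j * u x ord0 i))) ->
  dipole_moment (side eta s) u p -> p = 0.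
Proof.
move=> m0 hA [p0 [e e0 [C' [r0 [r00 hC']]]]].
have mD : measurable (side eta s).
  by case: hs => ->; rewrite ?side_below ?side_above; [exact: measurable_below|exact: measurable_above].
have [M M1 hM] := side_bounds eta heta; have [_ MD] := hM s hs.
pose C := `|C'|; have C0 : 0 <= C by exact: normr_ge0.
have hC x : side eta s x -> r0 <= enorm x ->
    enorm (u x - grad (fun y => dot p y / enorm y ^+ n) x) <= C * enorm x `^ (- (n%:R + e)).
  move=> Dx xr; have := hC' x Dx xr; rewrite ger0_norm ?enorm_ge0// => /le_trans; apply.
  by rewrite ler_wpM2r ?powR_ge0// ler_norm.
set S := \sum_i `|p ord0 i|; have S0 : 0 <= S by exact: sumr_ge0.
pose P2 := dot p p.
have P20 : 0 <= P2 by exact: dot_ge0.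
suff : P2 = 0.
  move=> hP; apply/rowP => i; rewrite mxE; apply/eqP; rewrite -sqrf_eq0 eq_le sqr_ge0 andbT -hP.
  exact: coord_dot.
apply/eqP; rewrite eq_le P20 andbT leNgt; apply/negP => P2p.
(* In the box every coordinate is at most [2 h] in absolute value, hence [|x| <= ka h]. *)
pose ka := n%:R * 2 : R.
have ka0 : 0 < ka by rewrite mulr_gt0// ltr0n.
have IA : Int (fun x => \1_(side eta s) x * A x).
  have : Int (fun x : 'rV[R]_n => \sum_i p ord0 i * (\1_(side eta s) x * (x ord0 i * u x ord0 ord_max - x ord0 ord_max * u x ord0 i))).
    by apply: Int_sum => i; apply: Int_scale; exact: hA.
  by apply: Int_eq => x; rewrite /A mulr_sumr; apply: eq_bigr => i _; rewrite mulrCA.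
pose K := Io (fun x => `|\1_(side eta s) x * A x|).
pose q := P2 / ka ^+ n / 2.
have q0 : 0 < q by rewrite !divr_gt0// exprn_gt0.
have [h1 hh1] := powR_small e e0 (2 * S * C) q q0.
(* [h >= M] puts the box inside the fluid, [h >= r0] makes the expansion of [u] valid on it,
   [h >= h1] lets the remainder consume at most half of the main term [2 q / h^m], and the last
   entry contradicts [q h <= K]. *)
pose h := Num.max h1 (Num.max M (Num.max r0 (K / q + 1))).
have [hh hM' hr hK] : [/\ h1 <= h, M <= h, r0 <= h & K / q + 1 <= h].
  by split; rewrite /h !le_max lexx ?orbT.
have h_1 : 1 <= h := le_trans M1 hM'.
have hp : 0 < h := lt_le_trans ltr01 h_1.
pose lo (i : 'I_n) := if i == ord_max then (if s == 1 then - (2 * h) else h) else - h.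
pose hi (i : 'I_n) := if i == ord_max then (if s == 1 then - h else 2 * h) else h.
have lohi i : lo i <= hi i by rewrite /lo /hi; case: ifP => _; [case: ifP => _|]; lra.
have [IG IoG] := Io_box lo hi lohi; set G := fun x => _ in IG IoG.
have vol : \prod_(i < n) (hi i - lo i) = (2 * h) ^+ m * h.
  by rewrite -prod_last; apply: eq_bigr => i _; rewrite /hi /lo; case: ifP => _; [case: ifP => _|]; ring.
have low x : q / h ^+ m * G x <= `|\1_(side eta s) x * A x|.
  have [->|/box_indic bx] := eqVneq (G x) 0; first by rewrite mulr0.
  have -> : G x = 1 by exact: box_eq1.
  have sv : h <= - (s * ver x) /\ `|ver x| <= 2 * h.
    have := bx ord_max; rewrite /lo /hi eqxx -/(ver x) ler_norml.
    case: hs => ->; rewrite ?eqxx ?mul1r ?mulN1r.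
      by move=> /andP[? ?]; split; [|apply/andP; split]; lra.
    rewrite (_ : (-1 == 1 :> R) = false); last by apply/negbTE/eqP; lra.
    by move=> /andP[? ?]; split; [|apply/andP; split]; lra.
  have Dx : side eta s x by apply: MD; move: sv => [? _]; lra.
  have vh : h <= `|ver x|.
    have [sv1 _] := sv; apply: (le_trans sv1); rewrite -mulNr; apply: (le_trans (ler_norm _)).
    by rewrite normrM normrN; case: hs => ->; rewrite ?normrN normr1 mul1r.
  have xh : h <= enorm x := le_trans vh (coord_enorm x ord_max).
  have xk : enorm x <= ka * h.
    apply: (le_trans (enorm_l1 x)); rewrite /ka -mulrA mulr_natl -[n in leRHS]card_ord -sumr_const.
    apply: ler_sum => i _; have [->|im] := eqVneq i ord_max; first by have [] := sv.
    have := bx i; rewrite /lo /hi (negbTE im) -ler_norml => /le_trans; apply; lra.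
  have x0 : 0 < enorm x := lt_le_trans hp xh.
  rewrite mulr1 indicE mem_set// mul1r.
  apply: le_trans (angular_lower C e r0 x p0 x0 C0 (hC x Dx (le_trans hr xh))).
  rewrite -/S -/P2.
  have t1 : h * P2 / (ka * h) ^+ n <= `|ver x| * P2 / enorm x ^+ n.
    rewrite ler_pM//; [by rewrite mulr_ge0// ltW|by rewrite invr_ge0 exprn_ge0// mulr_ge0// ltW|by rewrite ler_wpM2r|].
    rewrite lef_pV2 ?posrE ?exprn_gt0// ?mulr_gt0//.
    by rewrite lerXn2r ?nnegrE ?mulr_ge0// ltW.
  have t2 : 2 * S * C * enorm x `^ (- (m%:R + e)) <= q / h ^+ m.
    apply: (@le_trans _ _ (2 * S * C * h `^ (- (m%:R + e)))).
      by rewrite ler_wpM2l ?mulr_ge0// powRN_le// addr_ge0// ltW.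
    have -> : h `^ (- (m%:R + e)) = h `^ (- e) / h ^+ m.
      rewrite opprD addrC powRD; last by apply/implyP => /eqP; rewrite gt_eqF.
      by rewrite [h `^ (- m%:R)]powRN powR_mulrn// ltW.
    by rewrite mulrA ler_wpM2r ?invr_ge0 ?exprn_ge0 ?(ltW hp)//; exact: hh1.
  have t3 : h * P2 / (ka * h) ^+ n = 2 * q / h ^+ m.
    rewrite /q exprMn [h ^+ n]exprS; field.
    by rewrite !expf_neq0 ?gt_eqF.
  rewrite t3 in t1; move: t1 t2; rewrite -mulrA; lra.
have := Io_le _ _ (Int_scale _ _ IG) (Int_norm _ IA) low.
rewrite Io_scale// IoG vol -/K => hlow.
have : q * h <= K.
  apply: le_trans hlow.
  have -> : q / h ^+ m * ((2 * h) ^+ m * h) = 2 ^+ m * (q * h).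
    by rewrite exprMn; field; rewrite expf_neq0 ?gt_eqF.
  apply: ler_peMl; first exact: mulr_ge0 (ltW q0) (ltW hp).
  by rewrite exprn_ege1// ler1n.
apply/negP; rewrite -ltNge [ltRHS]mulrC -ltr_pdivrMr//.
by apply: lt_le_trans hK; rewrite ltrDl.
Qed.
End dipole_zero.

(* n = m + 1 *)
Theorem corollary1p8 (R : realType) (m : nat) (hm : m = 1%N \/ m = 2%N)
  (g sigma : R) (hg : 0 < g) (hsigma : 0 <= sigma) (c' : 'rV[R]_m)
  (eps : R) (heps : 0 < eps) (heps4 : eps < 1 / 4)
  (eta : 'rV[R]_m -> R) (heta : solitary_profile eps eta)
  (u : 'rV[R]_m.+1 -> 'rV[R]_m.+1) (P : 'rV[R]_m.+1 -> R) :
  ((case_IA g sigma c' eta u P \/ case_IB g sigma c' eta u P) ->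
   bigO_infty (below eta) (fun x => enorm (u x)) (m%:R + eps) ->
   finite_angular_momentum (below eta) (fun=> 1) u ->
   forall p, dipole_moment (below eta) u p -> p = 0)
  /\
  (forall rho_m rho_p : R, 0 < rho_m -> 0 < rho_p ->
   case_II g sigma rho_m rho_p c' eta u P ->
   bigO_infty (above eta `|` below eta) (fun x => enorm (u x)) (m%:R + eps) ->
   (finite_angular_momentum (above eta `|` below eta)
      (sheet_density eta rho_m rho_p) u ->
    forall p_m p_p, dipole_moment (below eta) u p_m ->
      dipole_moment (above eta) u p_p -> p_p = 0 /\ p_m = 0)
   /\
   (~ {ae leb R m.+1, forall x, (above eta `|` below eta) x -> u x = 0} ->
    ~ finite_angular_momentum (above eta `|` below eta)
        (sheet_density eta rho_m rho_p) u)).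
Proof.
have [ceta _ _ _] := heta.
have m0 : (0 < m)%N by case: hm => ->.
have mb := measurable_below eta ceta; have ma := measurable_above eta ceta.
split.
  move=> _ _ ham p; rewrite -side_below; apply: (dipole_zero eta ceta 1 u p (or_introl erefl) m0).
  rewrite side_below; apply: (extract_am (below eta) (fun=> 1) u 1 hm mb _ _ _ ham) => //.
  by move=> x; rewrite invr1.
move=> rho_m rho_p rm0 rp0 hII hdec; split; last first.
  by move=> nontriv ham; apply: nontriv; exact: (sheet_trivial hm _ _ _ _ _ _ heps heps4 _ ceta _ _ rm0 rp0 hII hdec ham).
move=> ham p_m p_p dm dp.
have mOm : measurable (above eta `|` below eta) := measurableU _ _ ma mb.
have IOm i j : Int (fun x : 'rV[R]_m.+1 => \1_(above eta `|` below eta) x * (x ord0 i * u x ord0 j - x ord0 j * u x ord0 i)).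
  apply: (extract_am _ _ u (rho_m^-1 + rho_p^-1) hm mOm (measurable_density eta rho_m rho_p ceta) _ _ ham).
  - by move=> x; have [] := density_inv eta rho_m rho_p x rm0 rp0.
  - by move=> x; have [] := density_inv eta rho_m rho_p x rm0 rp0.
have ID (D : set 'rV[R]_m.+1) i j : measurable D -> D `<=` above eta `|` below eta ->
   Int (fun x : 'rV[R]_m.+1 => \1_D x * (x ord0 i * u x ord0 j - x ord0 j * u x ord0 i)).
  move=> mD DOm; have b1 x : `|\1_D x : R| <= 1 by rewrite indicE; case: (_ \in _); rewrite ?normr1 ?normr0.
  apply: Int_eq (Int_mulb _ \1_D 1 (IOm i j) (measurable_indic mD) b1) => x.
  rewrite !indicE; case: (boolP (x \in D)) => [|_]; last by rewrite !mul0r.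
  by rewrite inE => /DOm h; rewrite [x \in _ `|` _]mem_set// !mul1r.
rewrite -side_below in dm; rewrite -side_above in dp; split.
  apply: (dipole_zero eta ceta (-1) u p_p (or_intror erefl) m0 _ dp) => i j.
  by rewrite side_above; apply: ID => // x; left.
apply: (dipole_zero eta ceta 1 u p_m (or_introl erefl) m0 _ dm) => i j.
by rewrite side_below; apply: ID => // x; right.
Qed.
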